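(* Assume condition (A) (stated in the context). For any $r\geq 1$ there exists a constant $C_r<\infty$ such that for all $\theta\in\Theta$, all observation sequences $y=\{y_n\}_{n\geq 0}$ in $\mathcal{Y}$, all $n\geq 0$, $N\geq 1$ and all $\varphi_n\in\mathrm{Osc}_1(\mathcal{X})$, $$\sqrt{N}\;\mathbb{E}_{\theta}^{y}\left\{\left|\zeta_{\theta,n}^{N}(\varphi_n)-\zeta_{\theta,n}(\varphi_n)\right|^{r}\right\}^{1/r}\leq C_r .$$
   Context: **Model.** $\mathcal{X}$, $\mathcal{Y}$ are measurable spaces with dominating measures denoted $dx$, $dy$; $\Theta\subseteq\mathbb{R}^d$ is open; $\pi_\theta(x)$ is a probability density on $\mathcal{X}$, $f_\theta(x'|x)$ a transition probability density on $\mathcal{X}$, and $g_\theta(y|x)$ a conditional probability density on $\mathcal{Y}$ given $x\in\mathcal{X}$. $\nabla$ is the gradient in $\theta$ and $|\cdot|$ is the norm on $\mathbb{R}^d$. $\nu(\varphi)=\int\nu(dx)\varphi(x)$. $z_{i:j}=(z_i,\dots,z_j)$. **Condition (A).** The dominating measures $dx$ on $\mathcal{X}$ and $dy$ on $\mathcal{Y}$ are finite, and there exist constants $0<\rho,\delta,c<\infty$ such that for all $(x,x',y,\theta)\in\mathcal{X}^2\times\mathcal{Y}\times\Theta$ the derivatives of $\pi_\theta(x)$, $f_\theta(x'|x)$, $g_\theta(y|x)$ with respect to $\theta$ exist and $\rho^{-1}\leq f_\theta(x'|x)\leq\rho$, $\delta^{-1}\leq g_\theta(y|x)\leq\delta$,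 and $|\nabla\log\pi_\theta(x)|\vee|\nabla\log f_\theta(x'|x)|\vee|\nabla\log g_\theta(y|x)|\leq c$. **Oscillation.** $\mathrm{Osc}_1(\mathcal{X})$ is the set of bounded measurable $\varphi:\mathcal{X}\to\mathbb{R}$ with $\sup_{x,x'}|\varphi(x)-\varphi(x')|\leq 1$. **Exact quantities.** Fix $\theta$ and a sequence $y=\{y_n\}_{n\ge0}$. Let $q_{\theta}(x_n|x_{n-1})=g_\theta(y_{n-1}|x_{n-1})f_\theta(x_n|x_{n-1})$ (dependence on $y_{n-1}$ suppressed). $\mathbb{Q}_{\theta,n}(dx_{0:n})$ is the probability measure on $\mathcal{X}^{n+1}$ proportional to $dx_0\pi_\theta(x_0)\prod_{k=1}^n q_\theta(x_k|x_{k-1})dx_k$ (the conditional law of $X_{0:n}$ given $Y_{0:n-1}=y_{0:n-1}$), and $\eta_{\theta,n}$ is its time-$n$ marginal, with $\eta_{\theta,0}(dx)=\pi_\theta(x)dx$. Let $t_{\theta,0}(x_{-1},x_0)=t_{\theta,0}(x_0)=\nabla\log\pi_\theta(x_0)$, $t_{\theta,k}(x_{k-1},x_k)=\nabla\log\big(g_\theta(y_{k-1}|x_{k-1})f_\theta(x_k|x_{k-1})\big)$ for $k>0$, and $T_{\theta,n}(x_{0:n})=\sum_{k=0}^n t_{\theta,k}(x_{k-1},x_k)$. The derivative of the filter is the ($\mathbb{R}^d$-valued) measure $$\zeta_{\theta,n}(\varphi)=\int\mathbb{Q}_{\theta,n}(dx_{0:n})\,T_{\theta,n}(x_{0:n})\big(\varphi(x_n)-\eta_{\theta,n}(\varphi)\big).$$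 **Particle system.** $X_0^{(1)},\dots,X_0^{(N)}$ are i.i.d. from $\eta_{\theta,0}$; given the particles up to time $n-1$, $X_n^{(1)},\dots,X_n^{(N)}$ are i.i.d. from the density (w.r.t. $dx_n$) $\sum_{j}f_\theta(x_n|X_{n-1}^{(j)})g_\theta(y_{n-1}|X_{n-1}^{(j)})\big/\sum_{j}g_\theta(y_{n-1}|X_{n-1}^{(j)})$. $\eta^N_{\theta,n}=\frac1N\sum_{i=1}^N\delta_{X_n^{(i)}}$. $\mathbb{E}_\theta^y$ is expectation with respect to the law of the particle system, for the fixed $\theta$ and $y$. The particle backward kernels are $$M_{\theta,n}^N(x_n,dx_{n-1})=\frac{\eta^N_{\theta,n-1}(dx_{n-1})q_\theta(x_n|x_{n-1})}{\eta^N_{\theta,n-1}(q_\theta(x_n|\cdot))},\quad n>0,$$ and $\mathbb{Q}^N_{\theta,n}(dx_{0:n})=\eta^N_{\theta,n}(dx_n)\prod_{k=n}^{1}M^N_{\theta,k}(x_k,dx_{k-1})$. The particle approximation of the filter derivative is $$\zeta^N_{\theta,n}(\varphi)=\int\mathbb{Q}^N_{\theta,n}(dx_{0:n})\,T_{\theta,n}(x_{0:n})\big(\varphi(x_n)-\eta^N_{\theta,n}(\varphi)\big).$$ *)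

(* Defs.v *)
From HB Require Import structures.
From mathcomp Require Import all_boot all_order all_algebra.
From mathcomp Require Import all_classical all_reals all_analysis.

Set Implicit Arguments.
Unset Strict Implicit.
Unset Printing Implicit Defensive.

Import Order.TTheory GRing.Theory Num.Theory.
Import numFieldNormedType.Exports.

Local Open Scope classical_set_scope.
Local Open Scope ring_scope.

Section euclidean.
Context {R : realType} {d : nat}.

(* The library norm on 'rV[R]_d is the sup norm. *)
Definition enorm (v : 'rV[R]_d) : R := Num.sqrt (\sum_(i < d) v 0 i ^+ 2).

Definition has_gradient (h : 'rV[R]_d -> R) (th : 'rV[R]_d) : Prop :=
  forall i : 'I_d, derivable h th (delta_mx 0 i).

Definition gradient (h : 'rV[R]_d -> R) (th : 'rV[R]_d) : 'rV[R]_d :=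
  \row_(i < d) derive h th (delta_mx 0 i).

End euclidean.

Section densities.
Context {R : realType}.

Definition density {dT} {T : measurableType dT}
    (mu : {measure set T -> \bar R}) (p : T -> R) : Prop :=
  [/\ measurable_fun setT p,
      forall x, 0 <= p x &
      (\int[mu]_x (p x)%:E = 1)%E].

(* [k x' x] stands for k(x' | x). *)
Definition cond_density {dT dS} {T : measurableType dT} {S : measurableType dS}
    (mu : {measure set T -> \bar R}) (k : T -> S -> R) : Prop :=
  measurable_fun setT (fun z : T * S => k z.1 z.2) /\
  forall x, density mu (k ^~ x).

Definition Osc1 {dT} {T : measurableType dT} (phi : T -> R) : Prop :=
  [/\ measurable_fun setT phi,
      exists B : R, forall x, `|phi x| <= B &
      forall x x', `|phi x - phi x'| <= 1].

End densities.

(* The n-fold product of mu, a measure whenever mu is sigma-finite. *)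
Fixpoint pow_measure {R : realType} {dT} {T : measurableType dT}
    (mu : {measure set T -> \bar R}) (n : nat) : set (n.-tuple T) -> \bar R :=
  match n with
  | 0 => dirac [tuple]
  | m.+1 => pushforward (product_measure1 mu (pow_measure mu (n := m)))
              (fun z : T * m.-tuple T => [the m.+1.-tuple T of z.1 :: z.2])
  end.

Section model.
Context {R : realType} {d : nat}.
Context {dX dY : measure_display} {X : measurableType dX} {Y : measurableType dY}.
Variables (mu : {measure set X -> \bar R}) (nu : {measure set Y -> \bar R}).
Variable Theta : set 'rV[R]_d.
(* [pi th x], [f th x' x] and [g th y x] stand for pi_th(x), f_th(x' | x) and
   g_th(y | x); mu and nu are the dominating measures dx and dy. *)
Variable pi : 'rV[R]_d -> X -> R.
Variable f : 'rV[R]_d -> X -> X -> R.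
Variable g : 'rV[R]_d -> Y -> X -> R.

Definition state_space_model : Prop :=
  open Theta /\
  forall th, Theta th ->
    [/\ density mu (pi th),
        cond_density mu (f th) &
        cond_density nu (g th)].

(* Since [ln] is total, the positivity of pi_th(x), without which
   log pi_th(x) is meaningless, has to be required explicitly. *)
Definition condition_A : Prop :=
  [/\ (mu setT < +oo)%E, (nu setT < +oo)%E &
  exists rho delta c : R,
    [/\ 0 < rho, 0 < delta, 0 < c &
    forall (x x' : X) (y : Y) (th : 'rV[R]_d), Theta th ->
      [/\ [/\ has_gradient (fun t => pi t x) th,
              has_gradient (fun t => f t x' x) th &
              has_gradient (fun t => g t y x) th],
          rho^-1 <= f th x' x <= rho,
          delta^-1 <= g th y x <= delta,
          0 < pi th x &
          Num.max (Num.max (enorm (gradient (fun t => ln (pi t x)) th))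
                           (enorm (gradient (fun t => ln (f t x' x)) th)))
                  (enorm (gradient (fun t => ln (g t y x)) th)) <= c]]].

Variables (th : 'rV[R]_d) (y : nat -> Y).

(* q_th(x_n | x_{n-1}) for n > 0. *)
Definition q (n : nat) (x' x : X) : R := g th (y n.-1) x * f th x' x.

(* t_{th,n}(x_{n-1}, x_n); the first argument is a dummy for n = 0. *)
Definition score (n : nat) (x x' : X) : 'rV[R]_d :=
  match n with
  | 0 => gradient (fun t => ln (pi t x')) th
  | m.+1 => gradient (fun t => ln (g t (y m) x * f t x' x)) th
  end.

(* T_{th,n}(x_{0:n}) *)
Definition path_score (n : nat) (x : n.+1.-tuple X) : 'rV[R]_d :=
  \sum_(k < n.+1) score k (tnth x (inord k.-1)) (tnth x k).

Definition path_density (n : nat) (x : n.+1.-tuple X) : R :=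
  pi th (tnth x ord0) *
  \prod_(k < n.+1 | (0 < k)%N) q k (tnth x k) (tnth x (inord k.-1)).

(* Q_{th,n}: the density above with respect to dx_0 ... dx_n, normalized. *)
Definition path_law (n : nat) : set (n.+1.-tuple X) -> \bar R := fun A =>
  (\int[pow_measure mu (n := n.+1)]_(x in A) (path_density x)%:E *
   (fine (\int[pow_measure mu (n := n.+1)]_x (path_density x)%:E))^-1%:E)%E.

Definition eta (n : nat) : set X -> \bar R :=
  pushforward (@path_law n) (fun x => tnth x ord_max).

Definition zeta (n : nat) (phi : X -> R) : 'rV[R]_d :=
  let eta_phi := fine (\int[eta n]_x (phi x)%:E)%E in
  \row_(i < d)
    fine (\int[@path_law n]_x
            (path_score x 0 i * (phi (tnth x ord_max) - eta_phi))%:E)%E.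

Section particle_approximation.
(* [xi n i] is the value of the particle X_n^(i). *)
Context {N : nat}.
Variable xi : nat -> 'I_N -> X.

(* The finitely supported random measures eta^N, M^N and Q^N are represented
   by the integrals of functions against them. *)
Definition etaN (n : nat) (phi : X -> R) : R :=
  N%:R^-1 * \sum_(i < N) phi (xi n i).

Definition MN (n : nat) (x' : X) (phi : X -> R) : R :=
  etaN n.-1 (fun x => phi x * q n x' x) / etaN n.-1 (q n x').

(* Integral of F(x_0, ..., x_n) against the kernels
   M^N_n(x_n, dx_{n-1}) ... M^N_1(x_1, dx_0), for a fixed x_n. *)
Fixpoint backward (n : nat) (x : X) : (n.+1.-tuple X -> R) -> R :=
  match n with
  | 0 => fun F => F [tuple x]
  | m.+1 => fun F =>
      MN m.+1 x (fun x' =>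
        backward x' (fun s : m.+1.-tuple X => F [tuple of rcons s x]))
  end.

Definition QN (n : nat) (F : n.+1.-tuple X -> R) : R :=
  etaN n (fun x => backward x F).

Definition zetaN (n : nat) (phi : X -> R) : 'rV[R]_d :=
  \row_(i < d)
    QN (fun x : n.+1.-tuple X =>
          path_score x 0 i * (phi (tnth x ord_max) - etaN n phi)).

End particle_approximation.

Definition mixture_density {N : nat} (n : nat) (c : 'I_N -> X) (x' : X) : R :=
  (\sum_(j < N) f th x' (c j) * g th (y n.-1) (c j)) /
  \sum_(j < N) g th (y n.-1) (c j).

(* The common conditional law of the particles at time n, given that the
   particles at time n-1 form the array c (irrelevant for n = 0). *)
Definition particle_kernel {N : nat} (n : nat) (c : 'I_N -> X) (B : set X) :
    \bar R :=
  match n with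
  | 0 => \int[mu]_(x in B) (pi th x)%:E
  | _.+1 => \int[mu]_(x in B) (mixture_density n c x)%:E
  end%E.

Section particle_system.
Context {dO : measure_display} {Omega : measurableType dO}.
Variable P : probability Omega R.
Context {N : nat}.
Variable xi : nat -> 'I_N -> {RV P >-> X}.

(* The sigma-algebra generated by the particles at times k < n. *)
Definition past (n : nat) : set (set Omega) :=
  <<s [set A | exists k i B,
         [/\ (k < n)%N, measurable B & A = xi k i @^-1` B]] >>.

(* Conditionally on the past, the X_n^(i) are i.i.d. with law
   [particle_kernel n]; for n = 0 the past is trivial. *)
Definition particle_system : Prop :=
  forall (n : nat) (A : set Omega) (B : 'I_N -> set X),
    past n A -> (forall i, measurable (B i)) ->
    (P (A `&` \bigcap_(i in setT) (xi n i @^-1` B i)) =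
     \int[P]_(w in A)
       \prod_(i < N) particle_kernel n (fun j => xi n.-1 j w) (B i))%E.

End particle_system.

End model.

Arguments particle_system {R d dX dY X Y} mu pi f g th y {dO Omega} P {N} xi.

(* Main.v *)
Require Import Defs.
From HB Require Import structures.
From mathcomp Require Import all_boot all_order all_algebra.
From mathcomp Require Import all_classical all_reals all_analysis.
From mathcomp Require Import measurable_realfun ring lra.

Import Order.TTheory GRing.Theory Num.Theory.
Import numFieldNormedType.Exports.

Local Open Scope classical_set_scope.
Local Open Scope ring_scope.

Set Implicit Arguments.
Unset Strict Implicit.
Unset Printing Implicit Defensive.

(* Write h, hA, hU for the integrals of 1, phi(x_n) and t_{k+1} + ... + t_n over
   the path after time k. In terms of the law E of x_k, the derivative of the
   filter is the covariance of A with V = tau + U (tau the conditional mean of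
   T_k given x_k) plus the mean of C, under E tilted by h, where C is the
   conditional covariance of the future. Since tau^N obeys the same backward
   recursion, this expression is unchanged when eta^N_k is replaced by its
   one-step prediction with tau^N_{k+1}, so that zeta^N - zeta telescopes into
   local errors, each comparing eta^N_k with the law from which the particles
   at time k are drawn. The bounds on q make the tilted kernels contract
   oscillations by 1 - kappa; hence A and C oscillate geometrically little in
   n - k while V has bounded oscillation. A local error is then controlled by
   empirical means of conditionally centred bounded functions, whose moments
   exp(sqrt N |.|) are bounded, and convexity of exp sums them over k. *)

(** * Means and tilted means *)

Section bounded_measurable.
Context {R : realType} {dX : measure_display} {X : measurableType dX}.
Implicit Types F G : X -> R.

(** Bounding the moment of exp(sqrt N |.|) instead of an r-th moment lets a single estimate serve
    every r, which then enters the constant only through a final factor r. The obstacle is that the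
    oscillation of V stays bounded but does not decay: perturbing the tilted means of V and of VA
    separately would leave errors that are not summable over k. Centering both V and A at the
    reference law leaves a product as small as the oscillation of A. A second obstacle is that the
    function averaged over the particles at time k is itself random, as tau^N_k is built from
    earlier particles. It depends on the past and the current state only, so conditional
    independence, given as a formula for events, has to be extended to products of bounded functions
    of the past and one particle. Empirical measures, backward kernels, sampling laws and tilts are
    all handled as positive normalized linear functionals on bounded measurable functions; one
    contraction lemma then serves both directions of time. In a <= q <= b, a kernel and its
    normalizer each cost a factor a / b, whence a rate below (a / b)^2. *)

Definition bmf F :=
  measurable_fun setT F /\ exists B : R, forall x, `|F x| <= B.

Lemma bmf_cst (a : R) : bmf (fun=> a).
Proof. by split; [exact: measurable_cst|exists `|a|]. Qed.

Lemma bmfD F G : bmf F -> bmf G -> bmf (fun x => F x + G x).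
Proof.
move=> [mF [B hB]] [mG [C hC]]; split; first exact: measurable_funD.
by exists (B + C) => x; rewrite (le_trans (ler_normD _ _))// lerD.
Qed.

Lemma bmfM F G : bmf F -> bmf G -> bmf (fun x => F x * G x).
Proof.
move=> [mF [B hB]] [mG [C hC]]; split; first exact: measurable_funM.
by exists (B * C) => x; rewrite normrM ler_pM.
Qed.

Lemma bmfZ (a : R) F : bmf F -> bmf (fun x => a * F x).
Proof. by move=> bF; apply: bmfM => //; exact: bmf_cst. Qed.

Lemma bmfN F : bmf F -> bmf (fun x => - F x).
Proof.
move=> [mF [B hB]]; split; first exact: measurable_funN.
by exists B => x; rewrite normrN.
Qed.

Lemma bmfB F G : bmf F -> bmf G -> bmf (fun x => F x - G x).
Proof. by move=> bF bG; apply: bmfD => //; exact: bmfN. Qed.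

Lemma measurable_fun_inv d (T : measurableType d) (F : T -> R) :
  measurable_fun setT F -> (forall x, 0 < F x) ->
  measurable_fun setT (fun x => (F x)^-1).
Proof.
move=> mF F0; rewrite (_ : (fun x => (F x)^-1) = (fun x => (F x) `^ (-1))).
  exact: measurableT_comp (@measurable_powR R (-1)) mF.
by apply/funext => x; rewrite powR_inv1// ltW.
Qed.

Lemma bmfV (e : R) F : 0 < e -> (forall x, e <= F x) -> bmf F ->
  bmf (fun x => (F x)^-1).
Proof.
move=> e0 eF [mF _]; have F0 x : 0 < F x := lt_le_trans e0 (eF x).
split; first exact: measurable_fun_inv.
by exists e^-1 => x; rewrite gtr0_norm ?invr_gt0// lef_pV2 ?posrE.
Qed.

Record mean (E : (X -> R) -> R) : Prop := Mean {
  meanD : forall F G, bmf F -> bmf G -> E (fun x => F x + G x) = E F + E G;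
  meanZ : forall a F, bmf F -> E (fun x => a * F x) = a * E F;
  mean_ge0 : forall F, bmf F -> (forall x, 0 <= F x) -> 0 <= E F;
  mean1 : E (fun=> 1) = 1 }.

Definition osc_le F (D : R) := forall x y, F x - F y <= D.

Lemma osc_leD F G D D' : osc_le F D -> osc_le G D' ->
  osc_le (fun x => F x + G x) (D + D').
Proof. by move=> oF oG x y; have := oF x y; have := oG x y; lra. Qed.

Lemma osc_le_norm F D x y : osc_le F D -> `|F x - F y| <= D.
Proof. by move=> oF; rewrite ler_norml; have := oF x y; have := oF y x; lra. Qed.

Section mean_theory.
Variables (E : (X -> R) -> R) (ME : mean E).

Lemma mean_cst a : E (fun=> a) = a.
Proof.
have -> : (fun=> a) = (fun x : X => a * (fun=> 1) x).
  by apply/funext => x; rewrite /= mulr1.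
by rewrite (meanZ ME)//; [rewrite (mean1 ME) mulr1|exact: bmf_cst].
Qed.

Lemma meanB F G : bmf F -> bmf G -> E (fun x => F x - G x) = E F - E G.
Proof.
move=> bF bG; rewrite -[in RHS]mulN1r -(meanZ ME)// -(meanD ME)//; last exact: bmfZ.
by congr E; apply/funext => x; rewrite mulN1r.
Qed.

Lemma meanZr a F : bmf F -> E (fun x => F x * a) = E F * a.
Proof.
move=> bF; rewrite mulrC -(meanZ ME)//.
by congr E; apply/funext => x; rewrite mulrC.
Qed.

Lemma mean_le F G : bmf F -> bmf G -> (forall x, F x <= G x) -> E F <= E G.
Proof.
move=> bF bG FG; rewrite -subr_ge0 -meanB//; apply: (mean_ge0 ME).
  exact: bmfB.
by move=> x; rewrite subr_ge0.
Qed.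

Lemma mean_norm F D : bmf F -> (forall x, `|F x| <= D) -> `|E F| <= D.
Proof.
move=> bF FD; rewrite ler_norml -(mean_cst (- D)) -{2}(mean_cst D).
apply/andP; split; (apply: mean_le => //; first exact: bmf_cst) ||
  (apply: mean_le => //; last exact: bmf_cst) => x;
  by have := FD x; rewrite ler_norml => /andP[].
Qed.

Lemma mean_osc F D x : bmf F -> osc_le F D -> `|F x - E F| <= D.
Proof.
move=> bF oF; rewrite -{1}(mean_cst (F x)) -meanB//; last exact: bmf_cst.
apply: mean_norm; first by apply: bmfB => //; exact: bmf_cst.
by move=> y; exact: osc_le_norm.
Qed.

Lemma mean_cov F G D D' : bmf F -> bmf G -> osc_le F D -> osc_le G D' ->
  `|E (fun x => F x * G x) - E F * E G| <= D * D'.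
Proof.
move=> bF bG oF oG.
have -> : E (fun x => F x * G x) - E F * E G =
    E (fun x => (F x - E F) * (G x - E G)).
  rewrite [in RHS](_ : (fun _ => _) = (fun x => (F x * G x - E G * F x) -
      (E F * G x - E F * E G))); last by apply/funext => x; ring.
  have [bFG bGF] := (bmfM bF bG, bmfZ (E G) bF).
  have [bEG bc] := (bmfZ (E F) bG, bmf_cst (E F * E G) : bmf (fun=> _)).
  rewrite meanB; [|exact: bmfB|exact: bmfB].
  by rewrite !meanB// mean_cst !(meanZ ME)//; ring.
apply: mean_norm.
  by apply: bmfM; apply: bmfB => //; exact: bmf_cst.
by move=> x; rewrite normrM ler_pM// mean_osc.
Qed.

Lemma mean_tilt (e : R) (h : X -> R) : 0 < e -> (forall x, e <= h x) -> bmf h ->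
  mean (fun F => E (fun x => h x * F x) / E h).
Proof.
move=> e0 eh bh.
have Eh : 0 < E h.
  by rewrite (lt_le_trans e0)// -(mean_cst e) mean_le//; exact: bmf_cst.
split.
- move=> F G bF bG; rewrite -mulrDl -(meanD ME); [|exact: bmfM..].
  by congr (E _ / _); apply/funext => x; rewrite mulrDr.
- move=> a F bF; rewrite mulrA -(meanZ ME); last exact: bmfM.
  by congr (E _ / _); apply/funext => x; rewrite mulrCA.
- move=> F bF F0; rewrite divr_ge0 ?(ltW Eh)// (mean_ge0 ME)//; first exact: bmfM.
  by move=> x; rewrite mulr_ge0// (le_trans (ltW e0)).
- rewrite [X in E X](_ : _ = h) ?divff ?gt_eqF//.
  by apply/funext => x; rewrite /= mulr1.
Qed.

End mean_theory.

(* With K := E1 - k E2, which is positive of mass 1 - k, K F - (1 - k) D is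
   below (1 - k) F pointwise, hence below (1 - k) E2 F. *)
Lemma mean_contract (E1 E2 : (X -> R) -> R) (k D : R) F :
  mean E1 -> mean E2 -> 0 <= k <= 1 ->
  (forall G, bmf G -> (forall x, 0 <= G x) -> k * E2 G <= E1 G) ->
  bmf F -> osc_le F D -> E1 F - E2 F <= (1 - k) * D.
Proof.
move=> M1 M2 /andP[k0 k1] minor bF oF.
have HK y : E1 F - k * E2 F - (1 - k) * D <= (1 - k) * F y.
  have bG : bmf (fun x => F y + D - F x) by apply: bmfB => //; exact: bmf_cst.
  have G0 x : 0 <= F y + D - F x by have := oF x y; lra.
  have := minor _ bG G0.
  by rewrite !meanB ?mean_cst//; [lra|exact: bmf_cst..].
have := mean_le M2 (bmf_cst _) (bmfZ (1 - k) bF) HK.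
by rewrite (mean_cst M2) (meanZ M2)//; lra.
Qed.

(** * Perturbation of tilted means and covariances *)

Definition tilt (E : (X -> R) -> R) (h F : X -> R) : R :=
  E (fun x => h x * F x) / E h.

(** The influence function at [E] of the tilted mean of [F]: it has mean zero under [E], and its
    mean under another law gives the change of the tilted mean. *)
Definition cnoise (E : (X -> R) -> R) (h F : X -> R) (x : X) : R :=
  h x / E h * (F x - tilt E h F).

(** Its oscillation is small as soon as those of [A] and [C] are, even if [V] has only a bounded
    oscillation. *)
Definition centered (E : (X -> R) -> R) (h A V C : X -> R) (x : X) : R :=
  (V x - tilt E h V) * (A x - tilt E h A) + C x.

(* At the law E of the state at time k, with h, f, k and l the integrals over
   the future path x_{k+1:n} of 1, phi(x_n), T_n phi(x_n) and T_n, this is the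
   derivative of the filter at time n. *)
Definition Zval (E : (X -> R) -> R) (h f k l : X -> R) : R :=
  E k / E h - E f * E l / E h ^+ 2.

Lemma osc_leM F G D D' B : (forall x, `|F x| <= D) ->
  (forall x, `|G x| <= D') -> 2 * D * D' <= B ->
  osc_le (fun x => F x * G x) B.
Proof.
move=> FD GD DB x y.
have H z : `|F z * G z| <= D * D' by rewrite normrM ler_pM.
by have := H x; have := H y; rewrite !ler_norml; lra.
Qed.

Section perturbation.
Variables (h : X -> R) (e rho : R).
Hypotheses (e0 : 0 < e) (eh : forall x, e <= h x) (bh : bmf h).
Hypothesis hrho : forall x y, h x <= rho * h y.

Lemma mean_gt0 E : mean E -> 0 < E h.
Proof.
move=> ME; rewrite (lt_le_trans e0)// -(mean_cst ME e).
by apply: (mean_le ME) => //; exact: bmf_cst.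
Qed.

Lemma mean_cnoise E F : mean E -> bmf F -> E (cnoise E h F) = 0.
Proof.
move=> ME bF; have Eh := mean_gt0 ME.
have -> : cnoise E h F =
    (fun x => (E h)^-1 * (h x * F x) - (E h)^-1 * tilt E h F * h x).
  by apply/funext => x; rewrite /cnoise; ring.
have bhF := bmfM bh bF.
rewrite (meanB ME) ?(meanZ ME)//; try exact: bmfZ.
by rewrite /tilt; field; rewrite gt_eqF.
Qed.

Lemma cnoise_le E F D x : mean E -> bmf F -> osc_le F D ->
  `|cnoise E h F x| <= rho * D.
Proof.
move=> ME bF oF; have Eh := mean_gt0 ME.
rewrite /cnoise normrM ler_pM//; last first.
  exact: (mean_osc (mean_tilt ME e0 eh bh)).
rewrite ger0_norm; last by rewrite divr_ge0 ?(ltW Eh)// (le_trans (ltW e0)).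
rewrite ler_pdivrMr// -(meanZ ME)// -[leLHS](mean_cst ME).
by apply: (mean_le ME) => //; [exact: bmf_cst|exact: bmfZ].
Qed.

(** An exact identity, without remainder: the nonlinearity of the quotient is carried by the ratio
    of normalizers, which is at most [rho]. *)
Lemma tilt_cnoise E E' F : mean E -> mean E' -> bmf F ->
  tilt E h F - tilt E' h F = E' h / E h * E (cnoise E' h F).
Proof.
move=> ME ME' bF; have Eh := mean_gt0 ME; have Eh' := mean_gt0 ME'.
have -> : cnoise E' h F =
    (fun x => (E' h)^-1 * (h x * F x) - (E' h)^-1 * tilt E' h F * h x).
  by apply/funext => x; rewrite /cnoise; ring.
have bhF := bmfM bh bF.
rewrite (meanB ME) ?(meanZ ME)//; try exact: bmfZ.
by rewrite {1}/tilt; field; rewrite !gt_eqF.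
Qed.

Lemma Zval_tilt E A V C : mean E -> bmf A -> bmf V -> bmf C ->
  Zval E h (fun x => h x * A x) (fun x => h x * (V x * A x + C x))
    (fun x => h x * V x) =
  tilt E h (fun x => V x * A x + C x) - tilt E h A * tilt E h V.
Proof.
move=> ME bA bV bC; rewrite /Zval /tilt; have Eh := mean_gt0 ME.
by field; rewrite gt_eqF.
Qed.

(* The tilted covariance does not change when V and A are centered under the
   tilted E', which kills the product of means on the side of E'. *)
Lemma Zval_perturbation E E' A V C L :
  mean E -> mean E' -> bmf A -> bmf V -> bmf C -> osc_le V L ->
  `|Zval E h (fun x => h x * A x) (fun x => h x * (V x * A x + C x))
      (fun x => h x * V x) -
    Zval E' h (fun x => h x * A x) (fun x => h x * (V x * A x + C x))
      (fun x => h x * V x)| <=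
  rho * (`|E (cnoise E' h (centered E' h A V C))| + L * `|E (cnoise E' h A)|).
Proof.
move=> ME ME' bA bV bC oV; rewrite !Zval_tilt//.
set G := centered _ _ _ _ _; set v := tilt E' h V; set a := tilt E' h A.
have bG : bmf G.
  by apply: bmfD => //; apply: bmfM; apply: bmfB => //; exact: bmf_cst.
have bVA : bmf (fun x => V x * A x + C x) by apply: bmfD => //; exact: bmfM.
have TG S : mean S -> tilt S h G = tilt S h (fun x => V x * A x + C x)
    - a * tilt S h V - v * tilt S h A + v * a.
  move=> MS; have MT := mean_tilt MS e0 eh bh.
  rewrite -/(tilt S h) in MT; rewrite -(meanZ MT)// -(meanZ MT)//.
  rewrite -(mean_cst MT (v * a)) -(meanB MT)//; last exact: bmfZ.
  rewrite -(meanB MT)//; [|by apply: bmfB => //; exact: bmfZ|exact: bmfZ].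
  rewrite -(meanD MT)//; [|by do 2 (apply: bmfB => //; last exact: bmfZ)|exact: bmf_cst].
  by congr tilt; apply/funext => x; rewrite /G /centered -/a -/v; ring.
have Eh := mean_gt0 ME; have Eh' := mean_gt0 ME'.
have MT := mean_tilt ME e0 eh bh; rewrite -/(tilt E h) in MT.
have -> : tilt E h (fun x => V x * A x + C x) - tilt E h A * tilt E h V -
  (tilt E' h (fun x => V x * A x + C x) - tilt E' h A * tilt E' h V) =
  (tilt E h G - tilt E' h G) -
  (tilt E h A - tilt E' h A) * (tilt E h V - v).
  by rewrite !TG// -/v -/a; ring.
have tV : `|tilt E h V - v| <= L.
  rewrite -(mean_cst MT v) -(meanB MT)//; last exact: bmf_cst.
  apply: (mean_norm MT) => [|x]; first by apply: bmfB => //; exact: bmf_cst.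
  exact: (mean_osc (mean_tilt ME' e0 eh bh)).
rewrite (tilt_cnoise (F := G))// (tilt_cnoise (F := A))//.
have r0 : 0 < E' h / E h by rewrite divr_gt0.
have rr : E' h / E h <= rho.
  rewrite ler_pdivrMr// -(meanZ ME)// -[leLHS](mean_cst ME).
  apply: (mean_le ME) => [||x]; [exact: bmf_cst|exact: bmfZ|].
  rewrite -[leRHS](mean_cst ME') (mean_le ME')//; exact: bmf_cst.
move: (E' h / E h) r0 rr => s s0 srho.
rewrite (le_trans (ler_normB _ _))// !normrM (gtr0_norm s0) mulrDr lerD//.
  by rewrite ler_wpM2r.
rewrite -mulrA ler_pM ?mulr_ge0 ?(ltW s0)// mulrC ler_wpM2r//.
Qed.

End perturbation.

End bounded_measurable.

(** * The backward semigroup *)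

Section integral_of_bounded.
Context {R : realType} {dX : measure_display} {X : measurableType dX}.

Lemma bounded_bmf (F : X -> R) : (exists B : R, forall x, `|F x| <= B) ->
  [bounded F x | x in setT].
Proof.
move=> [B FB]; exists B; split; first exact: num_real.
by move=> M BM x _ /=; rewrite (le_trans (FB x))// ltW.
Qed.

Lemma integrableM_bmf (mu : {measure set X -> \bar R}) (p F : X -> R) :
  mu.-integrable setT (EFin \o p) -> bmf F ->
  mu.-integrable setT (EFin \o (fun x => p x * F x)).
Proof.
move=> ip [mF /bounded_bmf bF].
have := integrableMl measurableT ip mF bF.
by apply: eq_integrable.
Qed.

Lemma density_integrable (mu : {measure set X -> \bar R}) (p : X -> R) :
  density mu p -> mu.-integrable setT (EFin \o p).
Proof.
move=> [mp p0 p1]; apply/integrableP; split; first exact/measurable_EFinP.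
by under eq_integral do rewrite /= ger0_norm//; rewrite p1 ltry.
Qed.

Lemma mean_density (mu : {measure set X -> \bar R}) (p : X -> R) :
  density mu p -> mean (fun F => \int[mu]_x (p x * F x)).
Proof.
move=> dp; have ip := density_integrable dp; have [mp p0 p1] := dp; split.
- move=> F G bF bG; rewrite -RintegralD//; [|exact: integrableM_bmf..].
  by apply: eq_Rintegral => x _; rewrite mulrDr.
- move=> a F bF; rewrite -RintegralZl//; last exact: integrableM_bmf.
  by apply: eq_Rintegral => x _; rewrite mulrCA.
- by move=> F bF F0; apply: Rintegral_ge0 => x _; rewrite mulr_ge0.
- rewrite /Rintegral; under eq_integral do rewrite mulr1.
  by rewrite p1.
Qed.

Lemma measurable_Rintegral (mu : {finite_measure set X -> \bar R})
    d (T : measurableType d) (G : T -> X -> R) :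
  measurable_fun setT (fun z : T * X => G z.1 z.2) ->
  measurable_fun setT (fun w => \int[mu]_x G w x).
Proof.
move=> mG; rewrite /Rintegral; apply: measurableT_comp => //.
under eq_fun do rewrite integralE.
have mE : measurable_fun setT (fun z : T * X => (G z.1 z.2)%:E).
  exact/measurable_EFinP.
apply: emeasurable_funB.
  apply: eq_measurable_fun (measurable_fun_fubini_tonelli_F (m2 := mu) _
    (measurable_funepos mE) (fun z => funepos_ge0 _ z)) => w _.
  by apply: eq_integral => x _; rewrite !funeposE.
apply: eq_measurable_fun (measurable_fun_fubini_tonelli_F (m2 := mu) _
  (measurable_funeneg mE) (fun z => funeneg_ge0 _ z)) => w _.
by apply: eq_integral => x _; rewrite !funenegE.
Qed.

Variable mu : {finite_measure set X -> \bar R}.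

Lemma bmf_integrable (F : X -> R) : bmf F -> mu.-integrable setT (EFin \o F).
Proof.
move=> [mF /bounded_bmf bF]; apply: measurable_bounded_integrable => //.
by rewrite ltey_eq fin_num_measure.
Qed.

Lemma Rintegral_norm_le (F : X -> R) B : bmf F -> (forall x, `|F x| <= B) ->
  `|\int[mu]_x F x| <= B * fine (mu setT).
Proof.
move=> bF FB; have iF := bmf_integrable bF.
rewrite (le_trans (le_normr_Rintegral _ iF))// -Rintegral_cst//.
apply: le_Rintegral => //; last exact: bmf_integrable (bmf_cst B).
apply: bmf_integrable; case: bF => mF [D FD]; split.
  exact: measurableT_comp.
by exists D => x; rewrite normr_id.
Qed.

Lemma bmf_Rintegral d (T : measurableType d) (G : T -> X -> R) :
  bmf (fun z : T * X => G z.1 z.2) -> bmf (fun w => \int[mu]_x G w x).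
Proof.
move=> [mG [B GB]]; split; first exact: measurable_Rintegral.
exists (B * fine (mu setT)) => w; apply: Rintegral_norm_le => [|x].
  split; last by exists B => x; exact: (GB (w, x)).
  exact: (measurableT_comp mG (pair1_measurable w)).
exact: (GB (w, x)).
Qed.

End integral_of_bounded.

Section comp_bmf.
Context {R : realType} d d' (S : measurableType d) (T : measurableType d').

Lemma bmf_comp (F : T -> R) (u : S -> T) : bmf F -> measurable_fun setT u ->
  bmf (F \o u).
Proof.
move=> [mF [B FB]] mu; split; first exact: measurableT_comp.
by exists B => x; exact: FB.
Qed.

End comp_bmf.

Lemma osc_le_of_norm {R : realType} {dX} {X : measurableType dX} (F : X -> R) c :
  (forall x, `|F x| <= c) -> osc_le F (2 * c).
Proof. by move=> Fc x y; have := Fc x; have := Fc y; rewrite !ler_norml; lra. Qed.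

Lemma ler_sub_near {R : realFieldType} (s1 s2 v1 v2 B : R) (K : R) :
  s1 - s2 <= B -> `|v1| <= 2^-1 * K -> `|v2| <= 2^-1 * K ->
  (s1 + v1) - (s2 + v2) <= B + K.
Proof. by rewrite !ler_norml; lra. Qed.

Section semigroup.
Context {R : realType} {dX : measure_display} {X : measurableType dX}.
Variable mu : {finite_measure set X -> \bar R}.
Variables (q t : nat -> X -> X -> R).

(* [Vsg m k psi x] and [Wsg m k psi x] are the integrals of psi(x_{k+m}) and of
   (t_{k+1} + ... + t_{k+m}) psi(x_{k+m}) against the unnormalized law of
   x_{k+1}, ..., x_{k+m} started from x_k = x. *)
Fixpoint Vsg (m k : nat) (psi : X -> R) (x : X) : R :=
  match m with
  | 0 => psi x
  | m'.+1 => \int[mu]_x' (q k.+1 x' x * Vsg m' k.+1 psi x')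
  end.

Fixpoint Wsg (m k : nat) (psi : X -> R) (x : X) : R :=
  match m with
  | 0 => 0
  | m'.+1 => \int[mu]_x' (q k.+1 x' x *
      (t k.+1 x x' * Vsg m' k.+1 psi x' + Wsg m' k.+1 psi x'))
  end.

Variables (a b c : R).
Hypotheses (a0 : 0 < a) (c0 : 0 <= c).
Hypothesis mq : forall k, measurable_fun setT (fun z : X * X => q k.+1 z.1 z.2).
Hypothesis qab : forall k x' x, a <= q k.+1 x' x <= b.
Hypothesis mt : forall k, measurable_fun setT (fun z : X * X => t k.+1 z.1 z.2).
Hypothesis tc : forall k x x', `|t k.+1 x x'| <= c.
Hypothesis muT : (0 < mu setT)%E.

Let mu_gt0 : 0 < fine (mu setT).
Proof. by rewrite fine_gt0// muT ltey_eq fin_num_measure. Qed.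

Lemma q_gt0 k x' x : 0 < q k.+1 x' x.
Proof. by have /andP[] := qab k x' x; move=> /(lt_le_trans a0). Qed.

Lemma bmf_q k : bmf (fun z : X * X => q k.+1 z.2 z.1).
Proof.
split; first exact: (measurableT_comp (mq k) (@measurable_swap _ _ X X)).
exists b => z; rewrite gtr0_norm ?q_gt0//; by have /andP[] := qab k z.2 z.1.
Qed.

Lemma bmf_t k : bmf (fun z : X * X => t k.+1 z.1 z.2).
Proof. by split => //; exists c => z; exact: tc. Qed.

Lemma bmf_q1 k x : bmf (fun x' => q k.+1 x' x).
Proof. exact: (bmf_comp (bmf_q k) (pair1_measurable x)). Qed.

Lemma bmf_t1 k x : bmf (fun x' => t k.+1 x x').
Proof. exact: (bmf_comp (bmf_t k) (pair1_measurable x)). Qed.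

Lemma bmf_V m k psi : bmf psi -> bmf (Vsg m k psi).
Proof.
move=> bpsi; elim: m k => [//|m IH] k /=.
apply: bmf_Rintegral; apply: bmfM; first exact: bmf_q.
exact: (bmf_comp (IH k.+1) (@measurable_snd _ _ X X)).
Qed.

Lemma bmf_W m k psi : bmf psi -> bmf (Wsg m k psi).
Proof.
move=> bpsi; elim: m k => [|m IH] k /=; first exact: bmf_cst.
apply: bmf_Rintegral; apply: bmfM; first exact: bmf_q.
apply: bmfD; last exact: (bmf_comp (IH k.+1) (@measurable_snd _ _ X X)).
apply: bmfM; first exact: bmf_t.
exact: (bmf_comp (bmf_V m k.+1 bpsi) (@measurable_snd _ _ X X)).
Qed.

Definition hsg m k := Vsg m k (fun=> 1).

Lemma bmf_h m k : bmf (hsg m k).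
Proof. exact: bmf_V (bmf_cst 1). Qed.

(** This bound may degenerate with [m], so it serves only to make quotients by [hsg] legitimate;
    quantitative estimates go through ratios of values of [hsg]. *)
Lemma h_ge m k x : (a * fine (mu setT)) ^+ m <= hsg m k x.
Proof.
rewrite /hsg; elim: m k x => [|m IH] k x /=; first by rewrite expr0.
rewrite exprSr mulrA -Rintegral_cst//.
apply: le_Rintegral => //; first exact: bmf_integrable (bmf_cst _).
  by apply: bmf_integrable; apply: bmfM; [exact: bmf_q1|exact: bmf_h].
move=> x' _; rewrite mulrC ler_pM//.
- exact: ltW.
- by rewrite exprn_ge0// mulr_ge0// ltW.
- by have /andP[] := qab k x' x.
Qed.

Lemma hsg_lower_gt0 m : 0 < (a * fine (mu setT)) ^+ m.
Proof. by rewrite exprn_gt0// mulr_gt0. Qed.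

Lemma h_gt0 m k x : 0 < hsg m k x.
Proof. by rewrite (lt_le_trans (hsg_lower_gt0 m))// h_ge. Qed.

Lemma ab_le1 : 1 <= b / a.
Proof.
rewrite ler_pdivlMr// mul1r.
by have /andP[/le_trans H /H] := qab 0 point point.
Qed.

(** Only the first transition sees the starting point, so the bound does not depend on [m]; for
    [m = 0] it reduces to a <= b. *)
Lemma h_ratio m k x y : hsg m k x <= b / a * hsg m k y.
Proof.
case: m => [|m]; first by rewrite /hsg /= mulr1 ab_le1.
rewrite /hsg /= -RintegralZl//; last first.
  by apply: bmf_integrable; apply: bmfM; [exact: bmf_q1|exact: bmf_h].
apply: le_Rintegral => //.
- by apply: bmf_integrable; apply: bmfM; [exact: bmf_q1|exact: bmf_h].
- apply: bmf_integrable; apply: bmfZ.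
  by apply: bmfM; [exact: bmf_q1|exact: bmf_h].
move=> x' _; rewrite mulrA ler_wpM2r ?(ltW (h_gt0 _ _ _))//.
have /andP[ay yb] := qab k x' y; have /andP[ax xb] := qab k x' x.
rewrite (le_trans xb)// mulrAC ler_pdivlMr// ler_pM2l//.
exact: lt_le_trans (q_gt0 k x' x) xb.
Qed.

(** * Conditioned signal: contraction and oscillation bounds *)

Section normalized.
Variable phi : X -> R.
Hypotheses (bphi : bmf phi) (ophi : osc_le phi 1).

(* Asg, Usg and Csg are the conditional expectations of phi(x_{k+m}) and of
   t_{k+1} + ... + t_{k+m}, and their conditional covariance, given x_k = x. *)
Definition Asg m k x := Vsg m k phi x / hsg m k x.
Definition Usg m k x := Wsg m k (fun=> 1) x / hsg m k x.
Definition Csg m k x := Wsg m k phi x / hsg m k x - Asg m k x * Usg m k x.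

Lemma bmf_hV m k : bmf (fun x => (hsg m k x)^-1).
Proof. exact: bmfV (hsg_lower_gt0 m) (h_ge m k) (bmf_h m k). Qed.

Lemma bmf_A m k : bmf (Asg m k).
Proof. by apply: bmfM; [exact: bmf_V|exact: bmf_hV]. Qed.

Lemma bmf_U m k : bmf (Usg m k).
Proof. by apply: bmfM; [exact: bmf_W (bmf_cst 1)|exact: bmf_hV]. Qed.

Lemma bmf_C m k : bmf (Csg m k).
Proof.
apply: bmfB; first by apply: bmfM; [exact: bmf_W|exact: bmf_hV].
by apply: bmfM; [exact: bmf_A|exact: bmf_U].
Qed.

(* The Markov kernel q_{k+1}(x'|x) h_{k+1}(x') / h_k(x): the signal
   conditioned on the future potentials. *)
Definition cstep m k x (F : X -> R) : R :=
  \int[mu]_x' (q k.+1 x' x * hsg m k.+1 x' / hsg m.+1 k x * F x').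

Lemma cstep_density m k x :
  density mu (fun x' => q k.+1 x' x * hsg m k.+1 x' / hsg m.+1 k x).
Proof.
have bqh := bmfM (bmf_q1 k x) (bmf_h m k.+1).
have b1 : bmf (fun x' => (hsg m.+1 k x)^-1 * (q k.+1 x' x * hsg m k.+1 x')).
  exact: bmfZ.
split.
- by apply: measurable_funM; [exact: bqh.1|exact: measurable_cst].
- by move=> x'; rewrite divr_ge0 ?mulr_ge0 ?ltW ?q_gt0 ?h_gt0.
under eq_integral do rewrite mulrC.
rewrite -[LHS]fineK; last by apply: integrable_fin_num => //; exact: bmf_integrable b1.
congr EFin; have := RintegralZl (hsg m.+1 k x)^-1 measurableT (bmf_integrable mu bqh).
by rewrite /Rintegral => ->; rewrite mulVf// gt_eqF// h_gt0.
Qed.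

Lemma mean_cstep m k x : mean (cstep m k x).
Proof. exact: mean_density (cstep_density m k x). Qed.

Lemma cstepE m k x F : bmf F ->
  cstep m k x F = (\int[mu]_x' (q k.+1 x' x * (hsg m k.+1 x' * F x'))) / hsg m.+1 k x.
Proof.
move=> bF; rewrite [RHS]mulrC -RintegralZl//; last first.
  apply: bmf_integrable; apply: bmfM; first exact: bmf_q1.
  by apply: bmfM => //; exact: bmf_h.
by apply: eq_Rintegral => x' _; ring.
Qed.

Lemma A_step m k x : Asg m.+1 k x = cstep m k x (Asg m k.+1).
Proof.
rewrite cstepE; last exact: bmf_A.
congr (_ / _); apply: eq_Rintegral => x' _; congr (_ * _).
by rewrite /Asg mulrC divfK// gt_eqF// h_gt0.
Qed.

Lemma U_step m k x :
  Usg m.+1 k x = cstep m k x (fun x' => t k.+1 x x' + Usg m k.+1 x').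
Proof.
rewrite cstepE; last by apply: bmfD; [exact: bmf_t1|exact: bmf_U].
congr (_ / _); apply: eq_Rintegral => x' _; congr (_ * _).
rewrite mulrDr /Usg mulrCA divff ?gt_eqF ?h_gt0//.
by rewrite mulr1 mulrC.
Qed.

(** The law of total covariance, conditioning on the next state: mean of the conditional covariance
    plus covariance of the conditional means. *)
Lemma C_step m k x : Csg m.+1 k x = cstep m k x (Csg m k.+1) +
  (cstep m k x (fun x' => (t k.+1 x x' + Usg m k.+1 x') * Asg m k.+1 x') -
   cstep m k x (fun x' => t k.+1 x x' + Usg m k.+1 x') *
   cstep m k x (Asg m k.+1)).
Proof.
have btU := bmfD (bmf_t1 k x) (bmf_U m k.+1); have bA := bmf_A m k.+1.
rewrite addrA -(meanD (mean_cstep m k x)); [|exact: bmf_C|exact: bmfM].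
rewrite -A_step -U_step [X in _ - X]mulrC /Csg; congr (_ - _).
rewrite cstepE; last by apply: bmfD; [exact: bmf_C|exact: bmfM].
congr (_ / _); apply: eq_Rintegral => x' _; congr (_ * _).
rewrite [LHS](_ : _ = t k.+1 x x' * Vsg m k.+1 phi x' + Wsg m k.+1 phi x')//.
by rewrite /Csg /Asg /Usg; field; rewrite gt_eqF ?h_gt0.
Qed.

Variable kappa : R.
Hypotheses (k01 : 0 < kappa <= 1) (kab : kappa <= (a / b) ^+ 2).

(** The densities of the two kernels differ through q and through the normalizer [hsg m.+1 k]; each
    costs a factor a / b, whatever the horizon. *)
Lemma cstep_minor m k x y F : bmf F -> (forall x, 0 <= F x) ->
  kappa * cstep m k y F <= cstep m k x F.
Proof.
move=> bF F0.
have iF z : mu.-integrable setT (EFin \o (fun x' =>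
    q k.+1 x' z * hsg m k.+1 x' / hsg m.+1 k z * F x')).
  exact: integrableM_bmf (density_integrable (cstep_density m k z)) bF.
rewrite -RintegralZl//; apply: le_Rintegral => //.
  by have := integrableZl measurableT kappa (iF y); apply: eq_integrable.
move=> x' _; rewrite mulrA ler_wpM2r//.
have b0 : 0 < b.
  by have /andP[_] := qab k x' x; apply: lt_le_trans; exact: q_gt0.
rewrite (le_trans (ler_wpM2r _ kab))//.
  by rewrite divr_ge0 ?mulr_ge0 ?ltW ?q_gt0 ?h_gt0.
rewrite -(ler_pM2r (h_gt0 m.+1 k x)) divfK ?gt_eqF ?h_gt0//.
have -> : (a / b) ^+ 2 * (q k.+1 x' y * hsg m k.+1 x' / hsg m.+1 k y) * hsg m.+1 k x
  = (a / b * q k.+1 x' y) * hsg m k.+1 x' * (a / b * hsg m.+1 k x / hsg m.+1 k y).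
  by field; rewrite (gt_eqF b0) (gt_eqF (h_gt0 _ _ _)).
have H1 : a / b * q k.+1 x' y <= q k.+1 x' x.
  have /andP[ax _] := qab k x' x; have /andP[_ yb] := qab k x' y.
  by rewrite (le_trans _ ax)// -mulrA ger_pMr// mulrC ler_pdivrMr// mul1r.
have H2 : a / b * hsg m.+1 k x / hsg m.+1 k y <= 1.
  rewrite ler_pdivrMr ?h_gt0// mul1r -(ler_pM2l (divr_gt0 b0 a0)).
  rewrite mulrA (_ : b / a * (a / b) = 1) ?mul1r ?h_ratio//.
  by field; rewrite !gt_eqF.
rewrite -[leRHS]mulr1 ler_pM//.
- by rewrite !mulr_ge0 ?invr_ge0 ?ltW ?q_gt0 ?h_gt0.
- by rewrite !mulr_ge0 ?invr_ge0 ?ltW ?q_gt0 ?h_gt0.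
- by rewrite ler_wpM2r ?(ltW (h_gt0 _ _ _)).
Qed.

Lemma cstep_contract m k x y F D : bmf F -> osc_le F D ->
  cstep m k x F - cstep m k y F <= (1 - kappa) * D.
Proof.
move=> bF oF; apply: mean_contract => //; [exact: mean_cstep..| |].
  by have /andP[/ltW -> ->] := k01.
by move=> G bG G0; exact: cstep_minor.
Qed.

Lemma osc_A m k : osc_le (Asg m k) ((1 - kappa) ^+ m).
Proof.
elim: m k => [|m IH] k; first by rewrite expr0 /Asg /hsg /= => x y; rewrite !divr1.
by move=> x y; rewrite !A_step exprS cstep_contract//; exact: bmf_A.
Qed.

(** The bound is the fixed point of D = (1 - kappa) D + 2 c: one step contracts the later scores and
    adds a score bounded by [c]. *)
Lemma osc_U m k : osc_le (Usg m k) (2 * c / kappa).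
Proof.
have /andP[k0 k1] := k01.
elim: m k => [|m IH] k.
  by move=> x y; rewrite /Usg /= !mul0r subrr !mulr_ge0// invr_ge0 ltW.
move=> x y; rewrite !U_step.
have SD z : cstep m k z (fun x' => t k.+1 z x' + Usg m k.+1 x') =
    cstep m k z (t k.+1 z) + cstep m k z (Usg m k.+1).
  by apply: (meanD (mean_cstep m k z)); [exact: bmf_t1|exact: bmf_U].
rewrite !SD.
rewrite -[leRHS](_ : (1 - kappa) * (2 * c / kappa) + 2 * c = _); last first.
  by field; rewrite gt_eqF.
have := cstep_contract m k x y (bmf_U m k.+1) (IH k.+1).
have := mean_norm (mean_cstep m k x) (bmf_t1 k x) (tc k x).
have := mean_norm (mean_cstep m k y) (bmf_t1 k y) (tc k y).
move: (cstep m k x (Usg _ _)) (cstep m k y (Usg _ _)) ((1 - kappa) * _).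
move: (cstep m k x (t _ _)) (cstep m k y (t _ _)) => t1 t2 u1 u2 B.
by rewrite !ler_norml; lra.
Qed.

(** In closed form K m (1 - kappa)^(m-1) for m > 0. The recursive form follows that of [Csg] and
    makes summation over [m] direct. *)
Fixpoint covrate (K : R) (m : nat) : R :=
  match m with
  | 0 => 0
  | m'.+1 => (1 - kappa) * covrate K m' + K * (1 - kappa) ^+ m'
  end.

(** Each step contracts the previous covariance and adds one of size at most (2 c + 2 c / kappa) (1
    - kappa)^m, the product of the oscillations of its two factors; it enters at two starting
    points, hence the doubled constant. *)
Lemma osc_C m k : osc_le (Csg m k) (covrate (4 * c + 4 * c / kappa) m).
Proof.
elim: m k => [|m IH] k.
  by move=> x y; rewrite /Csg /Usg /= !mul0r !mulr0 subrr.
move=> x y; rewrite !C_step /=.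
have := cstep_contract m k x y (bmf_C m k.+1) (IH k.+1).
have ot z : osc_le (t k.+1 z) (2 * c).
  exact: osc_le_of_norm.
have H z : `|cstep m k z (fun x' => (t k.+1 z x' + Usg m k.+1 x') * Asg m k.+1 x') -
    cstep m k z (fun x' => t k.+1 z x' + Usg m k.+1 x') *
    cstep m k z (Asg m k.+1)| <= 2^-1 * ((4 * c + 4 * c / kappa) * (1 - kappa) ^+ m).
  have -> : 2^-1 * ((4 * c + 4 * c / kappa) * (1 - kappa) ^+ m) =
      (2 * c + 2 * c / kappa) * (1 - kappa) ^+ m.
    by field; have /andP[/gt_eqF->] := k01.
  exact: (mean_cov (mean_cstep m k z) (bmfD (bmf_t1 k z) (bmf_U m k.+1))
    (bmf_A m k.+1) (osc_leD (ot z) (osc_U m k.+1)) (osc_A m k.+1)).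
by move/ler_sub_near; apply; [exact: H|exact: H].
Qed.

End normalized.

End semigroup.

(** * Disintegration *)

Section density_measure.
Context {R : realType} d (T : measurableType d).
Variable m : {measure set T -> \bar R}.
Variable f : T -> R.
Hypotheses (mf : measurable_fun setT f) (f0 : forall x, 0 <= f x).

Let dens (A : set T) : \bar R := (\int[m]_(x in A) (f x)%:E)%E.

Let mfE : measurable_fun setT (EFin \o f). Proof. exact/measurable_EFinP. Qed.

Lemma exists_density_measure :
  exists nu : {measure set T -> \bar R}, (nu : set T -> \bar R) = dens.
Proof.
have d0 : dens set0 = 0%E by rewrite /dens integral_set0.
have dge0 A : (0 <= dens A)%E.
  by apply: integral_ge0 => x _; rewrite lee_fin.
have ds : semi_sigma_additive dens.
  by apply: (semi_sigma_additive_nng_induced mfE) => x; rewrite lee_fin.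
pose mm := isMeasure.Build _ _ _ dens d0 dge0 ds.
pose nu : {measure set T -> \bar R} := HB.pack dens mm.
by exists nu.
Qed.

Import HBNNSimple.

(** Monotone convergence along simple functions on both sides reduces the claim to indicators, where
    it is the hypothesis on [nu]. *)
Lemma ge0_integral_density (nu : {measure set T -> \bar R}) (g : T -> \bar R) :
  (forall A, measurable A -> nu A = dens A) ->
  measurable_fun setT g -> (forall x, (0 <= g x)%E) ->
  (\int[nu]_x g x = \int[m]_x (g x * (f x)%:E))%E.
Proof.
move=> nuE mg g0; pose h := nnsfun_approx measurableT mg.
have hg x : (EFin \o h ^~ x) @ \oo --> g x by exact: cvg_nnsfun_approx.
have fE0 x : (0 <= (f x)%:E)%E by rewrite lee_fin.
have -> : (\int[nu]_x g x = limn (fun n => \int[nu]_x (h n x)%:E))%E.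
  rewrite -monotone_convergence//.
  - by apply: eq_integral => x _; apply/esym/cvg_lim => //; exact: hg.
  - by move=> n; exact/measurable_EFinP.
  - by move=> n x _; rewrite lee_fin.
  - by move=> x _ a b ab; rewrite lee_fin; exact/lefP/nd_nnsfun_approx.
have -> : (\int[m]_x (g x * (f x)%:E) =
    limn (fun n => \int[m]_x ((h n x)%:E * (f x)%:E)))%E.
  rewrite -monotone_convergence//.
  - apply: eq_integral => x _; apply/esym/cvg_lim => //.
    by apply: cvgeZr => //; exact: hg.
  - by move=> n; apply: emeasurable_funM => //; exact/measurable_EFinP.
  - by move=> n x _; rewrite -EFinM lee_fin mulr_ge0.
  - move=> x _ a b ab; rewrite -!EFinM lee_fin ler_wpM2r//.
    exact/lefP/nd_nnsfun_approx.
congr (limn _); apply/funext => n.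
rewrite integralT_nnsfun sintegralE.
transitivity (\int[m]_x (\sum_(r \in range (h n))
    (r * \1_(h n @^-1` [set r]) x)%:E * (f x)%:E))%E; last first.
  apply: eq_integral => x _; rewrite -ge0_mule_fsuml.
    by rewrite fsumEFin// -fimfunE.
  by move=> r; exact: nnfun_muleindic_ge0.
rewrite ge0_integral_fsum//; last 2 first.
- move=> r; apply: emeasurable_funM => //; apply/measurable_EFinP.
  by apply: measurable_funM => //; exact: measurable_cst.
- by move=> r x _; rewrite mule_ge0// nnfun_muleindic_ge0.
apply: eq_fsbigr => r; rewrite inE => -[x _ hx].
have r0 : 0 <= r by rewrite -hx.
under eq_integral do rewrite EFinM -muleA.
rewrite ge0_integralZl//.
- rewrite nuE//; congr (_ * _)%E; rewrite /dens integral_mkcond.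
  by apply: eq_integral => y _; rewrite epatch_indic muleC.
- by apply: emeasurable_funM => //; apply/measurable_EFinP/measurable_indic.
- by move=> y _; rewrite mule_ge0// lee_fin.
Qed.

End density_measure.

(** The equality is one of measures, so the finite version can be substituted for the original
    throughout a goal. *)
Lemma exists_finite_measure {R : realType} d (T : measurableType d)
    (m : {measure set T -> \bar R}) : (m setT < +oo)%E ->
  exists m' : {finite_measure set T -> \bar R}, (m' : {measure set T -> \bar R}) = m.
Proof.
move=> mT; exists (mfrestr measurableT mT); apply: eq_measure.
by apply/funext => A; rewrite /= /mfrestr /mrestr setIT.
Qed.

Section disintegration.
Context {R : realType} dO (Omega : measurableType dO) dW (W : measurableType dW)
  dX (X : measurableType dX).
Local Open Scope ereal_scope.

Lemma exists_image_measure dT (T : measurableType dT)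
    (m : {measure set Omega -> \bar R})
    (phi : Omega -> T) : measurable_fun setT phi ->
  exists nu : {measure set T -> \bar R},
    (forall A, nu A = m (phi @^-1` A)) /\
    (forall g : T -> \bar R, measurable_fun setT g -> (forall x, 0 <= g x) ->
      \int[nu]_x g x = \int[m]_w g (phi w)).
Proof.
move=> mphi.
have [nu nuE] : exists nu : {measure set T -> \bar R},
    (nu : set T -> \bar R) = pushforward m phi.
  by unshelve eexists (pushforward m phi : {measure set T -> \bar R}).
exists nu; rewrite nuE; split => // g mg g0.
by rewrite ge0_integral_pushforward// preimage_setT.
Qed.

Variables (P : {finite_measure set Omega -> \bar R})
  (mu : {finite_measure set X -> \bar R}).
Variables (tau : Omega -> W) (xi : Omega -> X).
Hypotheses (mtau : measurable_fun setT tau) (mxi : measurable_fun setT xi).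
Variables (V : Omega -> R) (U : W -> R) (p : W -> X -> R).
Hypotheses (mV : measurable_fun setT V) (mU : measurable_fun setT U)
  (mp : measurable_fun setT (fun z : W * X => p z.1 z.2)).
Hypotheses (V0 : forall w, (0 <= V w)%R) (U0 : forall w, (0 <= U w)%R)
  (p0 : forall w x, (0 <= p w x)%R).
Hypothesis Vfin : \int[P]_w (V w)%:E < +oo.
Hypothesis VU : forall A B, measurable A -> measurable B ->
  \int[P]_(w in tau @^-1` A `&` xi @^-1` B) (V w)%:E =
  \int[P]_(w in tau @^-1` A) ((U (tau w))%:E * \int[mu]_(x in B) (p (tau w) x)%:E).

(** The image of V P under (tau, xi) and the measure with density U p with respect to (law of tau) x
    mu agree on rectangles by [VU], hence everywhere. The weight [V] is meant for the factors of the
    other particles, and [U] for their conditional mean. *)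
Lemma disintegration (H : W * X -> R) : measurable_fun setT H ->
  (forall z, (0 <= H z)%R) ->
  \int[P]_w (V w * H (tau w, xi w))%:E =
  \int[P]_w ((U (tau w))%:E * \int[mu]_x (H (tau w, x) * p (tau w) x)%:E).
Proof.
move=> mH H0.
have mpair : measurable_fun setT (fun w => (tau w, xi w)).
  exact: measurable_fun_pair.
have [PV PVE] := exists_density_measure P mV V0.
have [m1 [m1E m1I]] := exists_image_measure PV mpair.
have [PW [PWE PWI]] := exists_image_measure P mtau.
have PWfin : PW setT < +oo by rewrite PWE preimage_setT ltey_eq fin_num_measure.
have [PW' PW'E] := exists_finite_measure PWfin; subst PW.
have mUp : measurable_fun setT (fun z : W * X => U z.1 * p z.1 z.2)%R.
  by apply: measurable_funM => //; exact: measurableT_comp mU measurable_fst.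
have Up0 z : (0 <= U z.1 * p z.1 z.2)%R by rewrite mulr_ge0.
have [m2 m2E] := exists_density_measure (PW' \x mu) mUp Up0.
have tonelli (G : W * X -> R) : measurable_fun setT G -> (forall z, (0 <= G z)%R) ->
    \int[PW' \x mu]_z (G z * (U z.1 * p z.1 z.2))%:E =
    \int[P]_w ((U (tau w))%:E * \int[mu]_x (G (tau w, x) * p (tau w) x)%:E).
  move=> mG G0.
  have mGp : measurable_fun setT (fun z : W * X => (G z * p z.1 z.2)%:E).
    by apply/measurable_EFinP; exact: measurable_funM.
  have mGUp : measurable_fun setT
      (fun z : W * X => (G z * (U z.1 * p z.1 z.2))%:E).
    by apply/measurable_EFinP; exact: measurable_funM.
  have Gp0 z : 0 <= (G z * p z.1 z.2)%:E by rewrite lee_fin mulr_ge0.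
  rewrite fubini_tonelli1//; last by move=> z; rewrite lee_fin mulr_ge0.
  rewrite -(PWI (fun w => (U w)%:E * \int[mu]_x (G (w, x) * p w x)%:E)).
  - apply: eq_integral => w _; rewrite /fubini_F /=.
    rewrite -ge0_integralZl_EFin//.
    + by apply: eq_integral => x _; rewrite mulrCA.
    + exact: (measurableT_comp mGp (pair1_measurable w)).
  - apply: emeasurable_funM; first exact/measurable_EFinP.
    exact: (measurable_fun_fubini_tonelli_F (m2 := mu) _ mGp).
  - move=> w; rewrite mule_ge0 ?lee_fin//; apply: integral_ge0 => x _.
    by rewrite lee_fin mulr_ge0.
have indM (A : set W) (B : set X) : measurable A -> measurable B ->
    measurable_fun setT (\1_(A `*` B) : W * X -> R).
  by move=> mA mB; apply: measurable_indic; exact: measurableX.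
have m12 A B : measurable A -> measurable B -> m1 (A `*` B) = m2 (A `*` B).
  move=> mA mB; rewrite m1E PVE m2E.
  have -> : (fun w => (tau w, xi w)) @^-1` (A `*` B) =
      tau @^-1` A `&` xi @^-1` B by [].
  rewrite VU// [RHS]integral_mkcond.
  transitivity (\int[PW' \x mu]_z
      (\1_(A `*` B) z * (U z.1 * p z.1 z.2))%:E); last first.
    apply: eq_integral => z _; rewrite patchE indicE.
    by case: ifP => _; rewrite ?mul1r ?mul0r.
  rewrite tonelli; [|exact: indM|by move=> z; rewrite indicE].
  rewrite [LHS]integral_mkcond; apply: eq_integral => w _; rewrite patchE.
  rewrite [X in _ = _ * X](_ : _ = (\1_A (tau w))%:E *
      \int[mu]_(x in B) (p (tau w) x)%:E); last first.
    rewrite [in RHS]integral_mkcond -ge0_integralZl_EFin//.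
    - apply: eq_integral => x _; rewrite patchE !indicE in_setX /=.
      by case: (x \in B); rewrite ?andbF ?mul0r ?mule0// andbT EFinM.
    - by move=> x _; rewrite patchE; case: ifP => _; rewrite ?lee_fin.
    - apply/(measurable_restrictT _ _).1 => //.
      apply/measurable_EFinP/measurable_funTS.
      exact: (measurableT_comp mp (pair1_measurable (tau w))).
  have -> : (w \in tau @^-1` A) = (tau w \in A) by apply/idP/idP; rewrite !inE.
  by rewrite indicE; case: (tau w \in A); rewrite ?mul1e// mul0e mule0.
(* Rectangles are stable under intersection and generate; the whole space is one of them, and its
   mass is finite by [Vfin]. *)
have m12E C : measurable C -> m1 C = m2 C.
  apply: (measure_unique
    [set A `*` B | A in measurable & B in measurable] (fun=> setT)).
  - exact: measurable_prod_measurableType.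
  - move=> _ _ [A mA [B mB <-]] [A' mA' [B' mB' <-]]; rewrite -setXI.
    by exists (A `&` A'); [exact: measurableI|
      exists (B `&` B'); [exact: measurableI|]].
  - by move=> _; exists setT => //; exists setT => //; rewrite setXTT.
  - by rewrite bigcup_const.
  - by move=> _ [A mA [B mB <-]]; exact: m12.
  - by move=> _; rewrite m1E PVE preimage_setT.
have mHE : measurable_fun setT (EFin \o H) by exact/measurable_EFinP.
have HE0 z : 0 <= (EFin \o H) z by rewrite lee_fin.
transitivity (\int[m1]_z (H z)%:E).
  rewrite (m1I (EFin \o H))//.
  rewrite (ge0_integral_density mV V0 (m := P) (nu := PV))//; last 2 first.
  - by move=> A mA; rewrite PVE.
  - exact: measurableT_comp mHE mpair.
  by apply: eq_integral => w _; rewrite /= mulrC EFinM.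
transitivity (\int[m2]_z (H z)%:E).
  by apply: eq_measure_integral => C mC _; exact: m12E.
rewrite (ge0_integral_density mUp Up0 (m := PW' \x mu) (nu := m2))//; last first.
  by move=> A mA; rewrite m2E.
by rewrite -tonelli//; apply: eq_integral => z _; rewrite EFinM.
Qed.

End disintegration.

(** * Conditionally independent particles *)

(** From e^(-z) >= 1 - z one gets e^z <= 1 / (1 - z), and (1 + z + 2 z^2) (1 - z) = 1 + z^2 (1 - 2
    z) >= 1 for z <= 1/2. *)
Lemma expR_le_quadratic {R : realType} (z : R) : `|z| <= 2^-1 ->
  expR z <= 1 + z + 2 * z ^+ 2.
Proof.
rewrite ler_norml => /andP[z1 z2].
have z3 : 0 < 1 - z by lra.
have : expR z <= (1 - z)^-1.
  by rewrite -[leLHS]invrK -expRN lef_pV2 ?posrE ?expR_gt0// expR_ge1Dx.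
move=> /le_trans; apply; rewrite -[leLHS]mul1r ler_pdivrMr//.
have : 0 <= z ^+ 2 * (1 - 2 * z) by rewrite mulr_ge0 ?sqr_ge0//; lra.
by rewrite (_ : (1 + z + 2 * z ^+ 2) * (1 - z) = 1 + z ^+ 2 * (1 - 2 * z)); [lra|ring].
Qed.

Section conditional_independence.
Context {R : realType} dO (Omega : measurableType dO) dW (W : measurableType dW)
  dX (X : measurableType dX).
Variables (P : probability Omega R) (mu : {finite_measure set X -> \bar R}).
Variables (N : nat) (tau : Omega -> W) (xi : 'I_N -> Omega -> X) (p : W -> X -> R).
Hypotheses (mtau : measurable_fun setT tau)
  (mxi : forall i, measurable_fun setT (xi i))
  (mp : measurable_fun setT (fun z : W * X => p z.1 z.2))
  (dp : forall w, density mu (p w)).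
Hypothesis condind : forall (A : set W) (B : 'I_N -> set X),
  measurable A -> (forall i, measurable (B i)) ->
  (P (tau @^-1` A `&` \bigcap_(i in setT) (xi i @^-1` B i)) =
   \int[P]_(w in tau @^-1` A) \prod_(i < N) \int[mu]_(x in B i) (p (tau w) x)%:E)%E.

Let p0 w x : 0 <= p w x. Proof. by case: (dp w). Qed.

Let mean_p w : mean (fun F => \int[mu]_x (p w x * F x)).
Proof. exact: mean_density (dp w). Qed.

Definition cmean (K : W * X -> R) (w : W) := \int[mu]_x (p w x * K (w, x)).

Lemma bmf_sec (K : W * X -> R) w : bmf K -> bmf (fun x => K (w, x)).
Proof. by move=> bK; exact: (bmf_comp bK (pair1_measurable w)). Qed.

Lemma cmeanE (K : W * X -> R) w : bmf K ->
  (\int[mu]_x (K (w, x) * p w x)%:E)%E = (cmean K w)%:E.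
Proof.
move=> bK; rewrite /cmean /Rintegral fineK.
  by apply: eq_integral => x _; rewrite mulrC.
apply: integrable_fin_num => //.
exact: integrableM_bmf (density_integrable (dp w)) (bmf_sec w bK).
Qed.

Lemma cmean_ge0 (K : W * X -> R) w : (forall z, 0 <= K z) -> 0 <= cmean K w.
Proof. by move=> K0; apply: Rintegral_ge0 => x _; rewrite mulr_ge0. Qed.

Lemma measurable_cmean (K : W * X -> R) : measurable_fun setT K ->
  measurable_fun setT (cmean K).
Proof.
move=> mK; apply: measurable_Rintegral; apply: measurable_funM => //.
by apply: eq_measurable_fun mK => -[w x] _.
Qed.

Lemma bmf_indic (B : set X) : measurable B -> bmf (fun z : W * X => \1_B z.2 : R).
Proof.
move=> mB; split; last by exists 1 => z; rewrite indicE normr_nat lern1 leq_b1.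
exact: (measurableT_comp (measurable_indic mB) (@measurable_snd _ _ W X)).
Qed.

Lemma cmean_indic (B : set X) w : measurable B ->
  (cmean (fun z => \1_B z.2) w)%:E = (\int[mu]_(x in B) (p w x)%:E)%E.
Proof.
move=> mB; rewrite -cmeanE; last exact: bmf_indic.
rewrite [RHS]integral_mkcond; apply: eq_integral => x _.
by rewrite patchE indicE /=; case: ifP => _; rewrite ?mul1r ?mul0r.
Qed.

Lemma EFin_prod (I : finType) (F : I -> R) :
  ((\prod_i F i)%:E = \prod_i (F i)%:E)%E.
Proof. by apply: (big_morph EFin) => // x y; rewrite EFinM. Qed.

Lemma bmf_prod (Q : pred 'I_N) (K : 'I_N -> W * X -> R) : (forall i, bmf (K i)) ->
  bmf (fun w => \prod_(i | Q i) K i (tau w, xi i w)).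
Proof.
move=> bK; have bKi i : bmf (fun w => K i (tau w, xi i w)).
  by apply: (bmf_comp (bK i)); exact: measurable_fun_pair.
split.
  apply: (eq_measurable_fun
    (fun w => \prod_(i <- [seq i <- index_enum 'I_N | Q i]) K i (tau w, xi i w))).
    by move=> w _; rewrite big_filter.
  by apply: measurable_prod => i _; case: (bKi i).
have /choice[B KB] : forall i, exists B, forall w, `|K i (tau w, xi i w)| <= B.
  by move=> i; case: (bKi i).
exists (\prod_(i | Q i) B i) => w; rewrite normr_prod; apply: ler_prod => i _.
by rewrite normr_ge0 KB.
Qed.

(** Indicators are traded for general functions one particle at a time: the factors of index below
    [j] are arbitrary, the others are indicators of events on their particle. With an indicator put
    back at index [j], the induction hypothesis is exactly the rectangle formula that
    [disintegration] asks for, [V] being the product of the other factors. *)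
Lemma cond_prod_step (j : nat) (K : 'I_N -> W * X -> R) (A : set W) :
  (forall i, bmf (K i)) -> (forall i z, 0 <= K i z) ->
  (forall i : 'I_N, (j <= i)%N -> exists2 B, measurable B & K i = fun z => \1_B z.2) ->
  measurable A ->
  (\int[P]_(w in tau @^-1` A) (\prod_i K i (tau w, xi i w))%:E =
   \int[P]_(w in tau @^-1` A) (\prod_i cmean (K i) (tau w))%:E)%E.
Proof.
elim: j K A => [|j IH] K A bK K0 Kj mA.
  have /choice[B KB] : forall i : 'I_N, exists B : set X,
      measurable B /\ K i = fun z => \1_B z.2.
    by move=> i; have [B mB KB] := Kj i (leq0n _); exists B.
  transitivity (P (tau @^-1` A `&` \bigcap_(i in setT) (xi i @^-1` B i))).
    have mtA : measurable (tau @^-1` A) by rewrite -[_ @^-1` _]setTI; exact: mtau.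
    have mB : measurable (\bigcap_(i in setT) (xi i @^-1` B i)).
      apply: fin_bigcap_measurable => // i _.
      by rewrite -[_ @^-1` _]setTI; apply: mxi => //; exact: (KB i).1.
    rewrite setIC -integral_indic//; apply: eq_integral => w _; congr EFin.
    rewrite indicE; case: (boolP (w \in _)) => [|/negP]; rewrite inE => wB.
      rewrite big1// => i _; rewrite (KB i).2 indicE mem_set//; exact: wB.
    have [i wBi] : exists i, ~ B i (xi i w).
      by apply/existsNP => wB'; apply: wB => i _; exact: wB'.
    by rewrite (bigD1 i)//= (KB i).2 indicE memNset// mul0r.
  rewrite condind//; last by move=> i; exact: (KB i).1.
  apply: eq_integral => w _; rewrite EFin_prod; apply: eq_bigr => i _.
  by rewrite (KB i).2 cmean_indic//; exact: (KB i).1.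
have [jN|Nj] := ltnP j N; last first.
  by apply: IH => // i ji; have := ltn_ord i; rewrite ltnNge (leq_trans Nj).
pose i0 := Ordinal jN.
pose V w := \prod_(i | i != i0) K i (tau w, xi i w).
pose U w := \prod_(i | i != i0) cmean (K i) w.
have V0 w : 0 <= V w by apply: prodr_ge0 => i _.
have U0 w : 0 <= U w by apply: prodr_ge0 => i _; exact: cmean_ge0.
have bV : bmf V := bmf_prod _ bK.
have mU : measurable_fun setT U.
  apply: (eq_measurable_fun
    (fun w => \prod_(i <- [seq i <- index_enum 'I_N | i != i0]) cmean (K i) w)).
    by move=> w _; rewrite big_filter.
  by apply: measurable_prod => i _; apply: measurable_cmean; case: (bK i).
have Vfin : (\int[P]_w (V w)%:E < +oo)%E.
  have /integrableP[_] := bmf_integrable P bV.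
  by under eq_integral do rewrite /= ger0_norm//.
have VU A' B : measurable A' -> measurable B ->
    (\int[P]_(w in tau @^-1` A' `&` xi i0 @^-1` B) (V w)%:E =
     \int[P]_(w in tau @^-1` A') ((U (tau w))%:E * \int[mu]_(x in B) (p (tau w) x)%:E))%E.
  move=> mA' mB.
  pose K' i := if i == i0 then (fun z : W * X => \1_B z.2) else K i.
  transitivity (\int[P]_(w in tau @^-1` A') (\prod_i K' i (tau w, xi i w))%:E)%E.
    rewrite integral_mkcondr; apply: eq_integral => w _; rewrite patchE.
    have -> : \prod_i K' i (tau w, xi i w) = \1_B (xi i0 w) * V w.
      rewrite (bigD1 i0)//= {1}/K' eqxx; congr (_ * _).
      by apply: eq_bigr => i /negbTE ii0; rewrite /K' ii0.
    have -> : (w \in xi i0 @^-1` B) = (xi i0 w \in B) by apply/idP/idP; rewrite !inE.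
    by rewrite indicE; case: (xi i0 w \in B); rewrite ?mul1r ?mul0r.
  rewrite IH//.
  - apply: eq_integral => w _; rewrite (bigD1 i0)//= {1}/K' eqxx.
    rewrite EFinM cmean_indic// muleC; congr (_%:E * _)%E.
    by apply: eq_bigr => i /negbTE ii0; rewrite /K' ii0.
  - by move=> i; rewrite /K'; case: ifP => // _; exact: bmf_indic.
  - by move=> i z; rewrite /K'; case: ifP => // _; rewrite indicE.
  - move=> i ji; rewrite /K'; case: eqVneq => [_|ii0]; first by exists B.
    apply: Kj; rewrite ltn_neqAle ji andbT; apply: contra_neq ii0 => jE.
    exact: val_inj.
pose H z := \1_A z.1 * K i0 z : R.
have mH : measurable_fun setT H.
  apply: measurable_funM; last by case: (bK i0).
  exact: (measurableT_comp (measurable_indic mA) (@measurable_fst _ _ W X)).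
have H0 z : 0 <= H z by rewrite mulr_ge0// indicE.
have tauA w : (w \in tau @^-1` A) = (tau w \in A) by apply/idP/idP; rewrite !inE.
transitivity (\int[P]_w (V w * H (tau w, xi i0 w))%:E)%E.
  rewrite integral_mkcond; apply: eq_integral => w _; rewrite patchE /H /=.
  rewrite indicE tauA (bigD1 i0)//=; case: (tau w \in A).
    by rewrite mul1r mulrC.
  by rewrite mul0r mulr0.
rewrite (disintegration (P := P) (mu := mu) mtau (mxi i0)
  (V := V) (U := U) (p := p))//; last first.
  by case: bV.
rewrite [RHS]integral_mkcond; apply: eq_integral => w _; rewrite patchE tauA.
have -> : (\int[mu]_x (H (tau w, x) * p (tau w) x)%:E)%E =
    ((tau w \in A)%:R * cmean (K i0) (tau w))%:E.
  rewrite EFinM -cmeanE// -integralZl//.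
    by apply: eq_integral => x _; rewrite -EFinM /H /= indicE mulrA.
  have := integrableM_bmf (density_integrable (dp (tau w))) (bmf_sec (tau w) (bK i0)).
  by apply: eq_integrable => // x _; rewrite /= mulrC.
rewrite (bigD1 i0)//=; case: (tau w \in A); last by rewrite mul0r mule0.
by rewrite mul1r -EFinM mulrC.
Qed.

Lemma cond_prod (K : 'I_N -> W * X -> R) :
  (forall i, bmf (K i)) -> (forall i z, 0 <= K i z) ->
  (\int[P]_w (\prod_i K i (tau w, xi i w))%:E =
   \int[P]_w (\prod_i cmean (K i) (tau w))%:E)%E.
Proof.
move=> bK K0; rewrite -(preimage_setT tau).
by apply: (@cond_prod_step N) => // i; rewrite leqNgt ltn_ord.
Qed.

Section exponential_moment.
Variables (H : W * X -> R) (M : R).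
Hypotheses (N0 : (0 < N)%N) (M0 : 0 < M) (bH : bmf H) (HM : forall z, `|H z| <= M)
  (H0 : forall w, cmean H w = 0).

(** At this scale |s H| <= 1 / (2 sqrt N), which is at most 1/2, so the quadratic bound on exp
    applies, and its second-order term 2 (s H)^2 is at most 1 / (2 N). *)
Let s : R := (2 * M * Num.sqrt N%:R)^-1.

Let NR0 : 0 < N%:R :> R. Proof. by rewrite ltr0n. Qed.

Let sN0 : 0 < Num.sqrt (N%:R : R). Proof. by rewrite sqrtr_gt0. Qed.

Let s0 : 0 < s. Proof. by rewrite invr_gt0 !mulr_gt0. Qed.

Let Kexp (b : R) (z : W * X) := expR (b * s * H z).

Let bKexp b : bmf (Kexp b).
Proof.
have bb : bmf (fun z => b * s * H z) by exact: bmfZ.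
split; first exact: measurableT_comp (@measurable_expR R) bb.1.
have [B bB] := bb.2; exists (expR B) => z.
by rewrite ger0_norm ?expR_ge0// ler_expR (le_trans (ler_norm _))//.
Qed.

(** The linear term vanishes because [H] is conditionally centred, leaving 1 + 1/N <= e^(1/N); the
    product of N such factors is at most e. *)
Let cmean_exp (b : R) w : `|b| <= 1 -> cmean (Kexp b) w <= expR (N%:R^-1).
Proof.
move=> b1; have MP := mean_p w; have bHw := bmf_sec w bH.
have step z : Kexp b z <= 1 + b * s * H z + N%:R^-1.
  have sM : `|b * s * H z| <= 2^-1 * (Num.sqrt N%:R)^-1.
    rewrite !normrM (gtr0_norm s0).
    have s0' := ltW s0.
    rewrite (le_trans (ler_pM _ _ (ler_pM _ _ b1 (lexx s)) (HM z)))//.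
      exact: mulr_ge0.
    by rewrite mul1r /s le_eqVlt; apply/orP; left; apply/eqP; field; rewrite !gt_eqF.
  have sM2 : `|b * s * H z| <= 2^-1.
    rewrite (le_trans sM)// ler_piMr// invf_le1// -[leLHS]sqrtr1.
    by rewrite ler_sqrt// ler1n.
  rewrite (le_trans (expR_le_quadratic sM2))// lerD2l.
  rewrite -real_normK ?num_real//.
  rewrite (le_trans (_ : _ <= 2 * (2^-1 * (Num.sqrt N%:R)^-1) ^+ 2))//.
    by rewrite ler_wpM2l// lerXn2r// nnegrE// mulr_ge0// invr_ge0 ltW.
  rewrite exprMn !exprVn (sqr_sqrtr (ltW NR0)) mulrA ger_pMl ?invr_gt0//.
  by rewrite expr2; lra.
apply: le_trans (expR_ge1Dx _).
have bs : bmf (fun x => 1 + b * s * H (w, x) + N%:R^-1).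
  apply: bmfD; last exact: bmf_cst.
  by apply: bmfD; [exact: bmf_cst|exact: bmfZ].
apply: le_trans (mean_le MP (bmf_sec w (bKexp b)) bs (fun x => step (w, x))) _.
rewrite (meanD MP); [|by apply: bmfD; [exact: bmf_cst|exact: bmfZ]|exact: bmf_cst].
rewrite (meanD MP); [|exact: bmf_cst|exact: bmfZ].
rewrite (meanZ MP)// !(mean_cst MP) -/(cmean H w) H0 mulr0 addr0//.
Qed.

Let exp_sum (b : R) : `|b| <= 1 ->
  (\int[P]_w (expR (b * s * \sum_i H (tau w, xi i w)))%:E <= (expR 1)%:E)%E.
Proof.
move=> b1.
have -> : (\int[P]_w (expR (b * s * \sum_i H (tau w, xi i w)))%:E =
    \int[P]_w (\prod_i Kexp b (tau w, xi i w))%:E)%E.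
  by apply: eq_integral => w _; rewrite mulr_sumr expR_sum.
rewrite (@cond_prod (fun=> Kexp b)); [|by move=> _; exact: bKexp|by move=> _ z; exact: expR_ge0].
have e0 w : 0 <= cmean (Kexp b) w by apply: cmean_ge0 => z; exact: expR_ge0.
have mE : measurable_fun setT (fun w => (\prod_(i < N) cmean (Kexp b) (tau w))%:E).
  apply/measurable_EFinP.
  rewrite (_ : (fun _ => _) = (fun w => cmean (Kexp b) (tau w) ^+ N)); last first.
    by apply/funext => w; rewrite prodr_const card_ord.
  apply: measurable_funX; apply: measurableT_comp mtau.
  by apply: measurable_cmean; case: (bKexp b).
apply: le_trans (_ : (\int[P]_w (expR 1)%:E <= _)%E).
  apply: ge0_le_integral => //.
  - by move=> w _; rewrite lee_fin prodr_ge0.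
  - move=> w _; rewrite lee_fin prodr_const card_ord.
    have -> : 1 = N%:R * N%:R^-1 :> R by rewrite divff ?gt_eqF.
    by rewrite mulrC expRM_natr lerXn2r ?nnegrE ?expR_ge0// cmean_exp.
by rewrite integral_cst//= probability_setT mule1.
Qed.

(** The bound e^|z| <= e^z + e^(-z) reduces the claim to the two signs b = 1 and b = -1, each
    contributing e. *)
Lemma exponential_moment :
  (\int[P]_w (expR `|Num.sqrt N%:R *
     (N%:R^-1 * \sum_i H (tau w, xi i w)) / (2 * M)|)%:E <= (2 * expR 1)%:E)%E.
Proof.
have mS b : measurable_fun setT (fun w => (expR (b * s * \sum_i H (tau w, xi i w)))%:E).
  apply/measurable_EFinP; apply: measurableT_comp => //.
  apply: measurable_funM; first exact: measurable_cst.
  apply: measurable_sum => i; apply: measurableT_comp; first exact: bH.1.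
  exact: measurable_fun_pair.
apply: (@le_trans _ _ (\int[P]_w ((expR (1 * s * \sum_i H (tau w, xi i w)))%:E +
    (expR (- 1 * s * \sum_i H (tau w, xi i w)))%:E)))%E.
  apply: ge0_le_integral => //.
  - apply/measurable_EFinP; apply: measurableT_comp => //.
    apply: measurableT_comp => //.
    apply: measurable_funM; last exact: measurable_cst.
    apply: measurable_funM; first exact: measurable_cst.
    apply: measurable_funM; first exact: measurable_cst.
    apply: measurable_sum => i; apply: measurableT_comp; first exact: bH.1.
    exact: measurable_fun_pair.
  - by apply: emeasurable_funD; exact: mS.
  - move=> w _; set S := \sum_i _.
    have -> : Num.sqrt N%:R * (N%:R^-1 * S) / (2 * M) = s * S.
      rewrite /s -[in N%:R^-1](sqr_sqrtr (ltW NR0)).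
      by field; rewrite !gt_eqF.
    rewrite -EFinD lee_fin mul1r mulN1r mulNr.
    have e0 := @expR_ge0 R; case: (leP 0 (s * S)) => sS.
      by rewrite ger0_norm// lerDl.
    by rewrite ltr0_norm// lerDr.
rewrite ge0_integralD//.
have -> : 2 * expR 1 = expR 1 + expR 1 :> R by rewrite mulr_natl mulr2n.
rewrite EFinD; apply: leeD; apply: exp_sum; first by rewrite normr1.
by rewrite normrN normr1.
Qed.

End exponential_moment.

End conditional_independence.

(** * Integrals over paths *)

Section product_power.
Context {R : realType} {dX : measure_display} {X : measurableType dX}.
Variable mu : {finite_measure set X -> \bar R}.

Let cons_pair m (z : X * m.-tuple X) := [the m.+1.-tuple X of z.1 :: z.2].

Let mcons m : measurable_fun setT (@cons_pair m).
Proof. exact: measurable_cons measurable_fst measurable_snd. Qed.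

(** [pow_measure] is a bare set function; its measure structure is recovered inductively, since each
    product needs the previous power to be a finite measure. *)
Lemma pow_measure_finite m :
  exists nu : {finite_measure set (m.-tuple X) -> \bar R},
    (nu : set (m.-tuple X) -> \bar R) = pow_measure mu (n := m).
Proof.
elim: m => [|m [nu nuE]]; first by exists (dirac ([tuple] : 0.-tuple X)).
have [nu' nu'E] : exists nu' : {measure set (m.+1.-tuple X) -> \bar R},
    (nu' : set (m.+1.-tuple X) -> \bar R) = pow_measure mu (n := m.+1).
  rewrite /= -nuE; unshelve eexists (pushforward (mu \x nu)%E (@cons_pair m)
    : {measure set (m.+1.-tuple X) -> \bar R}) => //.
  exact: mcons.
have nu'fin : (nu' setT < +oo)%E.
  rewrite nu'E /= -nuE /pushforward preimage_setT -setXTT product_measure1E//.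
  by rewrite ltey_eq fin_numM// fin_num_measure.
by have [nu2 nu2E] := exists_finite_measure nu'fin; exists nu2; rewrite -nu'E -nu2E.
Qed.

Definition pown m : {finite_measure set (m.-tuple X) -> \bar R} :=
  sval (cid (pow_measure_finite m)).

Lemma pownE m : (pown m : set (m.-tuple X) -> \bar R) = pow_measure mu (n := m).
Proof. exact: svalP (cid (pow_measure_finite m)). Qed.

Lemma pownS m : (pown m.+1 : set (m.+1.-tuple X) -> \bar R) =
  pushforward (mu \x pown m)%E (@cons_pair m).
Proof. by rewrite pownE /= -pownE. Qed.

Section iterated.
Variables (m : nat) (G : m.+1.-tuple X -> R) (p : X -> R) (K : X * m.-tuple X -> R).
Hypotheses (mG : measurable_fun setT G) (ip : mu.-integrable setT (EFin \o p))
  (bK : bmf K) (GE : forall x (s : m.-tuple X), G [tuple of x :: s] = p x * K (x, s)).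

Let iprod : (mu \x pown m)%E.-integrable setT (EFin \o (fun z => p z.1 * K z)).
Proof.
apply: integrableM_bmf => //.
have /integrableP[mp pfin] := ip.
have mpf : measurable_fun setT (EFin \o (fun z : X * m.-tuple X => p z.1)).
  exact: (measurableT_comp mp).
apply/(integrable12ltyP mu (pown m) mpf).
rewrite (eq_integral (fun x => `|(p x)%:E| * pown m setT)%E); last first.
  by move=> x _; rewrite -integral_cst.
rewrite ge0_integralZr//; last exact: measurableT_comp.
rewrite lte_mul_pinfty//; first exact: integral_ge0.
  by rewrite ge0_fin_numE//; exact: integral_ge0.
by rewrite ltey_eq fin_num_measure.
Qed.

Lemma integrable_pown : (pown m.+1).-integrable setT (EFin \o G).
Proof.
apply/integrableP; split; first exact/measurable_EFinP.
rewrite pownS ge0_integral_pushforward//; first last.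
- by apply: measurableT_comp => //; exact/measurable_EFinP.
- exact: mcons.
rewrite preimage_setT; have /integrableP[_] := iprod.
by congr (_ < _)%E; apply: eq_integral => -[x s] _ /=; rewrite -GE.
Qed.

(** Fubini, with the first coordinate split off. The factor [p] is only integrable, so that the
    initial density, on which no upper bound is assumed, is covered. *)
Lemma Rintegral_pown :
  \int[pown m.+1]_t G t = \int[mu]_x (p x * \int[pown m]_s K (x, s)).
Proof.
have -> : \int[pown m.+1]_t G t =
    fine (integral (pown m.+1 : set (m.+1.-tuple X) -> \bar R) setT (EFin \o G)) by [].
rewrite pownS integral_pushforward//; first last.
- rewrite preimage_setT; apply: eq_integrable iprod => // -[x s] _ /=.
  by rewrite -GE.
- exact/measurable_EFinP.
- exact: mcons.
rewrite preimage_setT.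
rewrite (eq_integral (EFin \o (fun z => p z.1 * K z))); last first.
  by move=> [x s] _ /=; rewrite -GE.
rewrite -(integral12_prod_meas1 iprod); congr fine; apply: eq_integral => x _.
have bKx : bmf (fun s => K (x, s)) := bmf_comp bK (pair1_measurable x).
rewrite /fubini_F /= EFinM fineK; last by apply: integrable_fin_num => //; exact: bmf_integrable.
rewrite -integralZl//; last exact: bmf_integrable.
Qed.

End iterated.

End product_power.

Section density_change.
Context {R : realType} d (T : measurableType d).
Variables (m nu : {measure set T -> \bar R}) (f : T -> R).
Hypotheses (imf : m.-integrable setT (EFin \o f)) (f0 : forall x, 0 <= f x).
Hypothesis nuE : forall A, measurable A -> nu A = (\int[m]_(x in A) (f x)%:E)%E.

Let mf : measurable_fun setT f.
Proof. by apply/measurable_EFinP; exact: measurable_int imf. Qed.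

Lemma density_finite : (nu setT < +oo)%E.
Proof.
have /integrableP[_] := imf; rewrite nuE//; apply: le_lt_trans.
rewrite le_eqVlt; apply/orP; left; apply/eqP.
by apply: eq_integral => x _ /=; rewrite ger0_norm.
Qed.

Lemma density_bmf_integrable g : bmf g -> nu.-integrable setT (EFin \o g).
Proof.
move=> [mg /bounded_bmf bg].
by apply: measurable_bounded_integrable => //; exact: density_finite.
Qed.

(** Adding a bound [B] of |g| makes the integrand nonnegative; the constant is then subtracted, its
    integral being given by the same nonnegative case. *)
Lemma Rintegral_density g : bmf g -> \int[nu]_x g x = \int[m]_x (f x * g x).
Proof.
move=> bg; have [mg [B gB]] := bg.
have B1 : bmf (fun _ : T => B) := bmf_cst B.
have key h : bmf h -> (forall x, 0 <= h x) -> \int[nu]_x h x = \int[m]_x (f x * h x).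
  move=> [mh _] h0; rewrite /Rintegral (ge0_integral_density mf f0 nuE)//.
  - by congr fine; apply: eq_integral => x _; rewrite -EFinM mulrC.
  - exact/measurable_EFinP.
have bgB := bmfD bg B1.
have -> : \int[nu]_x g x = \int[nu]_x (g x + B) - \int[nu]_x B.
  rewrite -RintegralB//; [|exact: density_bmf_integrable..].
  by apply: eq_Rintegral => x _; rewrite addrK.
have B0 : 0 <= B by rewrite (le_trans (normr_ge0 (g point))).
rewrite !key//; last first.
  by move=> x; have := gB x; rewrite ler_norml => /andP[]; rewrite lerNl -subr_ge0 opprK addrC.
rewrite -RintegralB//; [|exact: integrableM_bmf..].
by apply: eq_Rintegral => x _; ring.
Qed.

End density_change.

Lemma eq_bmf {R : realType} d (T : measurableType d) (F G : T -> R) :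
  F =1 G -> bmf F -> bmf G.
Proof. by move=> /funext ->. Qed.

Section path_integrals.
Context {R : realType} {dX : measure_display} {X : measurableType dX}.
Variable mu : {finite_measure set X -> \bar R}.
Variables (q t : nat -> X -> X -> R) (a b c : R).
Hypothesis a0 : 0 < a.
Hypothesis mq : forall k, measurable_fun setT (fun z : X * X => q k.+1 z.1 z.2).
Hypothesis qab : forall k x' x, a <= q k.+1 x' x <= b.
Hypothesis mt : forall k, measurable_fun setT (fun z : X * X => t k.+1 z.1 z.2).
Hypothesis tc : forall k x x', `|t k.+1 x x'| <= c.

(** Stated on sequences, so that the recursion removes the head without any cast between tuple
    types; [k] is the time of [x], and [s] lists the later states. *)
Fixpoint sdens (k : nat) (x : X) (s : seq X) : R :=
  if s is x' :: s' then q k.+1 x' x * sdens k.+1 x' s' else 1.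

Fixpoint sscore (k : nat) (x : X) (s : seq X) : R :=
  if s is x' :: s' then t k.+1 x x' + sscore k.+1 x' s' else 0.

Let bq := bmf_q a0 mq qab.
Let bt := bmf_t mt tc.
Let bq1 := bmf_q1 a0 mq qab.
Let bt1 := bmf_t1 mt tc.

Section tuples.
Variable m : nat.
Let mhead : measurable_fun setT
  (fun z : X * m.+1.-tuple X => (z.1, thead z.2)).
Proof.
apply: measurable_fun_pair => //.
exact: (measurableT_comp (measurable_tnth ord0)).
Qed.
Let mnext : measurable_fun setT
  (fun z : X * m.+1.-tuple X => (thead z.2, [tuple of behead z.2])).
Proof.
apply: measurable_fun_pair.
  exact: (measurableT_comp (measurable_tnth ord0)).
exact: (measurableT_comp (@measurable_behead _ _ _)).
Qed.

Lemma bmf_head F : bmf (fun z : X * X => F z.1 z.2) ->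
  bmf (fun z : X * m.+1.-tuple X => F z.1 (thead z.2) : R).
Proof. by move=> bF; exact: (bmf_comp bF mhead). Qed.

Lemma bmf_next (F : X -> seq X -> R) : bmf (fun z : X * m.-tuple X => F z.1 z.2) ->
  bmf (fun z : X * m.+1.-tuple X => F (thead z.2) (behead z.2)).
Proof. by move=> bF; exact: (bmf_comp bF mnext). Qed.
End tuples.

Lemma bmf_sdens m k : bmf (fun z : X * m.-tuple X => sdens k z.1 z.2).
Proof.
elim: m k => [|m IH] k.
  rewrite (_ : (fun _ => _) = (fun=> 1)); first exact: bmf_cst.
  by apply/funext => -[x s]; rewrite (tuple0 s).
have := bmfM (bmf_head (F := fun x x' => q k.+1 x' x) m (bq k))
  (bmf_next (F := sdens k.+1) (IH k.+1)).
by apply: eq_bmf => -[x s]; rewrite (tuple_eta s).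
Qed.

Lemma bmf_sscore m k : bmf (fun z : X * m.-tuple X => sscore k z.1 z.2).
Proof.
elim: m k => [|m IH] k.
  rewrite (_ : (fun _ => _) = (fun=> 0)); first exact: bmf_cst.
  by apply/funext => -[x s]; rewrite (tuple0 s).
have := bmfD (bmf_head m (bt k)) (bmf_next (F := sscore k.+1) (IH k.+1)).
by apply: eq_bmf => -[x s]; rewrite (tuple_eta s).
Qed.

Lemma bmf_last m psi : bmf psi ->
  bmf (fun z : X * m.-tuple X => psi (last z.1 z.2) : R).
Proof.
move=> bpsi; elim: m => [|m IH].
  rewrite (_ : (fun _ => _) = psi \o fst); first exact: bmf_comp.
  by apply/funext => -[x s]; rewrite (tuple0 s).
have := bmf_next (F := fun x s => psi (last x s)) IH.
by apply: eq_bmf => -[x s]; rewrite (tuple_eta s).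
Qed.

Lemma bmf_tuple m (F : X -> seq X -> R) x :
  bmf (fun z : X * m.-tuple X => F z.1 z.2) -> bmf (fun s : m.-tuple X => F x s).
Proof. by move=> bF; exact: (bmf_comp bF (pair1_measurable x)). Qed.

Lemma Rintegral_pown0 (G : 0.-tuple X -> R) :
  \int[pown mu 0]_s G s = G [tuple].
Proof.
have -> : \int[pown mu 0]_s G s =
    fine (integral (pown mu 0 : set (0.-tuple X) -> \bar R) setT (EFin \o G)) by [].
rewrite pownE integral_dirac//; first by rewrite diracT mul1e.
rewrite (_ : (fun s => (G s)%:E) = cst (G [tuple])%:E); first exact: measurable_cst.
by apply/funext => s; rewrite /= (tuple0 s).
Qed.

Lemma Rintegral_pown_bounded m k x (F : X -> seq X -> R) :
  bmf (fun z : X * m.-tuple X => F z.1 z.2) ->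
  bmf (fun s : m.+1.-tuple X => q k.+1 (thead s) x * F (thead s) (behead s)) ->
  \int[pown mu m.+1]_s (q k.+1 (thead s) x * F (thead s) (behead s)) =
  \int[mu]_x' (q k.+1 x' x * \int[pown mu m]_s F x' s).
Proof.
move=> bF bG; apply: (Rintegral_pown (p := fun x' => q k.+1 x' x)
   (K := fun z => F z.1 z.2) bG.1 (bmf_integrable mu (bq1 k x)) bF).
by move=> x' s; rewrite theadE.
Qed.

Lemma path_Vsg m k x psi : bmf psi ->
  \int[pown mu m]_s (sdens k x s * psi (last x s)) = Vsg mu q m k psi x.
Proof.
move=> bpsi; elim: m k x => [|m IH] k x; first by rewrite Rintegral_pown0 /= mul1r.
have bK j n : bmf (fun z : X * n.-tuple X => sdens j z.1 z.2 * psi (last z.1 z.2)).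
  by apply: bmfM; [exact: bmf_sdens|exact: bmf_last].
rewrite (@eq_Rintegral _ _ _ _ setT (fun s => q k.+1 (thead s) x *
    (sdens k.+1 (thead s) (behead s) * psi (last (thead s) (behead s))))); last first.
  by move=> s _; rewrite (tuple_eta s) /= mulrA.
rewrite (Rintegral_pown_bounded (F := fun x s => sdens k.+1 x s * psi (last x s)))//.
  by apply: eq_Rintegral => x' _; rewrite IH.
have := bmf_tuple (F := fun x s => sdens k x s * psi (last x s)) x (bK k m.+1).
by apply: eq_bmf => s; rewrite (tuple_eta s) /= mulrA.
Qed.

Lemma path_Wsg m k x psi : bmf psi ->
  \int[pown mu m]_s (sdens k x s * (sscore k x s * psi (last x s))) =
  Wsg mu q t m k psi x.
Proof.
move=> bpsi; elim: m k x => [|m IH] k x.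
  by rewrite Rintegral_pown0 /= mul0r mulr0.
have bV j n : bmf (fun z : X * n.-tuple X => sdens j z.1 z.2 * psi (last z.1 z.2)).
  by apply: bmfM; [exact: bmf_sdens|exact: bmf_last].
have bK j n : bmf (fun z : X * n.-tuple X =>
    sdens j z.1 z.2 * (sscore j z.1 z.2 * psi (last z.1 z.2))).
  by do 2 (apply: bmfM; [exact: bmf_sdens || exact: bmf_sscore|]); exact: bmf_last.
have bF : bmf (fun z : X * m.-tuple X => t k.+1 x z.1 *
    (sdens k.+1 z.1 z.2 * psi (last z.1 z.2)) +
    sdens k.+1 z.1 z.2 * (sscore k.+1 z.1 z.2 * psi (last z.1 z.2))).
  apply: bmfD => //; apply: bmfM => //.
  exact: (bmf_comp (bt1 k x) (@measurable_fst _ _ X (m.-tuple X))).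
rewrite (@eq_Rintegral _ _ _ _ setT (fun s => q k.+1 (thead s) x *
    (t k.+1 x (thead s) *
     (sdens k.+1 (thead s) (behead s) * psi (last (thead s) (behead s))) +
     sdens k.+1 (thead s) (behead s) *
      (sscore k.+1 (thead s) (behead s) * psi (last (thead s) (behead s)))))); last first.
  by move=> s _; rewrite (tuple_eta s) /=; ring.
rewrite (Rintegral_pown_bounded (F := fun x' s => t k.+1 x x' *
    (sdens k.+1 x' s * psi (last x' s)) +
    sdens k.+1 x' s * (sscore k.+1 x' s * psi (last x' s))))//.
  apply: eq_Rintegral => x' _; congr (_ * _).
  have b1 := bmf_tuple (F := fun x s => sdens k.+1 x s * psi (last x s)) x' (bV k.+1 m).
  have b2 := bmf_tuple (F := fun x s => sdens k.+1 x s * (sscore k.+1 x s * psi (last x s)))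
    x' (bK k.+1 m).
  rewrite RintegralD//; [|exact: bmf_integrable (bmfZ _ b1)|exact: bmf_integrable b2].
  by rewrite RintegralZl//; [rewrite path_Vsg// IH|exact: bmf_integrable b1].
have := bmf_tuple (F := fun x s => sdens k x s * (sscore k x s * psi (last x s))) x (bK k m.+1).
by apply: eq_bmf => s; rewrite (tuple_eta s) /=; ring.
Qed.

End path_integrals.

Section set_function_integral.
Import HBNNSimple.

(** [path_law] and [eta] are bare set functions, known to agree with a measure on measurable sets
    only. This is enough: the integral evaluates them on level sets of simple functions. *)
Lemma eq_set_function_integral {R : realType} d (T : measurableType d)
    (m1 m2 : set T -> \bar R) (F : T -> \bar R) :
  (forall A, measurable A -> m1 A = m2 A) ->
  (\int[m1]_x F x = \int[m2]_x F x)%E.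
Proof.
move=> m12; rewrite /integral.
by congr (ereal_sup _ - ereal_sup _)%E; apply: eq_imagel => h _;
  apply: eq_fsbigr => r _; rewrite m12//.
Qed.

End set_function_integral.

Section path_lists.
Context {R : realType} {dX : measure_display} {X : measurableType dX}.
Variables (q t : nat -> X -> X -> R).

Lemma sdensE k x0 x s :
  sdens q k x s =
  \prod_(j < size s) q (k + j).+1 (nth x0 s j) (nth x0 (x :: s) j).
Proof.
elim: s k x => [|x' s IH] k x; first by rewrite big_ord0.
rewrite /= big_ord_recl /= addn0 IH; congr (_ * _).
by apply: eq_bigr => j _; rewrite addSnnS.
Qed.

Lemma sscoreE k x0 x s :
  sscore t k x s =
  \sum_(j < size s) t (k + j).+1 (nth x0 (x :: s) j) (nth x0 s j).
Proof.
elim: s k x => [|x' s IH] k x; first by rewrite big_ord0.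
rewrite /= big_ord_recl /= addn0 IH; congr (_ + _).
by apply: eq_bigr => j _; rewrite addSnnS.
Qed.

End path_lists.

(** * The exact derivative as a functional of the initial law *)

Section exact_derivative.
Context {R : realType} {d : nat}.
Context {dX dY : measure_display} {X : measurableType dX} {Y : measurableType dY}.
Variables (mu : {finite_measure set X -> \bar R}).
Variables (pi : 'rV[R]_d -> X -> R) (f : 'rV[R]_d -> X -> X -> R)
  (g : 'rV[R]_d -> Y -> X -> R) (th : 'rV[R]_d) (y : nat -> Y) (i : 'I_d).

Notation qM := (q f g th y).
(** The analysis is real-valued, one coordinate of the gradient at a time. At time 0 the first
    argument is a dummy, whence the recurring [tM 0 x x]. *)
Definition tM k x x' : R := score pi f g th y k x x' 0 i.

Let pred_nth n (x : X) (s : n.-tuple X) (j : 'I_n) :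
  tnth [tuple of x :: s] (inord (lift ord0 j).-1) = nth x (x :: s) j.
Proof.
have jn : (j < n.+1)%N by rewrite ltnS ltnW// ltn_ord.
by rewrite (tnth_nth x) /= inordK.
Qed.

Let lift_nth n (x : X) (s : n.-tuple X) (j : 'I_n) :
  tnth [tuple of x :: s] (lift ord0 j) = nth x s j.
Proof. by rewrite (tnth_nth x). Qed.

Lemma path_density_cons n x (s : n.-tuple X) :
  path_density pi f g th y [tuple of x :: s] = pi th x * sdens qM 0 x s.
Proof.
have -> : sdens qM 0 x s =
    \prod_(j < n) qM j.+1 (nth x s j) (nth x (x :: s) j).
  by rewrite (sdensE _ _ x) size_tuple.
rewrite /path_density; congr (_ * _).
rewrite big_mkcond big_ord_recl /= mul1r; apply: eq_bigr => j _.
by rewrite pred_nth lift_nth.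
Qed.

Lemma path_score_cons n x (s : n.-tuple X) :
  path_score pi f g th y [tuple of x :: s] 0 i = tM 0 x x + sscore tM 0 x s.
Proof.
have -> : sscore tM 0 x s =
    \sum_(j < n) tM j.+1 (nth x (x :: s) j) (nth x s j).
  by rewrite (sscoreE _ _ x) size_tuple.
rewrite /path_score summxE big_ord_recl.
congr (_ + _); apply: eq_bigr => j _.
by rewrite pred_nth lift_nth.
Qed.

Lemma path_last n x (s : n.-tuple X) : tnth [tuple of x :: s] ord_max = last x s.
Proof.
rewrite (tnth_nth x) /= -[RHS]nth_last size_tuple.
by case: n s => [|n] s //=; rewrite (tuple0 s).
Qed.

Variables (a b c : R).
Hypothesis a0 : 0 < a.
Hypothesis mq : forall k, measurable_fun setT (fun z : X * X => qM k.+1 z.1 z.2).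
Hypothesis qab : forall k x' x, a <= qM k.+1 x' x <= b.
Hypothesis mt : forall k, measurable_fun setT (fun z : X * X => tM k z.1 z.2).
Hypothesis tc : forall k x x', `|tM k x x'| <= c.
Hypothesis muT : (0 < mu setT)%E.
Hypothesis dpi : density mu (pi th).

Let E0 (F : X -> R) := \int[mu]_x (pi th x * F x).

Let mt1 k := mt k.+1.
Let tc1 k := tc k.+1.

Lemma bmf_t0 : bmf (fun x => tM 0 x x).
Proof.
split; last by exists c => x; exact: tc.
exact: (measurableT_comp (mt 0) (measurable_fun_pair (@measurable_id _ _ setT)
  (@measurable_id _ _ setT))).
Qed.

Let b_sd n := @bmf_sdens _ _ _ qM _ _ a0 mq qab n 0.
Let b_ss n := @bmf_sscore _ _ _ tM _ mt1 tc1 n 0.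
Let ipi := density_integrable dpi.

Let mcons2 n : measurable_fun setT
  (fun t : n.+1.-tuple X => (thead t, [tuple of behead t])).
Proof.
apply: measurable_fun_pair; last exact: measurable_behead.
exact: measurable_tnth.
Qed.

Let mpd n : measurable_fun setT (@path_density R d dX dY X Y pi f g th y n).
Proof.
have [mpi _ _] := dpi.
have -> : @path_density R d dX dY X Y pi f g th y n =
    (fun z : X * n.-tuple X => pi th z.1 * sdens qM 0 z.1 z.2) \o
    (fun t => (thead t, [tuple of behead t])).
  by apply/funext => t /=; rewrite [in LHS](tuple_eta t) path_density_cons.
have mz : measurable_fun setT
    (fun z : X * n.-tuple X => pi th z.1 * sdens qM 0 z.1 z.2).
  apply: measurable_funM; last exact: (b_sd n).1.
  exact: measurableT_comp mpi measurable_fst.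
exact: (measurableT_comp mz (@mcons2 n)).
Qed.

Let bscore n : bmf (fun x : n.+1.-tuple X => path_score pi f g th y x 0 i).
Proof.
have := bmf_comp (bmfD (bmf_comp bmf_t0 (@measurable_fst _ _ X (n.-tuple X)))
  (b_ss n)) (@mcons2 n).
apply: eq_bmf => t /=; by rewrite [in RHS](tuple_eta t) path_score_cons.
Qed.

Let blast n psi : bmf psi -> bmf (fun x : n.+1.-tuple X => psi (tnth x ord_max) : R).
Proof. by move=> bpsi; exact: (bmf_comp bpsi (measurable_tnth ord_max)). Qed.

Let ipd n : (pown mu n.+1).-integrable setT
  (EFin \o @path_density R d dX dY X Y pi f g th y n).
Proof.
apply: (integrable_pown (p := pi th) (K := fun z => sdens qM 0 z.1 z.2)) => //.
by move=> x s; rewrite path_density_cons.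
Qed.

Let int_path n (psi : X -> R) : bmf psi ->
  \int[pown mu n.+1]_x (path_density pi f g th y x * psi (tnth x ord_max)) =
  E0 (Vsg mu qM n 0 psi).
Proof.
move=> bpsi.
have bK : bmf (fun z : X * n.-tuple X => sdens qM 0 z.1 z.2 * psi (last z.1 z.2)).
  by apply: bmfM; [exact: b_sd|exact: bmf_last].
rewrite (@Rintegral_pown _ _ _ mu n _ (pi th)
  (fun z => sdens qM 0 z.1 z.2 * psi (last z.1 z.2)))//.
- by apply: eq_Rintegral => x _; rewrite (path_Vsg mu a0 mq qab).
- by apply: measurable_funM; [exact: mpd|exact: (@blast n psi bpsi).1].
- by move=> x s; rewrite path_density_cons path_last mulrA.
Qed.

Let int_path_score n (psi : X -> R) : bmf psi ->
  \int[pown mu n.+1]_x (path_density pi f g th y x *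
    (path_score pi f g th y x 0 i * psi (tnth x ord_max))) =
  E0 (fun x => tM 0 x x * Vsg mu qM n 0 psi x + Wsg mu qM tM n 0 psi x).
Proof.
move=> bpsi.
have bK1 : bmf (fun z : X * n.-tuple X => sdens qM 0 z.1 z.2 * psi (last z.1 z.2)).
  by apply: bmfM; [exact: b_sd|exact: bmf_last].
have bK2 : bmf (fun z : X * n.-tuple X =>
    sdens qM 0 z.1 z.2 * (sscore tM 0 z.1 z.2 * psi (last z.1 z.2))).
  by do 2 (apply: bmfM; [exact: b_sd || exact: b_ss|]); exact: bmf_last.
have bK : bmf (fun z : X * n.-tuple X => tM 0 z.1 z.1 *
    (sdens qM 0 z.1 z.2 * psi (last z.1 z.2)) +
    sdens qM 0 z.1 z.2 * (sscore tM 0 z.1 z.2 * psi (last z.1 z.2))).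
  apply: bmfD => //; apply: bmfM => //.
  exact: (bmf_comp bmf_t0 (@measurable_fst _ _ X (n.-tuple X))).
rewrite (@Rintegral_pown _ _ _ mu n _ (pi th) (fun z => tM 0 z.1 z.1 *
    (sdens qM 0 z.1 z.2 * psi (last z.1 z.2)) +
    sdens qM 0 z.1 z.2 * (sscore tM 0 z.1 z.2 * psi (last z.1 z.2))))//.
- apply: eq_Rintegral => x _; congr (_ * _).
  have b1 := bmf_tuple (F := fun x s => sdens qM 0 x s * psi (last x s)) x bK1.
  have b2 := bmf_tuple (F := fun x s =>
    sdens qM 0 x s * (sscore tM 0 x s * psi (last x s))) x bK2.
  rewrite /= RintegralD//; [|exact: bmf_integrable (bmfZ (tM 0 x x) b1)|exact: bmf_integrable b2].
  rewrite RintegralZl//; last exact: bmf_integrable b1.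
  by rewrite (path_Vsg mu a0 mq qab)// (path_Wsg mu a0 mq qab mt1 tc1).
- apply: measurable_funM; first exact: mpd.
  by apply: measurable_funM; [exact: (bscore n).1|exact: (@blast n psi bpsi).1].
- by move=> x s; rewrite path_density_cons path_last path_score_cons; ring.
Qed.

(** The normalizer of the path law is the mean of [hsg] under the initial law, and expanding phi -
    eta(phi) gives the two terms of [Zval]. This is the starting value of the telescoping sum. *)
Lemma zetaE n phi : bmf phi ->
  zeta mu pi f g th y n phi 0 i =
  Zval E0 (hsg mu qM n 0) (Vsg mu qM n 0 phi)
    (fun x => tM 0 x x * Vsg mu qM n 0 phi x + Wsg mu qM tM n 0 phi x)
    (fun x => tM 0 x x * hsg mu qM n 0 x + Wsg mu qM tM n 0 (fun=> 1) x).
Proof.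
move=> bphi; have [mpi pi0 _] := dpi.
have ME0 : mean E0 := mean_density dpi.
set pd := @path_density R d dX dY X Y pi f g th y n.
have Z0 : 0 < E0 (hsg mu qM n 0).
  exact: (mean_gt0 (hsg_lower_gt0 a0 muT n) (h_ge a0 mq qab muT n 0) (bmf_h mu a0 mq qab n 0) ME0).
set Z := E0 _ in Z0.
have ZE : fine (\int[pow_measure mu (n := n.+1)]_x (pd x)%:E)%E = Z.
  rewrite -pownE -[LHS]/(\int[pown mu n.+1]_x pd x) /Z /hsg -int_path; last exact: bmf_cst.
  by apply: eq_Rintegral => x _; rewrite mulr1.
have pd0 x : 0 <= pd x.
  have q0 k u v : 0 <= qM k.+1 u v by rewrite ltW// (q_gt0 a0 qab).
  rewrite /pd /path_density mulr_ge0//; apply: prodr_ge0 => -[[|k] kn] //= _.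
pose dn x := pd x / Z.
have dn0 x : 0 <= dn x by rewrite divr_ge0// ltW.
have idn : (pown mu n.+1).-integrable setT (EFin \o dn).
  have := integrableZr measurableT Z^-1 (ipd n).
  by apply: eq_integrable => // x _; rewrite /= EFinM.
have [nu nuE] := exists_density_measure (pown mu n.+1)
  (measurable_funM (@mpd n) (measurable_cst Z^-1)) dn0.
have lawE A : measurable A -> @path_law R d dX dY X Y mu pi f g th y n A = nu A.
  move=> mA; rewrite nuE /path_law ZE -pownE muleC -ge0_integralZl//.
  - by apply: eq_integral => x _; rewrite [RHS]EFinM muleC.
  - by apply/measurable_EFinP; apply: measurable_funTS; exact: mpd.
  - by move=> x _; rewrite lee_fin; exact: pd0.
  - by rewrite lee_fin invr_ge0 ltW.
have RD (G : n.+1.-tuple X -> R) : bmf G ->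
    fine (\int[@path_law R d dX dY X Y mu pi f g th y n]_x (G x)%:E)%E =
    (\int[pown mu n.+1]_x (pd x * G x)) / Z.
  move=> bG; rewrite (eq_set_function_integral _ lawE).
  rewrite -[LHS]/(\int[nu]_x G x) (Rintegral_density idn dn0)//; last first.
    by move=> A mA; rewrite nuE.
  rewrite mulrC -RintegralZl//; last exact: integrableM_bmf.
  by apply: eq_Rintegral => x _; rewrite /dn mulrAC mulrC.
have etaE : fine (\int[Defs.eta mu pi f g th y n]_x (phi x)%:E)%E =
    E0 (Vsg mu qM n 0 phi) / Z.
  have mlast := @measurable_tnth _ X n.+1 ord_max.
  rewrite (@eq_set_function_integral _ _ _ _
    (pushforward nu (fun x : n.+1.-tuple X => tnth x ord_max))); last first.
    move=> A mA; rewrite /Defs.eta /pushforward lawE//.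
    by rewrite -[_ @^-1` _]setTI; exact: mlast.
  have nuE' A : measurable A -> nu A = (\int[pown mu n.+1]_(x in A) (dn x)%:E)%E.
    by rewrite nuE.
  rewrite integral_pushforward//; first last.
  - rewrite preimage_setT; exact: (density_bmf_integrable idn dn0 nuE' (@blast n phi bphi)).
  - by apply/measurable_EFinP; case: bphi.
  rewrite preimage_setT -[LHS]/(\int[nu]_x phi (tnth x ord_max)).
  rewrite (Rintegral_density idn dn0 nuE' (@blast n phi bphi)) -int_path// mulrC.
  rewrite -RintegralZl//; last exact: integrableM_bmf (ipd n) (@blast n phi bphi).
  by apply: eq_Rintegral => x _; rewrite /dn mulrAC mulrC.
rewrite /zeta mxE RD; last first.
  by apply: bmfM => //; apply: bmfB; [exact: blast|exact: bmf_cst].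
rewrite etaE; set cc := E0 (Vsg _ _ _ _ _) / Z.
have i1 : (pown mu n.+1).-integrable setT (EFin \o (fun x => pd x *
    (path_score pi f g th y x 0 i * phi (tnth x ord_max)))).
  by apply: integrableM_bmf => //; apply: bmfM => //; exact: blast.
have i2 : (pown mu n.+1).-integrable setT (EFin \o (fun x => pd x *
    (path_score pi f g th y x 0 i * (fun=> 1) (tnth x ord_max)))).
  by apply: integrableM_bmf => //; apply: bmfM => //; exact: bmf_cst.
rewrite (@eq_Rintegral _ _ _ _ setT (fun x =>
    pd x * (path_score pi f g th y x 0 i * phi (tnth x ord_max)) -
    cc * (pd x * (path_score pi f g th y x 0 i * (fun=> 1) (tnth x ord_max))))); last first.
  by move=> x _; rewrite /=; ring.
rewrite RintegralB//; last by have := integrableZl measurableT cc i2; exact: eq_integrable.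
have S1 : \int[pown mu n.+1]_x (pd x * (path_score pi f g th y x 0 i * 1)) =
    E0 (fun x => tM 0 x x * Vsg mu qM n 0 (fun=> 1) x + Wsg mu qM tM n 0 (fun=> 1) x).
  exact: (int_path_score n (bmf_cst 1)).
rewrite RintegralZl// S1 int_path_score//.
by rewrite /Zval -/Z /cc /hsg; field; rewrite gt_eqF.
Qed.

End exact_derivative.

(** * The particle backward recursion *)

Section particles.
Context {R : realType} {d : nat}.
Context {dX dY : measure_display} {X : measurableType dX} {Y : measurableType dY}.
Variables (mu : {finite_measure set X -> \bar R}).
Variables (pi : 'rV[R]_d -> X -> R) (f : 'rV[R]_d -> X -> X -> R)
  (g : 'rV[R]_d -> Y -> X -> R) (th : 'rV[R]_d) (y : nat -> Y) (i : 'I_d).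

Notation qM := (q f g th y).
Notation tM := (tM pi f g th y i).

(* The conditional expectation of T_n given x_n = x under Q^N_n. *)
Fixpoint tauN {N : nat} (xi : nat -> 'I_N -> X) (n : nat) (x : X) : R :=
  match n with
  | 0 => tM 0 x x
  | m.+1 => MN f g th y xi m.+1 x (fun x' => tauN xi m x' + tM m.+1 x' x)
  end.

(** [backward] appends states at the end, whereas integrals over paths split off the first state;
    the score is therefore decomposed from both sides. *)
Lemma path_score_rcons n (s : n.+1.-tuple X) x :
  path_score pi f g th y [tuple of rcons s x] 0 i =
  path_score pi f g th y s 0 i + tM n.+1 (tnth s ord_max) x.
Proof.
rewrite /path_score !summxE big_ord_recr /=; congr (_ + _).
  apply: eq_bigr => j _.
  rewrite !(tnth_nth x) /= !nth_rcons !size_tuple.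
  have jn := ltn_ord j.
  have jp : (j.-1 < n.+1)%N by rewrite (leq_ltn_trans (leq_pred _)).
  by rewrite !inordK ?jn ?jp// ltnS ltnW.
rewrite /tM !(tnth_nth x) /= !nth_rcons !size_tuple /= ltnn eqxx.
have n2 : (n < n.+2)%N by rewrite ltnS ltnW.
by rewrite (inordK n2) ltnSn.
Qed.

Section fixed_array.
Context {N : nat} (N0 : (0 < N)%N) (xi : nat -> 'I_N -> X).
Hypothesis q0 : forall k x' x, 0 < qM k.+1 x' x.

Let NR0 : 0 < N%:R :> R. Proof. by rewrite ltr0n. Qed.

Let sum_ord_gt0 (F : 'I_N -> R) : (forall j, 0 < F j) -> 0 < \sum_j F j.
Proof.
by move=> F0; rewrite (bigD1 (Ordinal N0))//= ltr_pwDl// sumr_ge0// => j _; exact: ltW.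
Qed.

Lemma mean_etaN n : mean (etaN xi n : (X -> R) -> R).
Proof.
split.
- by move=> F G _ _; rewrite /etaN -mulrDr big_split.
- by move=> r F _; rewrite /etaN mulrCA [in RHS]mulr_sumr.
- by move=> F _ F0; rewrite mulr_ge0 ?invr_ge0 ?sumr_ge0// ltW.
- by rewrite /etaN sumr_const card_ord mulVf// gt_eqF.
Qed.

Lemma etaN_gt0 n (F : X -> R) : (forall x, 0 < F x) -> 0 < etaN xi n F.
Proof.
by move=> F0; rewrite mulr_gt0 ?invr_gt0//; exact: sum_ord_gt0.
Qed.

Lemma mean_MN n x : mean (MN f g th y xi n.+1 x).
Proof.
have E0 : 0 < etaN xi n (qM n.+1 x) by apply: etaN_gt0 => x'; exact: q0.
split.
- move=> F G _ _; rewrite /MN /etaN /= -mulrDl -mulrDr -big_split /=.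
  by congr (_ * _ / _); apply: eq_bigr => j _; rewrite mulrDl.
- move=> r F _; rewrite /MN /etaN /= mulrA; congr (_ / _).
  rewrite [RHS]mulrCA; congr (_ * _); rewrite mulr_sumr.
  by apply: eq_bigr => j _; rewrite -mulrA.
- move=> F _ F0; rewrite /MN /= divr_ge0 ?(ltW E0)// mulr_ge0 ?invr_ge0 ?(ltW NR0)//.
  by rewrite sumr_ge0// => j _; rewrite mulr_ge0// ltW.
- rewrite /MN /= [X in X / _](_ : _ = etaN xi n (qM n.+1 x)); last first.
    by congr etaN; apply/funext => x'; rewrite mul1r.
  by rewrite divff// gt_eqF.
Qed.

(** [G] gathers the scores of the later steps and [K] the centred test function at the final state,
    both constant once the later states are fixed; the induction moves one more score into [G]. *)
Lemma backward_score n x (F : n.+1.-tuple X -> R) (G K : R) :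
  (forall m, bmf (tauN xi m)) ->
  (forall k x, bmf (fun x' => tM k.+1 x' x)) ->
  (forall s, tnth s ord_max = x ->
     F s = (path_score pi f g th y s 0 i + G) * K) ->
  backward f g th y xi x F = (tauN xi n x + G) * K.
Proof.
move=> btau bt; elim: n x F G => [|n IH] x F G FE /=.
  rewrite FE//; congr ((_ + _) * _).
  by rewrite /path_score summxE big_ord1 /tM /score.
rewrite -/tauN.
have bT : bmf (fun x' => tauN xi n x' + tM n.+1 x' x) by apply: bmfD => //; exact: btau.
have MM := mean_MN n x.
rewrite (_ : (fun x' => _) = (fun x' => (tauN xi n x' + tM n.+1 x' x + G) * K)).
  rewrite (meanZr MM); last by apply: bmfD => //; exact: bmf_cst.
  by rewrite (meanD MM)//; [rewrite (mean_cst MM)|exact: bmf_cst].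
apply/funext => x'; rewrite -addrA; apply: IH => s sx'.
rewrite FE ?path_score_rcons ?sx' ?addrA//.
by rewrite (tnth_nth x) /= nth_rcons size_tuple ltnn eqxx.
Qed.

(** The final value of the telescoping sum: with no future, [hsg] is 1, [Wsg] is 0, and [Zval] is
    the empirical covariance of tau^N_n and phi. *)
Lemma zetaNE n phi : bmf phi ->
  (forall m, bmf (tauN xi m)) ->
  (forall k x, bmf (fun x' => tM k.+1 x' x)) ->
  zetaN pi f g th y xi n phi 0 i =
  Zval (etaN xi n) (hsg mu qM 0 n) (Vsg mu qM 0 n phi)
    (fun x => tauN xi n x * Vsg mu qM 0 n phi x + Wsg mu qM tM 0 n phi x)
    (fun x => tauN xi n x * hsg mu qM 0 n x + Wsg mu qM tM 0 n (fun=> 1) x).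
Proof.
move=> bphi btau bt; have ME := mean_etaN n.
rewrite /zetaN mxE /QN.
rewrite (_ : (fun x => backward _ _ _ _ _ _ _) =
    (fun x => tauN xi n x * phi x - etaN xi n phi * tauN xi n x)); last first.
  apply/funext => x.
  rewrite (@backward_score n x _ 0 (phi x - etaN xi n phi))//.
    by rewrite addr0; ring.
  by move=> s ->; rewrite addr0.
have btp : bmf (fun x => tauN xi n x * phi x) by exact: bmfM.
rewrite (meanB ME)//; last exact: bmfZ.
rewrite (meanZ ME)// /Zval /hsg /= (mean1 ME) expr1n !divr1.
by congr (etaN xi n _ - _ * etaN xi n _); apply/funext => x; rewrite ?mulr1 addr0.
Qed.

Section one_step.
Variables (a b c : R).
Hypothesis a0 : 0 < a.
Hypothesis mq : forall k, measurable_fun setT (fun z : X * X => qM k.+1 z.1 z.2).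
Hypothesis qab : forall k x' x, a <= qM k.+1 x' x <= b.
Hypothesis mt : forall k, measurable_fun setT (fun z : X * X => tM k.+1 z.1 z.2).
Hypothesis tc : forall k x x', `|tM k.+1 x x'| <= c.
Hypothesis g0 : forall k x, 0 < g th (y k) x.
Hypothesis df : cond_density mu (f th).
Hypothesis muT : (0 < mu setT)%E.
Hypothesis btau : forall m, bmf (tauN xi m).

Definition mixture_mean k (F : X -> R) : R :=
  \int[mu]_x' (mixture_density f g th y k.+1 (xi k) x' * F x').

Let Gs k := \sum_(j < N) g th (y k) (xi k j).

Let Gs0 k : 0 < Gs k.
Proof. exact: sum_ord_gt0. Qed.

Let mixE k x' : mixture_density f g th y k.+1 (xi k) x' =
  (\sum_(j < N) qM k.+1 x' (xi k j)) / Gs k.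
Proof. by congr (_ / _); apply: eq_bigr => j _; rewrite mulrC. Qed.

Let bqj k j : bmf (fun x' => qM k.+1 x' (xi k j)).
Proof. exact: (bmf_q1 a0 mq qab). Qed.

Lemma bmf_sum (I : finType) (F : I -> X -> R) : (forall j, bmf (F j)) ->
  bmf (fun x => \sum_j F j x).
Proof.
move=> bF; split; first by apply: measurable_sum => j; case: (bF j).
have /choice[B FB] : forall j, exists B, forall x, `|F j x| <= B.
  by move=> j; case: (bF j).
by exists (\sum_j B j) => x; rewrite (le_trans (ler_norm_sum _ _ _))// ler_sum.
Qed.

Lemma Rintegral_sum (I : finType) (F : I -> X -> R) : (forall j, bmf (F j)) ->
  \int[mu]_x (\sum_j F j x) = \sum_j \int[mu]_x F j x.
Proof.
move=> bF; have : forall s : seq I,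
    \int[mu]_x (\sum_(j <- s) F j x) = \sum_(j <- s) \int[mu]_x F j x /\
    bmf (fun x => \sum_(j <- s) F j x).
  elim=> [|j s [IH bs]].
    split; last by apply: eq_bmf (bmf_cst 0) => x; rewrite big_nil.
    rewrite big_nil (@eq_Rintegral _ _ _ _ setT (fun=> 0)) ?Rintegral_cst ?mul0r//.
    by move=> x _; rewrite big_nil.
  split; last by apply: eq_bmf (bmfD (bF j) bs) => x; rewrite big_cons.
  rewrite big_cons -IH -RintegralD//; [|exact: bmf_integrable..].
  by apply: eq_Rintegral => x _; rewrite big_cons.
by move=> /(_ (index_enum I))[].
Qed.

Lemma mixture_density_density k :
  density mu (mixture_density f g th y k.+1 (xi k)).
Proof.
have bmix : bmf (fun x' => (Gs k)^-1 * \sum_(j < N) qM k.+1 x' (xi k j)).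
  by apply: bmfZ; exact: bmf_sum.
have E x' : (Gs k)^-1 * (\sum_(j < N) qM k.+1 x' (xi k j)) =
    mixture_density f g th y k.+1 (xi k) x' by rewrite mixE mulrC.
split.
- exact: (eq_bmf E bmix).1.
- by move=> x'; rewrite mixE divr_ge0 ?sumr_ge0 ?(ltW (Gs0 k))// => j _; exact: ltW.
have := bmf_integrable mu (eq_bmf E bmix) => /(integrable_fin_num measurableT)/fineK <-.
congr EFin; rewrite -[LHS]/(\int[mu]_x' mixture_density f g th y k.+1 (xi k) x').
rewrite (@eq_Rintegral _ _ _ _ setT (fun x' => (Gs k)^-1 *
  \sum_(j < N) qM k.+1 x' (xi k j))); last first.
  by move=> x' _; rewrite E.
rewrite RintegralZl//; last by apply: bmf_integrable; exact: bmf_sum.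
rewrite Rintegral_sum//.
rewrite [X in _ * X](_ : _ = Gs k) ?mulVf ?gt_eqF//.
apply: eq_bigr => j _; have [_ /(_ (xi k j)) dfj] := df.
rewrite RintegralZl//; last exact: density_integrable.
by case: dfj => _ _; rewrite /Rintegral => ->; rewrite mulr1.
Qed.

Lemma Rintegral_mixture k F : bmf F ->
  mixture_mean k F = (\sum_(j < N) \int[mu]_x' (qM k.+1 x' (xi k j) * F x')) / Gs k.
Proof.
move=> bF; rewrite /mixture_mean -Rintegral_sum; last by move=> j; exact: bmfM.
rewrite mulrC -RintegralZl//; last first.
  by apply: bmf_integrable; apply: bmf_sum => j; exact: bmfM.
by apply: eq_Rintegral => x' _; rewrite mixE -mulr_suml mulrAC mulrA mulrC mulrA.
Qed.

(* sum_j q(x', c_j) tau_{k+1}(x') = sum_j q(x', c_j) (tau_k(c_j) + t(c_j, x')) by the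
   definition of the backward kernel. *)
Lemma mixture_step k m psi : bmf psi ->
  mixture_mean k (fun x' =>
    tauN xi k.+1 x' * Vsg mu qM m k.+1 psi x' + Wsg mu qM tM m k.+1 psi x') =
  (\sum_(j < N) (tauN xi k (xi k j) * Vsg mu qM m.+1 k psi (xi k j) +
    Wsg mu qM tM m.+1 k psi (xi k j))) / Gs k.
Proof.
move=> bpsi.
have bV := bmf_V mu a0 mq qab m k.+1 bpsi.
have bW := bmf_W mu a0 mq qab mt tc m k.+1 bpsi.
rewrite Rintegral_mixture; last by apply: bmfD => //; exact: bmfM.
congr (_ / _); rewrite -Rintegral_sum; last first.
  by move=> j; apply: bmfM => //; apply: bmfD => //; exact: bmfM.
pose F j x' := tauN xi k (xi k j) * (qM k.+1 x' (xi k j) * Vsg mu qM m k.+1 psi x') +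
   qM k.+1 x' (xi k j) * (tM k.+1 (xi k j) x' * Vsg mu qM m k.+1 psi x' +
     Wsg mu qM tM m k.+1 psi x').
have bt j : bmf (tM k.+1 (xi k j)) := bmf_t1 mt tc k (xi k j).
have b1 j : bmf (fun x' => qM k.+1 x' (xi k j) * Vsg mu qM m k.+1 psi x') by exact: bmfM.
have b2 j : bmf (fun x' => qM k.+1 x' (xi k j) *
    (tM k.+1 (xi k j) x' * Vsg mu qM m k.+1 psi x' + Wsg mu qM tM m k.+1 psi x')).
  by apply: bmfM => //; apply: bmfD => //; exact: bmfM.
have bF j : bmf (F j) by apply: bmfD => //; exact: bmfZ.
transitivity (\int[mu]_x' \sum_(j < N) F j x'); last first.
  rewrite Rintegral_sum//; apply: eq_bigr => j _.
  rewrite RintegralD//; [|exact: bmf_integrable (bmfZ _ (b1 j))|exact: bmf_integrable].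
  by rewrite RintegralZl//; exact: bmf_integrable.
apply: eq_Rintegral => x' _.
have Q0 : 0 < \sum_(j < N) qM k.+1 x' (xi k j).
  by apply: sum_ord_gt0 => j.
have tauQ : tauN xi k.+1 x' * (\sum_(j < N) qM k.+1 x' (xi k j)) =
    \sum_(j < N) (tauN xi k (xi k j) + tM k.+1 (xi k j) x') * qM k.+1 x' (xi k j).
  rewrite /= /MN /etaN /=; field.
  by rewrite !gt_eqF.
rewrite -mulr_suml mulrDr mulrA (mulrC _ (tauN _ _ _)) tauQ.
rewrite mulr_suml mulr_suml -big_split; apply: eq_bigr => j _ /=.
by rewrite /F; ring.
Qed.

Lemma mixture_step1 k m psi : bmf psi ->
  mixture_mean k (Vsg mu qM m k.+1 psi) = (\sum_(j < N) Vsg mu qM m.+1 k psi (xi k j)) / Gs k.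
Proof.
by move=> bpsi; rewrite Rintegral_mixture//; exact: (bmf_V mu a0 mq qab).
Qed.

(** [Zval] is homogeneous of degree 0 in its functional. Both sides involve the same four sums over
    the particles, divided by the sum of the g's on one side and by N on the other, and these
    factors cancel. *)
Lemma Zval_step k m phi : bmf phi ->
  Zval (mixture_mean k) (hsg mu qM m k.+1) (Vsg mu qM m k.+1 phi)
    (fun x => tauN xi k.+1 x * Vsg mu qM m k.+1 phi x + Wsg mu qM tM m k.+1 phi x)
    (fun x => tauN xi k.+1 x * hsg mu qM m k.+1 x + Wsg mu qM tM m k.+1 (fun=> 1) x) =
  Zval (etaN xi k) (hsg mu qM m.+1 k) (Vsg mu qM m.+1 k phi)
    (fun x => tauN xi k x * Vsg mu qM m.+1 k phi x + Wsg mu qM tM m.+1 k phi x)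
    (fun x => tauN xi k x * hsg mu qM m.+1 k x + Wsg mu qM tM m.+1 k (fun=> 1) x).
Proof.
move=> bphi; rewrite /Zval /hsg !mixture_step//; [|exact: bmf_cst].
rewrite !mixture_step1//; [|exact: bmf_cst].
rewrite /etaN.
have H0 : 0 < \sum_(j < N) Vsg mu qM m.+1 k (fun=> 1) (xi k j).
  have h0 x : 0 < Vsg mu qM m.+1 k (fun=> 1) x by exact: (h_gt0 a0 mq qab muT m.+1 k x).
  exact: sum_ord_gt0.
move: (\sum_(j < N) Vsg mu qM m.+1 k (fun=> 1) (xi k j)) H0 => H H0.
by field; rewrite !gt_eqF.
Qed.

End one_step.

End fixed_array.

End particles.

Section particle_score.
Context {R : realType} {d : nat}.
Context {dX dY : measure_display} {X : measurableType dX} {Y : measurableType dY}.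
Variables (pi : 'rV[R]_d -> X -> R) (f : 'rV[R]_d -> X -> X -> R)
  (g : 'rV[R]_d -> Y -> X -> R) (th : 'rV[R]_d) (y : nat -> Y) (i : 'I_d).

Notation qM := (q f g th y).
Notation tM := (tM pi f g th y i).

Variables (a b c kappa : R).
Hypotheses (a0 : 0 < a) (c0 : 0 <= c).
Hypothesis mq : forall k, measurable_fun setT (fun z : X * X => qM k.+1 z.1 z.2).
Hypothesis qab : forall k x' x, a <= qM k.+1 x' x <= b.
Hypothesis mt : forall k, measurable_fun setT (fun z : X * X => tM k z.1 z.2).
Hypothesis tc : forall k x x', `|tM k x x'| <= c.
Hypotheses (k01 : 0 < kappa <= 1) (kab : kappa <= (a / b) ^+ 2).

Context {N : nat} (N0 : (0 < N)%N).

Let q0 k x' x : 0 < qM k.+1 x' x. Proof. exact: (q_gt0 a0 qab). Qed.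

Let NR0 : 0 < N%:R :> R. Proof. by rewrite ltr0n. Qed.

Section joint.
Context dW (W : measurableType dW) (n : nat) (xi : nat -> 'I_N -> W -> X).
Hypothesis mxi : forall k j, (k < n)%N -> measurable_fun setT (xi k j).

Notation xiw w := (fun k j => xi k j w).

(** [tauN] at time [m] reads only the particles at times below [m], so measurability with respect to
    the past of time [n] is enough. *)
Lemma bmf_tauN_joint m : (m <= n)%N ->
  bmf (fun z : W * X => tauN pi f g th y i (xiw z.1) m z.2).
Proof.
elim: m => [_|m IH mn] /=.
  exact: (bmf_comp (bmf_t0 mt tc) (@measurable_snd _ _ W X)).
have m1 j : measurable_fun setT (fun z : W * X => (z.1, xi m j z.1)).
  apply: measurable_fun_pair => //.
  by apply: measurableT_comp => //; exact: mxi.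
have m2 j : measurable_fun setT (fun z : W * X => (xi m j z.1, z.2)).
  apply: measurable_fun_pair => //.
  by apply: measurableT_comp => //; exact: mxi.
have bq j : bmf (fun z : W * X => qM m.+1 z.2 (xi m j z.1)).
  exact: (bmf_comp (bmf_q a0 mq qab m) (m2 j)).
have bt j : bmf (fun z : W * X => tM m.+1 (xi m j z.1) z.2).
  have bt : bmf (fun z : X * X => tM m.+1 z.1 z.2) by split => //; exists c => z.
  exact: (bmf_comp bt (m2 j)).
have btau j : bmf (fun z : W * X => tauN pi f g th y i (xiw z.1) m (xi m j z.1)).
  exact: (bmf_comp (IH (ltnW mn)) (m1 j)).
apply: bmfM.
  apply: bmfZ; apply: bmf_sum => j; apply: bmfM; last exact: bq.
  by apply: bmfD; [exact: btau|exact: bt].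
apply: (@bmfV _ _ _ a) => //; last by apply: bmfZ; apply: bmf_sum => j; exact: bq.
move=> z; rewrite -(mean_cst (mean_etaN N0 (xiw z.1) m) a) /etaN ler_pM2l ?invr_gt0//.
by apply: ler_sum => j _; case/andP: (qab m z.2 (xi m j z.1)).
Qed.

End joint.

Section fixed.
Variable xi : nat -> 'I_N -> X.

Lemma bmf_tauN m : bmf (tauN pi f g th y i xi m).
Proof.
(* A fixed array is seen as a constant random one; [X] merely provides a nonempty parameter
   space. *)
have := bmf_tauN_joint (W := X) (n := m) (xi := fun k j _ => xi k j)
  (fun k j _ => measurable_cst _) (leqnn m).
by move=> /(bmf_sec point).
Qed.

Lemma bmf_tM2 k x : bmf (fun x' => tM k.+1 x' x).
Proof.
split; last by exists c => x'.
exact: (measurableT_comp (mt k.+1) (pair2_measurable x)).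
Qed.

(** The backward kernels all reweight the same particles, and the conditioning state enters only
    through q: once in the numerator and once in the normalizer, at a cost a / b each. *)
Lemma MN_minor k x u F : (forall v, 0 <= F v) ->
  kappa * MN f g th y xi k.+1 u F <= MN f g th y xi k.+1 x F.
Proof.
move=> F0; have b0 : 0 < b.
  by have /andP[_] := qab k x u; apply: lt_le_trans; exact: q0.
have S0 v : 0 < etaN xi k (qM k.+1 v) by apply: (etaN_gt0 N0) => w; exact: q0.
have ratio v w z : a / b * qM k.+1 v z <= qM k.+1 w z.
  have /andP[aw _] := qab k w z; have /andP[_ vb] := qab k v z.
  by rewrite (le_trans _ aw)// -mulrA ger_pMr// mulrC ler_pdivrMr// mul1r.
have ab0 : 0 < a / b by rewrite divr_gt0.
have Sxu : a / b * etaN xi k (qM k.+1 x) <= etaN xi k (qM k.+1 u).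
  rewrite /etaN mulrCA ler_pM2l ?invr_gt0// mulr_sumr.
  by apply: ler_sum => j _; exact: ratio.
rewrite /MN /= mulrA ler_pdivrMr// mulrAC ler_pdivlMr//.
rewrite (le_trans (ler_wpM2r (ltW (S0 x)) (ler_wpM2r _ kab)))//.
  rewrite mulr_ge0 ?invr_ge0 ?(ltW NR0)// sumr_ge0// => j _.
  by rewrite mulr_ge0// ltW.
set EF := etaN _ _ _.
rewrite [leLHS](_ : _ = (a / b * EF) * (a / b * etaN xi k (qM k.+1 x))); last by ring.
rewrite ler_pM//.
- rewrite mulr_ge0 ?(ltW ab0)// mulr_ge0 ?invr_ge0 ?(ltW NR0)// sumr_ge0// => j _.
  by rewrite mulr_ge0// ltW.
- by rewrite mulr_ge0// ltW.
rewrite /etaN mulrCA ler_pM2l ?invr_gt0// mulr_sumr.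
by apply: ler_sum => j _; rewrite mulrCA ler_wpM2l.
Qed.

(** The same fixed point as for [osc_U], now for the backward recursion and uniformly over all
    particle arrays. *)
Lemma osc_tauN m : osc_le (tauN pi f g th y i xi m) (2 * c / kappa).
Proof.
have /andP[k0 k1] := k01.
elim: m => [|m IH].
  move=> x u; apply: le_trans (_ : 2 * c <= _).
    by have := tc 0 x x; have := tc 0 u u; rewrite !ler_norml /=; lra.
  by rewrite ler_pdivlMr// ler_piMr// mulr_ge0.
move=> x u /=; have M x := mean_MN N0 xi q0 m x.
have D z : MN f g th y xi m.+1 z (fun x' => tauN pi f g th y i xi m x' + tM m.+1 x' z)
    = MN f g th y xi m.+1 z (tauN pi f g th y i xi m) +
      MN f g th y xi m.+1 z (fun x' => tM m.+1 x' z).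
  by apply: (meanD (M z)); [exact: bmf_tauN|exact: bmf_tM2].
rewrite !D -[leRHS](_ : (1 - kappa) * (2 * c / kappa) + 2 * c = _); last first.
  by field; rewrite gt_eqF.
have H1 : MN f g th y xi m.+1 x (tauN pi f g th y i xi m) -
    MN f g th y xi m.+1 u (tauN pi f g th y i xi m) <= (1 - kappa) * (2 * c / kappa).
  apply: (mean_contract (M x) (M u)) => //; [by rewrite k1 ltW| |exact: bmf_tauN].
  by move=> F _ F0; exact: MN_minor.
have H2 z : `|MN f g th y xi m.+1 z (fun x' => tM m.+1 x' z)| <= 2^-1 * (2 * c).
  rewrite mulrA mulVf// mul1r.
  by apply: (mean_norm (M z)) => [|x']; [exact: bmf_tM2|exact: tc].
exact: ler_sub_near H1 (H2 x) (H2 u).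
Qed.

End fixed.

End particle_score.

(** * The score *)

Section gradients.
Context {R : realType} {d : nat}.
Implicit Types (th v : 'rV[R]_d) (G H : 'rV[R]_d -> R).

Lemma derivable_ln_comp G th v : 0 < G th -> derivable G th v ->
  derivable (fun t => ln (G t)) th v.
Proof.
move=> G0 /derivable1P dG; apply/derivable1P.
have lnG : is_derive (G (0 *: v + th)) 1 (@ln R) (G (0 *: v + th))^-1.
  by apply: is_derive1_ln; rewrite scale0r add0r.
have dG' := derivableP dG.
exact: (@ex_derive _ _ _ _ _ _ _
  (@is_derive1_comp R (@ln R) (fun h => G (h *: v + th)) 0 _ _ lnG dG')).
Qed.

Lemma norm_gradient_le G th i : `|gradient G th 0 i| <= enorm (gradient G th).
Proof.
rewrite /enorm -[leLHS]sqrtr_sqr ler_sqrt; last first.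
  by rewrite sumr_ge0// => j _; exact: sqr_ge0.
by rewrite (bigD1 i)//= lerDl sumr_ge0// => j _; exact: sqr_ge0.
Qed.

Section open_set.
Variables (Theta : set 'rV[R]_d) (th : 'rV[R]_d).
Hypotheses (oT : open Theta) (Tth : Theta th).

(** The logarithm of the product splits where both factors are positive, hence on [Theta]; this is a
    neighbourhood of [th], which suffices for derivatives. *)
Lemma derive_ln_mul G H v : (forall t, Theta t -> 0 < G t) ->
  (forall t, Theta t -> 0 < H t) -> derivable G th v -> derivable H th v ->
  derivable (fun t => ln (G t * H t)) th v /\
  'D_v (fun t => ln (G t * H t)) th =
  'D_v (fun t => ln (G t)) th + 'D_v (fun t => ln (H t)) th.
Proof.
move=> G0 H0 dG dH.
have lG := derivable_ln_comp (G0 _ Tth) dG.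
have lH := derivable_ln_comp (H0 _ Tth) dH.
have E : \near th, ln (G th) + ln (H th) = ln (G th * H th).
  have : nbhs th Theta by exact: open_nbhs_nbhs.
  by apply: filterS => t Tt; rewrite lnM ?posrE ?G0 ?H0.
split.
  apply: (near_eq_derivable E); exact: derivableD.
by rewrite -(near_eq_derive v E); exact: deriveD.
Qed.

(** A pointwise limit of difference quotients along steps 1/(m+1); by openness these stay in [Theta]
    from some index [m0] on, and the sequence is shifted by [m0]. *)
Lemma measurable_derive dT (T : measurableType dT) (F : 'rV[R]_d -> T -> R) v :
  (forall t, Theta t -> measurable_fun setT (F t)) ->
  (forall z, derivable (F ^~ z) th v) ->
  measurable_fun setT (fun z => 'D_v (F ^~ z) th).
Proof.
move=> mF dF.
have [m0 m0T] : exists m0, forall m, (m0 <= m)%N -> Theta (m.+1%:R^-1 *: v + th).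
  have cv : (fun m => (m.+1%:R^-1 : R) *: v + th) @ \oo --> 0 *: v + th.
    apply: cvgD; last exact: cvg_cst.
    apply: cvgZr_tmp; exact: cvg_harmonic.
  rewrite scale0r add0r in cv.
  have /cv [m0 _ H] : nbhs th Theta by exact: open_nbhs_nbhs.
  by exists m0 => m /H.
pose u m : R := (m + m0).+1%:R^-1.
have u0 m : u m != 0 by rewrite invr_neq0.
have cu : u @ \oo --> 0 by have := @cvg_harmonic R; rewrite -(cvg_shiftn m0).
apply: (@measurable_fun_cvg _ _ _ _
  (fun m z => (u m)^-1 * (F (u m *: v + th) z - F th z))).
  move=> m; apply: measurable_funM; first exact: measurable_cst.
  by apply: measurable_funB; apply: mF => //; apply: m0T; rewrite leq_addl.
move=> z _; have := dF z; rewrite /derivable /derive => cF.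
by move/cvgr_dnbhsP : cF => /(_ u (conj u0 cu)).
Qed.

End open_set.

End gradients.

Section model_bounds.
Context {R : realType} {d : nat}.
Context {dX dY : measure_display} {X : measurableType dX} {Y : measurableType dY}.
Variables (mu : {measure set X -> \bar R}) (nu : {measure set Y -> \bar R}).
Variables (Theta : set 'rV[R]_d) (pi : 'rV[R]_d -> X -> R)
  (f : 'rV[R]_d -> X -> X -> R) (g : 'rV[R]_d -> Y -> X -> R).
Hypothesis ssm : state_space_model mu nu Theta pi f g.
Variables (rho delta c : R).
Hypotheses (rho0 : 0 < rho) (delta0 : 0 < delta).
Hypothesis bounds : forall (x x' : X) (y : Y) (th : 'rV[R]_d), Theta th ->
  [/\ [/\ has_gradient (fun t => pi t x) th,
          has_gradient (fun t => f t x' x) th &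
          has_gradient (fun t => g t y x) th],
      rho^-1 <= f th x' x <= rho,
      delta^-1 <= g th y x <= delta,
      0 < pi th x &
      Num.max (Num.max (enorm (gradient (fun t => ln (pi t x)) th))
                       (enorm (gradient (fun t => ln (f t x' x)) th)))
              (enorm (gradient (fun t => ln (g t y x)) th)) <= c].
Variables (th : 'rV[R]_d) (y : nat -> Y) (i : 'I_d).
Hypothesis Tth : Theta th.

Let f0 t x' x : Theta t -> 0 < f t x' x.
Proof.
move=> Tt; have [_ /andP[fx _] _ _ _] := bounds x x' point Tt.
by rewrite (lt_le_trans _ fx)// invr_gt0.
Qed.

Let g0' t z x : Theta t -> 0 < g t z x.
Proof.
move=> Tt; have [_ _ /andP[gx _] _ _] := bounds x x z Tt.
by rewrite (lt_le_trans _ gx)// invr_gt0.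
Qed.

Lemma g_gt0 k x : 0 < g th (y k) x. Proof. exact: g0'. Qed.

(** Stated for every parameter in [Theta], because the difference quotients of the score evaluate q
    at parameters near [th]. *)
Lemma measurable_q t k : Theta t ->
  measurable_fun setT (fun z : X * X => q f g t y k.+1 z.1 z.2).
Proof.
move=> Tt; have [_ /(_ _ Tt)[_ [mf _] [mg _]]] := ssm.
apply: measurable_funM; last exact: mf.
have := measurableT_comp mg (pair1_measurable (y k)).
by move=> /measurableT_comp; apply; exact: measurable_snd.
Qed.

Lemma q_bounds k x' x :
  delta^-1 * rho^-1 <= q f g th y k.+1 x' x <= delta * rho.
Proof.
have [_ /andP[f1 f2] /andP[g1 g2] _ _] := bounds x x' (y k) Tth.
have ri : 0 <= rho^-1 by rewrite invr_ge0 ltW.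
have di : 0 <= delta^-1 by rewrite invr_ge0 ltW.
rewrite /q /= !ler_pM//; exact: ltW (f0 _ _ Tth) || exact: ltW (g0' _ _ Tth).
Qed.

(** The factor 2 comes from log q = log g + log f, each with gradient at most [c]; the single term
    at time 0 satisfies the same bound. *)
Lemma score_le k x x' : `|score pi f g th y k x x' 0 i| <= 2 * c.
Proof.
have [[dpi df dg] _ _ pi0 + ] := bounds x x' (y k.-1) Tth.
rewrite !ge_max => /andP[/andP[_ cf] cg].
have c0 : 0 <= c by rewrite (le_trans (sqrtr_ge0 _) cf).
case: k dg cg => [|k] dg cg /=.
  have [_ _ _ _] := bounds x' x' (y 0) Tth.
  rewrite !ge_max => /andP[/andP[cpi _] _].
  rewrite (le_trans (norm_gradient_le _ _ _))// (le_trans cpi)//.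
  by rewrite -[leLHS]mul1r ler_wpM2r// ler1n.
rewrite mxE.
have [oT _] := ssm.
have [_ ->] := @derive_ln_mul _ _ _ th oT Tth (fun t => g t (y k) x) (fun t => f t x' x)
  (delta_mx 0 i) (fun t => g0' (y k) x) (fun t => f0 x' x) (dg i) (df i).
rewrite (le_trans (ler_normD _ _))// mulr_natl mulr2n lerD//.
  have := norm_gradient_le (fun t => ln (g t (y k) x)) th i.
  by rewrite mxE => H; exact: le_trans H cg.
have := norm_gradient_le (fun t => ln (f t x' x)) th i.
by rewrite mxE => H; exact: le_trans H cf.
Qed.

Lemma measurable_score k :
  measurable_fun setT (fun z : X * X => score pi f g th y k z.1 z.2 0 i).
Proof.
have [oT ssmT] := ssm.
case: k => [|k] /=.
  under eq_fun do rewrite mxE.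
  have mpi : measurable_fun setT
      (fun x => 'D_(delta_mx 0 i) (fun t => ln (pi t x)) th).
    apply: (@measurable_derive _ _ Theta th oT Tth _ _ (fun t x => ln (pi t x))).
      by move=> t /ssmT[[mpi _ _] _ _]; exact: measurableT_comp.
    move=> x; have [[dpi _ _] _ _ pi0 _] := bounds x x (y 0) Tth.
    exact: derivable_ln_comp.
  exact: (measurableT_comp mpi measurable_snd).
under eq_fun do rewrite mxE.
apply: (@measurable_derive _ _ Theta th oT Tth _ _
  (fun t (z : X * X) => ln (g t (y k) z.1 * f t z.2 z.1))).
  move=> t Tt; apply: measurableT_comp; first exact: measurable_ln.
  exact: (measurableT_comp (measurable_q k Tt) (@measurable_swap _ _ X X)).
move=> z; have [[_ df dg] _ _ _ _] := bounds z.1 z.2 (y k) Tth.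
have [D _] := @derive_ln_mul _ _ _ th oT Tth (fun t => g t (y k) z.1)
  (fun t => f t z.2 z.1)
  (delta_mx 0 i) (fun t => g0' (y k) z.1) (fun t => f0 z.2 z.1) (dg i) (df i).
exact: D.
Qed.

End model_bounds.

(** * Exponential moments *)

Section orlicz.
Context {R : realType} dO (Omega : measurableType dO) (P : probability Omega R).

(* Jensen: e^m (1 + x - m) <= e^x at the mean m of the x_j and 0. *)
Lemma expR_sum_le (J : finType) (p x : J -> R) : (forall j, 0 <= p j) ->
  \sum_j p j <= 1 ->
  expR (\sum_j p j * x j) <= \sum_j p j * expR (x j) + (1 - \sum_j p j).
Proof.
move=> p0 p1; set m := \sum_j p j * x j.
have tangent z : expR m * (1 + (z - m)) <= expR z.
  have -> : expR z = expR m * expR (z - m) by rewrite -expRD subrKC.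
  by rewrite ler_wpM2l ?expR_ge0// expR_ge1Dx.
have H : \sum_j p j * (expR m * (1 + (x j - m))) <= \sum_j p j * expR (x j).
  by apply: ler_sum => j _; rewrite ler_wpM2l.
have H0 : (1 - \sum_j p j) * (expR m * (1 + (0 - m))) <= 1 - \sum_j p j.
  rewrite -[leRHS]mulr1 ler_wpM2l ?subr_ge0// (le_trans (tangent 0))// expR0//.
have E : \sum_j p j * (expR m * (1 + (x j - m))) =
    expR m * (\sum_j p j * (1 - m) + m).
  have mE : m = \sum_j p j * x j by [].
  rewrite [RHS]mulrDr [X in _ + expR m * X]mE !mulr_sumr -big_split.
  by apply: eq_bigr => j _ /=; ring.
rewrite E -mulr_suml in H.
have -> : expR m = expR m * ((\sum_j p j) * (1 - m) + m) +
    (1 - \sum_j p j) * (expR m * (1 + (0 - m))) by ring.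
exact: lerD.
Qed.

(** V / S lies below a combination of the Z_j with weights a_j / S; convexity averages their moments
    whatever their dependence. The missing weight sits at the value 0, whose exponential 1 is at
    most [B]. *)
Lemma exp_moment_sum (J : finType) (a : J -> R) (S B : R)
    (Z : J -> Omega -> R) (V : Omega -> R) :
  (forall j, 0 <= a j) -> \sum_j a j <= S -> 0 < S -> 1 <= B ->
  (forall j, measurable_fun setT (Z j)) -> measurable_fun setT V ->
  (forall j, (\int[P]_w (expR (Z j w))%:E <= B%:E)%E) ->
  (forall w, V w <= \sum_j a j * Z j w) ->
  (\int[P]_w (expR (V w / S))%:E <= B%:E)%E.
Proof.
move=> a0 aS S0 B1 mZ mV ZB VZ.
pose p j := a j / S.
have p0 j : 0 <= p j by rewrite divr_ge0// ltW.
have p1 : \sum_j p j <= 1 by rewrite -mulr_suml ler_pdivrMr// mul1r.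
have mpZ j : measurable_fun setT (fun w => (p j * expR (Z j w))%:E).
  apply/measurable_EFinP; apply: measurable_funM; first exact: measurable_cst.
  exact: measurableT_comp.
apply: (@le_trans _ _ (\int[P]_w (\sum_j (p j * expR (Z j w))%:E +
    (1 - \sum_j p j)%:E))%E).
  apply: ge0_le_integral => //.
  - apply/measurable_EFinP; apply: measurableT_comp => //.
    by apply: measurable_funM => //; exact: measurable_cst.
  - apply: emeasurable_funD; last exact: measurable_cst.
    by apply: emeasurable_sum => j; exact: mpZ.
  - move=> w _; rewrite sumEFin -EFinD lee_fin.
    apply: le_trans (expR_sum_le (Z^~ w) p0 p1).
    rewrite ler_expR ler_pdivrMr// mulr_suml (le_trans (VZ w))// ler_sum// => j _.
    by rewrite /p mulrAC divfK// gt_eqF.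
rewrite ge0_integralD//; first last.
- by move=> w _; rewrite lee_fin subr_ge0.
- by apply: emeasurable_sum => j; exact: mpZ.
- move=> w _; apply: sume_ge0 => j _; rewrite lee_fin mulr_ge0// expR_ge0//.
rewrite ge0_integral_sum//; last by move=> j w _; rewrite lee_fin mulr_ge0// expR_ge0.
rewrite integral_cst//= probability_setT mule1.
apply: (@le_trans _ _ (\sum_j (p j * B)%:E + (1 - \sum_j p j)%:E))%E.
  apply: leeD => //; apply: lee_sum => j _.
  under eq_integral do rewrite EFinM.
  have mE : measurable_fun setT (fun w => (expR (Z j w))%:E).
    by apply/measurable_EFinP; exact: measurableT_comp.
  rewrite ge0_integralZl_EFin// [leRHS]EFinM.
  by apply: lee_wpmul2l; rewrite ?lee_fin.
rewrite sumEFin -EFinD lee_fin -mulr_suml.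
have : (1 - \sum_j p j) * (B - 1) >= 0 by rewrite mulr_ge0 ?subr_ge0.
lra.
Qed.

(** Raise x / r <= e^(x / r) to the power r. *)
Lemma powR_le_expR (x r : R) : 0 <= x -> 0 < r -> x `^ r <= r `^ r * expR x.
Proof.
move=> x0 r0; have r0' := ltW r0.
have -> : x `^ r = r `^ r * (x / r) `^ r.
  by rewrite -powRM ?divr_ge0// mulrC divfK// gt_eqF.
rewrite ler_wpM2l ?powR_ge0//.
apply: (@le_trans _ _ (expR (x / r) `^ r)).
  rewrite ge0_ler_powR ?nnegrE ?divr_ge0 ?expR_ge0//.
  by apply: le_trans (expR_ge1Dx _); rewrite lerDr.
by rewrite -expRM divfK// gt_eqF.
Qed.

(** The r-th root turns (r S)^r into r S, and B^(1/r) <= B since both [B] and [r] are at least 1. *)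
Lemma exp_moment_Lnorm (V : Omega -> R) (S B r : R) :
  1 <= r -> 0 < S -> 1 <= B -> measurable_fun setT V -> (forall w, 0 <= V w) ->
  (\int[P]_w (expR (V w / S))%:E <= B%:E)%E ->
  ((\int[P]_w (V w `^ r)%:E) `^ r^-1 <= (r * S * B)%:E)%E.
Proof.
move=> r1 S0 B1 mV V0 VB.
have r0 : 0 < r by rewrite (lt_le_trans _ r1).
have rn0 : r != 0 by rewrite gt_eqF.
have [r0' S0'] := (ltW r0, ltW S0).
have B0 : 0 <= B by rewrite (le_trans _ B1).
have H : (\int[P]_w (V w `^ r)%:E <= ((r * S) `^ r * B)%:E)%E.
  apply: (@le_trans _ _ (\int[P]_w (((r * S) `^ r)%:E * (expR (V w / S))%:E))%E).
    apply: ge0_le_integral => //.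
    - by move=> w _; rewrite lee_fin powR_ge0.
    - apply/measurable_EFinP.
      exact: (measurableT_comp (@measurable_powR R r) mV).
    - apply: emeasurable_funM; first exact: measurable_cst.
      apply/measurable_EFinP; apply: measurableT_comp => //.
      by apply: measurable_funM => //; exact: measurable_cst.
    - move=> w _; rewrite -EFinM lee_fin.
      have VS0 : 0 <= V w / S by exact: divr_ge0.
      have -> : V w `^ r = S `^ r * (V w / S) `^ r.
        by rewrite -powRM// mulrC divfK// gt_eqF.
      rewrite (@powRM R r S r r0' S0') (mulrC (r `^ r)) -mulrA ler_wpM2l ?powR_ge0//.
      exact: powR_le_expR.
  have mE : measurable_fun setT (fun w => (expR (V w / S))%:E).
    apply/measurable_EFinP; apply: measurableT_comp => //.
    by apply: measurable_funM => //; exact: measurable_cst.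
  rewrite ge0_integralZl_EFin// ?powR_ge0// EFinM.
  by apply: lee_wpmul2l => //; rewrite lee_fin powR_ge0.
have I0 : (0 <= \int[P]_w (V w `^ r)%:E)%E.
  by apply: integral_ge0 => w _; rewrite lee_fin powR_ge0.
apply: le_trans (_ : ((((r * S) `^ r * B)%:E) `^ r^-1 <= _)%E).
  apply: gt0_ler_poweR => //; first by rewrite invr_ge0.
    by rewrite in_itv /= I0 leey.
  by rewrite in_itv /= leey andbT lee_fin mulr_ge0 ?powR_ge0.
rewrite poweR_EFin lee_fin powRM ?powR_ge0//.
have rS0 : 0 <= r * S by exact: mulr_ge0.
rewrite -powRrM mulfV// powRr1// ler_wpM2l//.
rewrite -[leRHS]powRr1// ler_powR// invf_le1//.
Qed.

End orlicz.

(** * The error bound *)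

Section rates.
Context {R : realType} (kappa : R) (k01 : 0 < kappa <= 1).

Lemma sum_geometric_le n : \sum_(m < n) (1 - kappa) ^+ m <= kappa^-1.
Proof.
have /andP[k0 k1] := k01.
elim: n => [|n IH]; first by rewrite big_ord0 invr_ge0 ltW.
rewrite big_ord_recl expr0.
under eq_bigr do rewrite lift0 exprS.
rewrite -mulr_sumr -[leRHS](_ : 1 + (1 - kappa) * kappa^-1 = _); last first.
  by field; rewrite gt_eqF.
by rewrite lerD2l ler_wpM2l// subr_ge0.
Qed.

Lemma covrate_ge0 K m : 0 <= K -> 0 <= covrate kappa K m.
Proof.
have /andP[k0 k1] := k01 => K0; have b0 : 0 <= 1 - kappa by rewrite subr_ge0.
elim: m => [//|m IH] /=.
by rewrite addr_ge0 ?mulr_ge0 ?exprn_ge0.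
Qed.

(** Summing the recursion, the partial sums obey s' <= (1 - kappa) s + K / kappa, whose fixed point
    is the bound. *)
Lemma sum_covrate_le K n : 0 <= K ->
  \sum_(m < n) covrate kappa K m <= K / kappa ^+ 2.
Proof.
move=> K0; have /andP[k0 k1] := k01.
elim: n => [|n IH]; first by rewrite big_ord0 divr_ge0// exprn_ge0// ltW.
rewrite big_ord_recl add0r.
under eq_bigr do rewrite lift0 /=.
rewrite big_split /= -!mulr_sumr.
rewrite -[leRHS](_ : (1 - kappa) * (K / kappa ^+ 2) + K * kappa^-1 = _); last first.
  by field; rewrite gt_eqF.
apply: lerD; first by rewrite ler_wpM2l// subr_ge0.
by rewrite ler_wpM2l// sum_geometric_le.
Qed.

End rates.

Section joint_cnoise.
Context {R : realType} dW (W : measurableType dW) dX (X : measurableType dX).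
Variables (mu : {finite_measure set X -> \bar R}) (p : W -> X -> R).
Hypotheses (mp : measurable_fun setT (fun z : W * X => p z.1 z.2))
  (dp : forall w, density mu (p w)).
Variables (h : X -> R) (e rho : R).
Hypotheses (e0 : 0 < e) (eh : forall x, e <= h x) (bh : bmf h).
Hypothesis hrho : forall x y, h x <= rho * h y.

Notation E w := (fun F : X -> R => \int[mu]_x (p w x * F x)).

Let ME w : mean (E w). Proof. exact: mean_density (dp w). Qed.

Let Eh w : 0 < E w h. Proof. exact: mean_gt0 e0 eh bh _ (ME w). Qed.

Let mE (F : W -> X -> R) : measurable_fun setT (fun z : W * X => F z.1 z.2) ->
  measurable_fun setT (fun w => E w (F w)).
Proof. by move=> mF; apply: measurable_Rintegral; exact: measurable_funM. Qed.

Let mh : measurable_fun setT (fun z : W * X => h z.2).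
Proof. exact: measurableT_comp bh.1 measurable_snd. Qed.

Let mEhV : measurable_fun setT (fun w => (E w h)^-1).
Proof. by apply: measurable_fun_inv => //; exact: (mE (F := fun _ => h)). Qed.

Let mtilt (F : W -> X -> R) : measurable_fun setT (fun z : W * X => F z.1 z.2) ->
  measurable_fun setT (fun z : W * X => tilt (E z.1) h (F z.1)).
Proof.
move=> mF.
have mt : measurable_fun setT (fun w => tilt (E w) h (F w)).
  apply: measurable_funM => //; apply: (mE (F := fun w x => h x * F w x)).
  exact: measurable_funM.
exact: (measurableT_comp mt measurable_fst).
Qed.

(** Reference law and function both vary with [w], so measurability is needed jointly; the
    oscillation bound makes the supremum uniform in [w]. *)
Lemma bmf_cnoise_joint (F : W -> X -> R) D :
  bmf (fun z : W * X => F z.1 z.2) -> (forall w, osc_le (F w) D) ->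
  bmf (fun z : W * X => cnoise (E z.1) h (F z.1) z.2).
Proof.
move=> bF oF; split; last first.
  exists (rho * D) => z; apply: (cnoise_le e0 eh bh hrho z.2 (ME z.1)) => //.
  exact: (bmf_comp bF (pair1_measurable z.1)).
apply: measurable_funM.
  apply: measurable_funM => //.
  exact: (measurableT_comp mEhV measurable_fst).
by apply: measurable_funB; [case: bF|apply: mtilt; case: bF].
Qed.

Lemma bmf_centered_joint (A C : X -> R) (V : W -> X -> R) DA DV :
  bmf A -> osc_le A DA -> bmf C ->
  bmf (fun z : W * X => V z.1 z.2) -> (forall w, osc_le (V w) DV) ->
  bmf (fun z : W * X => centered (E z.1) h A (V z.1) C z.2).
Proof.
move=> bA oA bC bV oV.
have mA : measurable_fun setT (fun z : W * X => A z.2).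
  exact: measurableT_comp bA.1 measurable_snd.
have bVw w : bmf (V w) := bmf_comp bV (pair1_measurable w).
split.
  apply: measurable_funD; last exact: measurableT_comp bC.1 measurable_snd.
  apply: measurable_funM; apply: measurable_funB => //.
  - by case: bV.
  - by apply: mtilt; case: bV.
  - exact: (mtilt (F := fun _ => A)).
have [B CB] := bC.2; exists (DV * DA + B) => z.
rewrite (le_trans (ler_normD _ _))// lerD// normrM ler_pM//.
  exact: (mean_osc (mean_tilt (ME z.1) e0 eh bh)).
exact: (mean_osc (mean_tilt (ME z.1) e0 eh bh)).
Qed.

Lemma osc_centered (A C V : X -> R) w DA DV DC : bmf A -> osc_le A DA ->
  bmf V -> osc_le V DV -> osc_le C DC ->
  osc_le (centered (E w) h A V C) (2 * DV * DA + DC).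
Proof.
move=> bA oA bV oV oC; apply: osc_leD => //.
apply: (osc_leM (D := DV) (D' := DA)) => //.
- by move=> x; exact: (mean_osc (mean_tilt (ME w) e0 eh bh)).
- by move=> x; exact: (mean_osc (mean_tilt (ME w) e0 eh bh)).
Qed.

End joint_cnoise.

Section error_bound.
Context {R : realType} {d : nat}.
Context {dX dY : measure_display} {X : measurableType dX} {Y : measurableType dY}.
Variables (mu : {finite_measure set X -> \bar R}).
Variables (pi : 'rV[R]_d -> X -> R) (f : 'rV[R]_d -> X -> X -> R)
  (g : 'rV[R]_d -> Y -> X -> R) (th : 'rV[R]_d) (y : nat -> Y) (i : 'I_d).

Notation qM := (q f g th y).
Notation tM := (tM pi f g th y i).

Variables (a b c kappa : R).
Hypotheses (a0 : 0 < a) (c0 : 0 < c).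
Hypothesis mq : forall k, measurable_fun setT (fun z : X * X => qM k.+1 z.1 z.2).
Hypothesis mg : forall k, measurable_fun setT (g th (y k)).
Hypothesis qab : forall k x' x, a <= qM k.+1 x' x <= b.
Hypothesis mt : forall k, measurable_fun setT (fun z : X * X => tM k z.1 z.2).
Hypothesis tc : forall k x x', `|tM k x x'| <= c.
Hypothesis g0 : forall k x, 0 < g th (y k) x.
Hypothesis dpi : density mu (pi th).
Hypothesis df : cond_density mu (f th).
Hypothesis muT : (0 < mu setT)%E.
Hypotheses (k01 : 0 < kappa < 1) (kab : kappa <= (a / b) ^+ 2).

Context {N : nat} (N0 : (0 < N)%N).
Notation tau := (@tauN _ _ _ _ _ _ pi f g th y i N).
Variables (n : nat) (phi : X -> R).
Hypotheses (bphi : bmf phi) (ophi : osc_le phi 1).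

Let c0' := ltW c0.
Let k01' : 0 < kappa <= 1. Proof. by have /andP[-> /ltW->] := k01. Qed.
Let q0 k x' x : 0 < qM k.+1 x' x. Proof. exact: (q_gt0 a0 qab). Qed.
Let mt1 k := mt k.+1.
Let tc1 k := tc k.+1.

(** The density from which the particles at time [k] are drawn; it reads only row k - 1 of the
    array, and time 0 is included so that all local errors have one form. *)
Definition sampling_density (k : nat) (arr : nat -> 'I_N -> X) (x : X) : R :=
  match k with
  | 0 => pi th x
  | k'.+1 => mixture_density f g th y k (arr k') x
  end.

Definition sampling_mean k arr (F : X -> R) := \int[mu]_x (sampling_density k arr x * F x).

Lemma sampling_densityP k arr : density mu (sampling_density k arr).
Proof. by case: k => [//|k]; exact: (mixture_density_density N0 arr q0 a0 mq qab). Qed.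

Notation h k := (hsg mu qM (n - k) k).
Notation A k := (Asg mu qM phi (n - k) k).
Notation U k := (Usg mu qM tM (n - k) k).
Notation C k := (Csg mu qM tM phi (n - k) k).
Notation V arr k := (fun x => tau arr k x + U k x).
Notation L := (4 * c / kappa).
Notation rho := (b / a).
Notation KC := (4 * c + 4 * c / kappa).

(** The filter derivative at time n obtained by running the exact recursion from time [k] on,
    started from the law [E] and the particle statistic tau^N_k. *)
Definition Zstep (arr : nat -> 'I_N -> X) k E := Zval E (h k) (Vsg mu qM (n - k) k phi)
  (fun x => tau arr k x * Vsg mu qM (n - k) k phi x + Wsg mu qM tM (n - k) k phi x)
  (fun x => tau arr k x * h k x + Wsg mu qM tM (n - k) k (fun=> 1) x).

Let bh k := bmf_h mu a0 mq qab (n - k) k.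
Let eh k := h_ge a0 mq qab muT (n - k) k.
Let e0 k := hsg_lower_gt0 a0 muT (n - k).
Let hrho k := h_ratio a0 mq qab muT (n - k) k.
Let bA k := bmf_A a0 mq qab muT bphi (n - k) k.
Let bU k := bmf_U a0 mq qab mt1 tc1 muT (n - k) k.
Let bC k := bmf_C a0 mq qab mt1 tc1 muT bphi (n - k) k.
Let oA k := osc_A a0 mq qab muT bphi ophi k01' kab (n - k) k.
Let oU k := osc_U a0 c0' mq qab mt1 tc1 muT k01' kab (n - k) k.
Let oC k := osc_C a0 c0' mq qab mt1 tc1 muT bphi ophi k01' kab (n - k) k.
Let btau arr m : bmf (tau arr m) := bmf_tauN a0 mq qab mt tc N0 arr m.
Let otau arr m : osc_le (tau arr m) (2 * c / kappa) :=
  osc_tauN a0 c0' mq qab mt tc k01' kab N0 arr m.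

Let oV arr k : osc_le (V arr k) L.
Proof.
have -> : L = 2 * c / kappa + 2 * c / kappa by ring.
by apply: osc_leD; [exact: otau|exact: oU].
Qed.

Let bV arr k : bmf (V arr k).
Proof. by apply: bmfD; [exact: btau|exact: bU]. Qed.

Let mean_sampling_mean k arr : mean (sampling_mean k arr).
Proof. exact: mean_density (sampling_densityP k arr). Qed.

Lemma telescoping arr :
  zetaN pi f g th y arr n phi 0 i - zeta mu pi f g th y n phi 0 i =
  \sum_(k < n.+1) (Zstep arr k (etaN arr k) - Zstep arr k (sampling_mean k arr)).
Proof.
(* The index is shifted by one: [u k] is the value just before the particles at time [k] are drawn,
   so that [u 0] is the exact derivative and [u n.+1] the particle one. *)
pose u k := match k with
  | 0 => zeta mu pi f g th y n phi 0 i
  | k'.+1 => Zstep arr k' (etaN arr k') end.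
have uE k : (k < n.+1)%N -> Zstep arr k (sampling_mean k arr) = u k.
  case: k => [_|k kn].
    by rewrite /Zstep subn0 /= (zetaE a0 mq qab mt tc muT dpi n bphi).
  rewrite /= /Zstep -(subnSK (kn : (k < n)%N)).
  exact: (Zval_step N0 q0 a0 mq qab mt1 tc1 g0 muT (btau arr) k (n - k.+1) bphi).
rewrite (eq_bigr (fun k : 'I_n.+1 => u k.+1 - u k)); last first.
  by move=> k _; rewrite uE.
rewrite -(big_mkord xpredT (fun k => u k.+1 - u k)) telescope_sumr//.
have ZN := zetaNE mu N0 q0 n bphi (btau arr) (fun k x => bmf_tM2 mt tc k x).
by rewrite ZN /= /Zstep subnn.
Qed.

(* [noise true] is the fluctuation of the tilted covariance of V and A plus the
   tilted mean of C; [noise false] is that of the tilted mean of A. *)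
Definition noise (s : bool) k arr : X -> R :=
  if s then cnoise (sampling_mean k arr) (h k)
    (centered (sampling_mean k arr) (h k) (A k) (V arr k) (C k))
  else cnoise (sampling_mean k arr) (h k) (A k).

Definition noise_size (s : bool) k : R :=
  if s then rho * (2 * L * (1 - kappa) ^+ (n - k) + covrate kappa KC (n - k))
  else rho * (1 - kappa) ^+ (n - k).

Lemma local_error arr k :
  `|Zstep arr k (etaN arr k) - Zstep arr k (sampling_mean k arr)| <=
  rho * (`|etaN arr k (noise true k arr)| + L * `|etaN arr k (noise false k arr)|).
Proof.
have hn x : h k x != 0 by rewrite gt_eqF// (h_gt0 a0 mq qab muT).
have E1 : Vsg mu qM (n - k) k phi = (fun x => h k x * A k x).
  by apply/funext => x; rewrite /Asg mulrC divfK.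
have E2 : (fun x => tau arr k x * Vsg mu qM (n - k) k phi x +
    Wsg mu qM tM (n - k) k phi x) = (fun x => h k x * (V arr k x * A k x + C k x)).
  by apply/funext => x; rewrite /Csg /Asg /Usg; field.
have E3 : (fun x => tau arr k x * h k x + Wsg mu qM tM (n - k) k (fun=> 1) x) =
    (fun x => h k x * V arr k x).
  by apply/funext => x; rewrite /Usg; field.
rewrite /Zstep E3 E2 E1.
exact: (Zval_perturbation (e0 k) (eh k) (bh k) (hrho k) (mean_etaN N0 arr k)
  (mean_sampling_mean k arr) (bA k) (bV arr k) (bC k) (oV arr k)).
Qed.

Let rho0 : 0 < rho.
Proof. by rewrite (lt_le_trans ltr01)// (ab_le1 a0 qab). Qed.

Let L0 : 0 < L. Proof. by have /andP[? _] := k01; rewrite divr_gt0// mulr_gt0. Qed.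

Let KC0 : 0 <= KC. Proof. by rewrite addr_ge0 ?(ltW L0)// mulr_ge0. Qed.

(** The sizes are used as divisors; strict positivity is where kappa < 1 enters. *)
Lemma noise_size_gt0 s k : 0 < noise_size s k.
Proof.
have /andP[_ k1] := k01; have b1 : 0 < 1 - kappa by rewrite subr_gt0.
case: s; rewrite /noise_size mulr_gt0// ?exprn_gt0//.
have L2 : 0 < 2 * L by rewrite mulr_gt0.
by rewrite ltr_pwDl ?covrate_ge0// mulr_gt0// exprn_gt0.
Qed.

Section randomness.
Context {dO : measure_display} {Omega : measurableType dO}.
Variable P : probability Omega R.
Variable xi : nat -> 'I_N -> {RV P >-> X}.
Hypothesis ps : particle_system mu pi f g th y P xi.

Notation arr w := (fun k j => xi k j w).

Let gens k : set (set Omega) := [set A | exists l j B,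
  [/\ (l < k)%N, measurable B & A = xi l j @^-1` B]].

(** Conditioning on the past is conditioning on a random element: [Omega] itself with the coarser
    sigma-algebra, reached by the identity map. *)
Let Past k := g_sigma_algebraType (gens k).

Let mpast k : measurable_fun setT (id : Omega -> Past k).
Proof.
move=> _ B mB; rewrite setTI preimage_id.
move: B mB; apply: smallest_sub; first exact: sigma_algebra_measurable.
by move=> _ [l [j [B [_ mB ->]]]]; rewrite -[_ @^-1` _]setTI; exact: measurable_funP.
Qed.

Let mxi_past k l j : (l < k)%N -> measurable_fun setT (xi l j : Past k -> X).
Proof.
move=> lk _ B mB; rewrite setTI; apply: sub_sigma_algebra.
by exists l, j, B.
Qed.

Let mpk k : measurable_fun setT (fun z : Past k * X => sampling_density k (arr z.1) z.2).
Proof.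
case: k => [|k].
  by have [mpi _ _] := dpi; exact: (measurableT_comp mpi measurable_snd).
have mxk j : measurable_fun setT (fun z : Past k.+1 * X => xi k j z.1).
  by apply: measurableT_comp measurable_fst; exact: mxi_past.
apply: measurable_funM.
  apply: measurable_sum => j; apply: measurable_funM; last first.
    exact: (measurableT_comp (mg k) (mxk j)).
  have [mf _] := df.
  exact: (measurableT_comp mf (measurable_fun_pair measurable_snd (mxk j))).
apply: measurable_fun_inv.
  by apply: measurable_sum => j; exact: (measurableT_comp (mg k) (mxk j)).
move=> z; rewrite (bigD1 (Ordinal N0))//= ltr_pwDl// sumr_ge0// => j _; exact: ltW.
Qed.

Let bVj k : bmf (fun z : Past k * X => tau (arr z.1) k z.2 + U k z.2).
Proof.
apply: bmfD; last exact: (bmf_comp (bU k) (@measurable_snd _ _ (Past k) X)).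
apply: (bmf_tauN_joint (n := k) (xi := fun l j => xi l j : Past k -> X)
  a0 mq qab mt tc N0) => // l j lk; exact: mxi_past.
Qed.

Let bnoise s k : bmf (fun z : Past k * X => noise s k (arr z.1) z.2).
Proof.
have dpk (w : Past k) := sampling_densityP k (arr w).
case: s.
  have bc := bmf_centered_joint (@mpk k) dpk (e0 k) (eh k) (bh k)
    (V := fun w => V (arr w) k) (bA k) (oA k) (bC k) (bVj k) (fun w => oV (arr w) k).
  have oc w := osc_centered dpk (e0 k) (eh k) (bh k) w (bA k) (oA k)
    (bV (arr w) k) (oV (arr w) k) (oC k).
  exact: (bmf_cnoise_joint (@mpk k) dpk (e0 k) (eh k) (bh k) (hrho k)
    (F := fun w => centered (sampling_mean k (arr w)) (h k) (A k) (V (arr w) k) (C k)) bc oc).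
have bAj : bmf (fun z : Past k * X => A k z.2).
  exact: (bmf_comp (bA k) (@measurable_snd _ _ (Past k) X)).
exact: (bmf_cnoise_joint (@mpk k) dpk (e0 k) (eh k) (bh k) (hrho k)
  (F := fun _ => A k) bAj (fun _ => oA k)).
Qed.

Let noise_le s k ar x : `|noise s k ar x| <= noise_size s k.
Proof.
(* The array is fixed here, so the lemmas on families of laws are used over a one-point parameter
   space. *)
have dpk (w : unit) := sampling_densityP k ar.
case: s; apply: (cnoise_le (e0 k) (eh k) (bh k) (hrho k) x (mean_sampling_mean k ar)) => //.
  apply: bmfD => //; apply: bmfM; apply: bmfB => //; exact: bmf_cst.
exact: (osc_centered dpk (e0 k) (eh k) (bh k) tt (bA k) (oA k)
    (bV ar k) (oV ar k) (oC k)).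
Qed.

Let noise_mean s k ar : sampling_mean k ar (noise s k ar) = 0.
Proof.
case: s; apply: (mean_cnoise (e0 k) (eh k) (bh k) (mean_sampling_mean k ar)) => //.
by apply: bmfD => //; apply: bmfM; apply: bmfB => //; exact: bmf_cst.
Qed.

Let kernelE k ar B : particle_kernel mu pi f g th y k (ar k.-1) B =
  (\int[mu]_(x in B) (sampling_density k ar x)%:E)%E.
Proof. by case: k. Qed.

Lemma noise_exp_moment s k :
  (\int[P]_w (expR `|Num.sqrt N%:R * etaN (arr w) k (noise s k (arr w)) /
     (2 * noise_size s k)|)%:E <= (2 * expR 1)%:E)%E.
Proof.
have dpk (w : Past k) := sampling_densityP k (arr w).
have ci (A' : set (Past k)) (B' : 'I_N -> set X) : measurable A' ->
    (forall j, measurable (B' j)) ->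
    P (id @^-1` A' `&` \bigcap_j xi k j @^-1` B' j) =
    (\int[P]_(w in id @^-1` A') \prod_(j < N) \int[mu]_(x in B' j)
      (sampling_density k (arr w) x)%:E)%E.
  (* Measurability in [Past k] unfolds to membership in [past], so the defining property of the
     particle system applies as it is. *)
  move=> mA mB; rewrite (ps mA mB).
  by apply: eq_integral => w _; apply: eq_bigr => j _; rewrite -kernelE.
exact: (exponential_moment (P := P) (mu := mu) (W := Past k) (tau := id)
  (xi := fun j => xi k j) (p := fun w => sampling_density k (arr w)) (@mpast k)
  (fun j => @measurable_funP _ _ _ _ _ (xi k j)) (@mpk k) dpk ci N0
  (noise_size_gt0 s k) (bnoise s k)
  (fun z => noise_le s k (arr z.1) z.2) (fun w => noise_mean s k (arr w))).
Qed.

Lemma measurable_noise s k :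
  measurable_fun setT (fun w => etaN (arr w) k (noise s k (arr w))).
Proof.
apply: measurable_funM; first exact: measurable_cst.
apply: measurable_sum => j.
have mpair : measurable_fun setT (fun w : Omega => ((w : Past k), xi k j w)).
  by apply: measurable_fun_pair => //; exact: mpast.
exact: (measurableT_comp (bnoise s k).1 mpair).
Qed.

Lemma measurable_zetaN :
  measurable_fun setT (fun w => zetaN pi f g th y (arr w) n phi 0 i).
Proof.
have mxj j : measurable_fun setT (fun w => xi n j w) by [].
have mphi j : measurable_fun setT (fun w => phi (xi n j w)).
  exact: (measurableT_comp bphi.1 (mxj j)).
have mtau j : measurable_fun setT (fun w => tau (arr w) n (xi n j w)).
  have := bmf_tauN_joint (n := n) (xi := fun l j => xi l j : Omega -> X)
    a0 mq qab mt tc N0 (fun l j _ => @measurable_funP _ _ _ _ _ _) (leqnn n).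
  move=> [mt' _]; exact: (measurableT_comp mt'
    (measurable_fun_pair (@measurable_id _ _ setT) (mxj j))).
rewrite (_ : (fun w => _) = (fun w =>
    etaN (arr w) n (fun x => tau (arr w) n x * phi x) -
    etaN (arr w) n phi * etaN (arr w) n (tau (arr w) n))); last first.
  apply/funext => w; rewrite (zetaNE mu N0 q0 n bphi (btau _) (fun k x => bmf_tM2 mt tc k x)).
  rewrite /Zval /hsg /= (mean1 (mean_etaN N0 _ n)) expr1n !divr1.
  by congr (_ - _ * _); rewrite /etaN; congr (_ * _); apply: eq_bigr => j _;
    rewrite ?mulr1 addr0.
apply: measurable_funB; last apply: measurable_funM.
- apply: measurable_funM; first exact: measurable_cst.
  by apply: measurable_sum => j; exact: measurable_funM.
- apply: measurable_funM; first exact: measurable_cst.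
  by apply: measurable_sum => j; exact: mphi.
- apply: measurable_funM; first exact: measurable_cst.
  by apply: measurable_sum => j; exact: mtau.
Qed.

(* A bound on the sum over k <= n, uniform in n, of the sizes of both noises
   weighted as in local_error. *)
Definition total_size : R := 2 * rho ^+ 2 * (3 * L / kappa + KC / kappa ^+ 2).

Lemma total_size_gt0 : 0 < total_size.
Proof.
have /andP[k0 _] := k01.
have s0 : 0 < 3 * L / kappa by rewrite divr_gt0// mulr_gt0.
have s1 : 0 <= KC / kappa ^+ 2 by rewrite divr_ge0// exprn_ge0// ltW.
exact: (mulr_gt0 (mulr_gt0 (ltr0Sn _ 1) (exprn_gt0 2 rho0)) (ltr_pwDl s0 s1)).
Qed.

(** The factor that turns the normalized noise of [noise_exp_moment] back into its term in
    [local_error]. *)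
Let weight (j : 'I_n.+1 * bool) : R :=
  rho * (if j.2 then 1 else L) * (2 * noise_size j.2 j.1) / Num.sqrt N%:R.

Let sqN0 : 0 < Num.sqrt (N%:R : R). Proof. by rewrite sqrtr_gt0 ltr0n. Qed.

Let weight_ge0 j : 0 <= weight j.
Proof.
have w0 : 0 <= (if j.2 then 1 else L) by case: ifP => // _; exact: ltW.
have s0 : 0 <= 2 * noise_size j.2 j.1 by rewrite mulr_ge0 ?(ltW (noise_size_gt0 _ _)).
exact: (divr_ge0 (mulr_ge0 (mulr_ge0 (ltW rho0) w0) s0) (ltW sqN0)).
Qed.

Let sum_weight : \sum_j weight j <= total_size / Num.sqrt N%:R.
Proof.
rewrite -(pair_bigA _ (fun (k : 'I_n.+1) s => weight (k, s))) /=.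
rewrite (eq_bigr (fun k : 'I_n.+1 => 2 * rho ^+ 2 / Num.sqrt N%:R *
    (3 * L * (1 - kappa) ^+ (n - k) + covrate kappa KC (n - k)))); last first.
  (* The constant 3 L collects 2 L from the centred product and L from the coefficient of the noise
     of A. *)
  by move=> k _; rewrite big_bool /weight /noise_size /=; ring.
rewrite -mulr_sumr big_split /= -mulr_sumr.
have rev (F : nat -> R) : \sum_(k < n.+1) F (n - k)%N = \sum_(k < n.+1) F k.
  rewrite (reindex_inj rev_ord_inj) /=; apply: eq_bigr => k _.
  by rewrite subSS subKn// -ltnS.
rewrite (rev (fun k => (1 - kappa) ^+ k)) (rev (covrate kappa KC)).
rewrite /total_size [leRHS]mulrAC ler_pM2l; last first.
  exact: (divr_gt0 (mulr_gt0 (ltr0Sn _ 1) (exprn_gt0 2 rho0)) sqN0).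
apply: lerD; last first.
  exact: (sum_covrate_le k01' n.+1 KC0).
rewrite ler_pM2l; last exact: (mulr_gt0 (ltr0Sn _ 2) L0).
exact: sum_geometric_le k01' _.
Qed.

Lemma component_exp_moment :
  (\int[P]_w (expR (`|zetaN pi f g th y (arr w) n phi 0 i -
      zeta mu pi f g th y n phi 0 i| / (total_size / Num.sqrt N%:R)))%:E
   <= (2 * expR 1)%:E)%E.
Proof.
pose Zj (j : 'I_n.+1 * bool) w := `|Num.sqrt N%:R * etaN (arr w) j.1 (noise j.2 j.1 (arr w)) /
     (2 * noise_size j.2 j.1)|.
apply: (exp_moment_sum (a := weight) (Z := Zj)) => //.
- exact: divr_gt0 total_size_gt0 sqN0.
- have := @expR_ge1Dx R 1; lra.
- move=> j; apply: measurableT_comp => //; apply: measurable_funM => //.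
  apply: measurable_funM => //; exact: measurable_noise.
- apply: measurableT_comp => //; apply: measurable_funB => //.
  exact: measurable_zetaN.
- by move=> j; exact: noise_exp_moment.
move=> w; rewrite telescoping (le_trans (ler_norm_sum _ _ _))//.
rewrite -(pair_bigA _ (fun (k : 'I_n.+1) s => weight (k, s) * Zj (k, s) w)) /=.
apply: ler_sum => k _; rewrite (le_trans (local_error _ _))// big_bool /=.
rewrite mulrDr le_eqVlt; apply/orP; left; apply/eqP.
have WZ s : weight (k, s) * Zj (k, s) w =
    rho * (if s then 1 else L) * `|etaN (arr w) k (noise s k (arr w))|.
  have ns0 := noise_size_gt0 s k.
  rewrite /weight /Zj /= normrM normrM (gtr0_norm sqN0).
  rewrite normfV (ger0_norm (_ : 0 <= 2 * noise_size s k)); last by rewrite mulr_ge0// ltW.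
  move: (rho * _) (noise_size s k) (Num.sqrt _) `|_| ns0 sqN0 => u v z e v0 z0.
  by field; rewrite (gt_eqF v0) (gt_eqF z0).
by rewrite !WZ mulr1 mulrA.
Qed.

End randomness.

End error_bound.

(** * From coordinates to the Euclidean norm *)

Lemma enorm_le_sum {R : realType} d (v : 'rV[R]_d) : enorm v <= \sum_(i < d) `|v 0 i|.
Proof.
have s0 : 0 <= \sum_(i < d) `|v 0 i| by exact: sumr_ge0.
rewrite -(ger0_norm s0) -sqrtr_sqr ler_wsqrtr// expr2 mulr_suml.
apply: ler_sum => i _; rewrite -real_normK ?num_real// expr2 ler_wpM2l//.
by rewrite (bigD1 i)//= lerDl sumr_ge0.
Qed.

Lemma measurable_enorm {R : realType} d dO (Omega : measurableType dO)
    (v : Omega -> 'rV[R]_d) :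
  (forall i, measurable_fun setT (fun w => v w 0 i)) ->
  measurable_fun setT (fun w => enorm (v w)).
Proof.
move=> mv; have msqrt : measurable_fun setT (@Num.sqrt R).
  by apply: continuous_measurable_fun; exact: sqrt_continuous.
apply: (measurableT_comp msqrt).
by apply: measurable_sum => i; exact: measurable_funX.
Qed.

Theorem theorem3p1 (R : realType) (d : nat) (dX dY : measure_display)
    (X : measurableType dX) (Y : measurableType dY)
    (mu : {measure set X -> \bar R}) (nu : {measure set Y -> \bar R})
    (Theta : set 'rV[R]_d)
    (pi : 'rV[R]_d -> X -> R) (f : 'rV[R]_d -> X -> X -> R)
    (g : 'rV[R]_d -> Y -> X -> R) :
  state_space_model mu nu Theta pi f g ->
  condition_A mu nu Theta pi f g ->
  forall r : R, 1 <= r ->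
  exists C : R,
  forall (th : 'rV[R]_d) (y : nat -> Y) (n N : nat) (phi : X -> R),
    Theta th -> (1 <= N)%N -> Osc1 phi ->
  forall (dO : measure_display) (Omega : measurableType dO)
    (P : probability Omega R) (xi : nat -> 'I_N -> {RV P >-> X}),
    particle_system mu pi f g th y P xi ->
    ((Num.sqrt N%:R)%:E *
     'E_P[fun w =>
            (enorm (zetaN pi f g th y (fun k i => xi k i w) n phi -
                   zeta mu pi f g th y n phi) `^ r)%R] `^ r^-1 <= C%:E)%E.
Proof.
move=> ssm [muoo _ [rho [delta [c [rho0 delta0 c0 bounds]]]]] r r1.
have [mu' mu'E] := exists_finite_measure muoo.
rewrite -{}mu'E {muoo mu} in ssm *.
set a := delta^-1 * rho^-1; set b := delta * rho.
have a0 : 0 < a by rewrite mulr_gt0 ?invr_gt0.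
have b0 : 0 < b by rewrite mulr_gt0.
have c20 : 0 < 2 * c by rewrite mulr_gt0.
(* Halving keeps kappa strictly below 1 even when a = b; [2 * c] is the bound on the coordinates of
   the score. *)
pose kappa := (a / b) ^+ 2 / 2; pose S := total_size a b (2 * c) kappa.
(* Here 2 e is the exponential moment, r comes from passing to the r-th moment, and d + 1 rather
   than d coordinates keep the scale positive when d = 0. *)
exists (r * (d.+1%:R * S) * (2 * expR 1)).
move=> th y n N phi Tth N0 [mphi [B phiB] ophi] dO Omega P xi ps.
have [dpi df [mg _]] := ssm.2 _ Tth.
have mgy k : measurable_fun setT (g th (y k)).
  exact: (measurableT_comp mg (pair1_measurable (y k))).
have qab := q_bounds rho0 delta0 bounds y Tth.
have mq k := measurable_q ssm y k Tth.
have mt i k := measurable_score ssm rho0 delta0 bounds y i Tth k.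
have tc i k x x' := score_le ssm rho0 delta0 bounds y i Tth k x x'.
have g0 := g_gt0 delta0 bounds y Tth.
have ab1 : a / b <= 1.
  have /andP[q1 q2] := qab 0 point point.
  by rewrite ler_pdivrMr// mul1r (le_trans q1 q2).
have ab0 : 0 < (a / b) ^+ 2 by rewrite exprn_gt0// divr_gt0.
have ab2 : (a / b) ^+ 2 <= 1 by rewrite exprn_ile1// ltW// divr_gt0.
have /andP[kab k01] : (kappa <= (a / b) ^+ 2) && (0 < kappa < 1).
  by rewrite /kappa; move: (_ ^+ 2) ab0 ab2 => t t0 t1; apply/and3P; split; lra.
(* A null dominating measure could not carry a density of total mass 1. *)
have muT : (0 < mu' setT)%E.
  rewrite lt0e measure_ge0 andbT; apply/eqP => mu0.
  have [mpi _ pi1] := dpi.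
  have : (\int[mu']_x (pi th x)%:E = 0)%E.
    by apply: null_set_integral => //; exact/measurable_EFinP.
  by rewrite pi1 => /eqP; rewrite eqe oner_eq0.
have bphi : bmf phi by split=> //; exists B.
have ophi' : osc_le phi 1 by move=> x x'; exact: le_trans (ler_norm _) (ophi x x').
have sN : 0 < Num.sqrt (N%:R : R) by rewrite sqrtr_gt0 ltr0n.
have S0 : 0 < S := total_size_gt0 a0 c20 qab k01.
pose err w := zetaN pi f g th y (fun k i => xi k i w) n phi -
  zeta mu' pi f g th y n phi.
have errE i w : err w 0 i = zetaN pi f g th y (fun k i => xi k i w) n phi 0 i -
    zeta mu' pi f g th y n phi 0 i.
  by rewrite /err mxE [X in _ + X]mxE.
have merr i : measurable_fun setT (fun w => err w 0 i).
  under eq_fun do rewrite errE.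
  apply: measurable_funB; last exact: measurable_cst.
  exact: (measurable_zetaN mu' a0 mq qab (mt i) (tc i) N0 n bphi xi).
have errB i : (\int[P]_w (expR (`|err w 0 i| / (S / Num.sqrt N%:R)))%:E <=
    (2 * expR 1)%:E)%E.
  under eq_integral do rewrite errE.
  exact: (component_exp_moment a0 c20 mq mgy qab (mt i) (tc i) g0 dpi df muT
    k01 kab N0 n bphi ophi' ps).
have B1 : 1 <= 2 * expR 1 :> R by have := @expR_ge1Dx R 1; lra.
have dS0 : 0 < d.+1%:R * S / Num.sqrt N%:R by rewrite divr_gt0// mulr_gt0.
have expB : (\int[P]_w (expR (enorm (err w) / (d.+1%:R * S / Num.sqrt N%:R)))%:E
    <= (2 * expR 1)%:E)%E.
  apply: (exp_moment_sum (a := fun i : 'I_d => S / Num.sqrt N%:R)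
    (Z := fun i w => `|err w 0 i| / (S / Num.sqrt N%:R))) => //.
  - by move=> i; rewrite divr_ge0// ltW.
  - rewrite sumr_const card_ord -[leRHS]mulrA mulr_natl ler_wpMn2l//.
    by rewrite divr_ge0// ltW.
  - move=> i; apply: measurable_funM; last exact: measurable_cst.
    exact: measurableT_comp.
  - exact: measurable_enorm.
  move=> w; rewrite (le_trans (enorm_le_sum _))// ler_sum// => i _.
  by rewrite mulrC divfK// gt_eqF// divr_gt0.
have := exp_moment_Lnorm r1 dS0 B1 (measurable_enorm merr) (fun w => sqrtr_ge0 _) expB.
move=> H; rewrite unlock.
apply: (@le_trans _ _ ((Num.sqrt N%:R)%:E *
  (r * (d.+1%:R * S / Num.sqrt N%:R) * (2 * expR 1))%:E)%E).
  by apply: lee_wpmul2l => //; rewrite lee_fin ltW.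
rewrite -EFinM lee_fin.
suff -> : Num.sqrt N%:R * (r * (d.+1%:R * S / Num.sqrt N%:R) * (2 * expR 1)) =
  r * (d.+1%:R * S) * (2 * expR 1) by [].
by move: (d.+1%:R * S) (expR 1) => u v; field; rewrite gt_eqF.
Qed.
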